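(* In the setting of the context, let $M_{\mathrm{opt}}$ on $X=L^2([0,t_f],\mathbb R^n\times\mathbb R^m)\times X_\lambda$ be given by $$M_{\mathrm{opt}}\big(x,u,(\lambda,\lambda_0)\big)=\begin{bmatrix} \nabla J(x,u)-\mathcal C^*\begin{bmatrix} \lambda \\ \lambda_0 \end{bmatrix} \\ \mathcal C\begin{bmatrix} x \\ u \end{bmatrix} \end{bmatrix},\qquad D(M_{\mathrm{opt}})=D(\mathcal C)\times D(\mathcal C^* ),$$ and let $\mathcal B=\begin{bmatrix} 0 \\ I \end{bmatrix}:X_\lambda\to X$. The optimizer dynamics, in the virtual time $t\ge0$ and with state $w(t)=(x(t),u(t),\lambda(t),\lambda_0(t))\in X$, $$\tfrac{\mathrm d}{\mathrm dt}w(t)=-M_{\mathrm{opt}}(w(t))+\mathcal Bu_{\mathrm{opt}}(t),\qquad y_{\mathrm{opt}}(t)=\mathcal B^*w(t)=\begin{bmatrix} \lambda(t) \\ \lambda_0(t) \end{bmatrix},\qquad u_{\mathrm{opt}}(t)\equiv\begin{bmatrix} f \\ x^0 \end{bmatrix},$$ is a maximally monotone port-Hamiltonian system. Furthermore, let $(\hat x,\hat u,\hat\lambda,\hat\lambda_0)\in D(\mathcal C)\times D(\mathcal C^* )$ be the unique solution of the optimality conditions $M_{\mathrm{opt}}(\hat x,\hat u,(\hat\lambda,\hat\lambda_0))=(0,0,f,x^0)$ (so that $(\hat x,\hat u)$ is the unique optimal solution of the optimal control problem), and assume that $J$ is twice differentiable and locally strictly convex with quadratic growth, i.e. there exists $c_{\hat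 x}>0$ such that for all $x$ in a neighborhood of $\hat x$ $$\langle\nabla_xJ(x)-\nabla_xJ(\hat x),x-\hat x\rangle\ge c_{\hat x}\|x-\hat x\|^2 .$$ Then for all initial values $(x(0),u(0),\lambda(0),\lambda_0(0))\in D(\mathcal C)\times D(\mathcal C^* )$ the strong solutions of the optimizer dynamics satisfy $$(x(t),u(t),\lambda(t),\lambda_0(t))\to(\hat x,\hat u,\hat\lambda,\hat\lambda_0)\quad\text{as }t\to\infty .$$ Further, there exists $\delta>0$ such that if the initial Lagrange multiplier satisfies $\|(\lambda(0)-\hat\lambda,\lambda_0(0)-\hat\lambda_0)\|_{L^2([0,t_f],\mathbb R^n)\times\mathbb R^n}<\delta$, then the convergence is exponential.
   Context: Optimal control problem: let $t_f>0$, $A\in\mathbb R^{n\times n}$, $B\in\mathbb R^{n\times m}$, $f\in L^2([0,t_f],\mathbb R^n)$, $x^0\in\mathbb R^n$, $\alpha>0$, and consider $$\min_{(x,u)\in H^1([0,t_f],\mathbb R^n)\times L^2([0,t_f],\mathbb R^m)}J(x,u)\quad\text{s.t.}\quad\dot x=Ax+Bu+f,\ x(0)=x^0,$$ where $J:L^2([0,t_f],\mathbb R^n)\times L^2([0,t_f],\mathbb R^m)\to\mathbb R$, $J(x,u)=\int_0^{t_f}\ell_x(x(\tau))+\frac\alpha2\|u(\tau)\|^2\,\mathrm d\tau$. Here $\ell_x:\mathbb R^n\to[0,\infty)$ is continuous and convex, $\ell_x(x(\cdot))\in L^1([0,t_f],\mathbb R)$ for all $x\in L^2([0,t_f],\mathbb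 R^n)$, and the $L^2$-gradient $\nabla_xJ(x)$ of $x\mapsto\int_0^{t_f}\ell_x(x(\tau))\,\mathrm d\tau$ (Fréchet) exists for all $x\in L^2([0,t_f],\mathbb R^n)$; thus $\nabla J(x,u)=(\nabla_xJ(x),\alpha u)$. Let $X_\lambda=L^2([0,t_f],\mathbb R^n)\times\mathbb R^n$. The constraint operator $\mathcal C:L^2([0,t_f],\mathbb R^n\times\mathbb R^m)\supset D(\mathcal C)\to X_\lambda$ is $D(\mathcal C)=H^1([0,t_f],\mathbb R^n)\times L^2([0,t_f],\mathbb R^m)$, $\mathcal C(x,u)=(\tfrac{\mathrm d}{\mathrm d\tau}x-Ax-Bu,\ x(0))$, and $\mathcal C^*$ is its Hilbert space adjoint. A monotone port-Hamiltonian system on a real Hilbert space $X$ with real Hilbert input space $U$ is a system $\tfrac{\mathrm d}{\mathrm dt}w=-M(w)+\mathcal Bu$, $y=\mathcal B^*w$ with $\mathcal B:U\to X$ linear bounded and $M:X\supseteq D(M)\to X$ accretive, i.e. $\langle M(w_1)-M(w_2),w_1-w_2\rangle\ge0$ for all $w_1,w_2\in D(M)$; it is maximally monotone if $M$ is m-accretive, i.e. additionally $\operatorname{ran}(\mu I+M)=X$ for some (equivalently all) $\mu>0$. A strong solution on $[0,T]$ is a function in $C([0,T],X)\cap W^{1,1}((0,T],X)$, differentiable almost everywhere, attaining the initial value and satisfying the differential equation for almost every $t$; on $[0,\infty)$ this is required on every finite interval. *)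

(* Defs.v *)
From HB Require Import structures.
From mathcomp Require Import all_boot all_order all_algebra.
From mathcomp Require Import all_classical all_reals all_analysis.
From mathcomp Require Import ring lra.

Set Implicit Arguments.
Unset Strict Implicit.
Unset Printing Implicit Defensive.

Import Order.TTheory GRing.Theory Num.Theory.
Import numFieldNormedType.Exports.

Local Open Scope classical_set_scope.
Local Open Scope ring_scope.

(* Normed modules whose norm comes from an inner product; completeness is not
   part of the structure. *)
HB.mixin Record NormedModule_isInnerProduct (R : realType) V
    & NormedModule R V := {
  inner : V -> V -> R;
  innerC : forall x y, inner x y = inner y x;
  inner_linear : forall a x y z,
    inner (a *: x + y) z = a * inner x z + inner y z;
  inner_norm : forall x, inner x x = `|x| ^+ 2
}.

#[short(type="innerProductType")]
HB.structure Definition InnerProduct (R : realType) :=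
  {V of NormedModule R V & NormedModule_isInnerProduct R V}.

HB.factory Record Lmodule_isInnerProduct (R : realType) V
    & GRing.Lmodule R V := {
  inner : V -> V -> R;
  innerC : forall x y, inner x y = inner y x;
  inner_linear : forall a x y z,
    inner (a *: x + y) z = a * inner x z + inner y z;
  inner_ge0 : forall x, 0 <= inner x x;
  inner_eq0 : forall x, inner x x = 0 -> x = 0
}.

HB.builders Context (R : realType) V & Lmodule_isInnerProduct R V.

Let norm (x : V) : R := Num.sqrt (inner x x).

Let innerDl x y z : inner (x + y) z = inner x z + inner y z.
Proof. by rewrite -{1}[x]scale1r inner_linear mul1r. Qed.

Let inner0l z : inner 0 z = 0.
Proof. by apply: (addrI (inner 0 z)); rewrite addr0 -innerDl addr0. Qed.

Let innerZl a x z : inner (a *: x) z = a * inner x z.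
Proof. by rewrite -[a *: x]addr0 inner_linear inner0l addr0. Qed.

Let innerDr x y z : inner z (x + y) = inner z x + inner z y.
Proof. by rewrite innerC innerDl !(innerC z). Qed.

Let innerZr a x z : inner z (a *: x) = a * inner z x.
Proof. by rewrite innerC innerZl (innerC z). Qed.

Let norm_sqr x : norm x ^+ 2 = inner x x.
Proof. by rewrite sqr_sqrtr ?inner_ge0. Qed.

Let cauchy_schwarz x y : inner x y <= norm x * norm y.
Proof.
have [->|x0] := eqVneq x 0; first by rewrite inner0l mulr_ge0 ?sqrtr_ge0.
have nx : 0 < norm x.
  rewrite sqrtr_gt0 lt_neqAle inner_ge0 andbT eq_sym.
  by apply: contra_neq x0; exact: inner_eq0.
have := inner_ge0 (norm y *: x + (- norm x) *: y).
rewrite !(innerDl, innerDr, innerZl, innerZr) (innerC y x) -!norm_sqr => h.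
have [->|y0] := eqVneq y 0; first by rewrite innerC inner0l mulr_ge0 ?sqrtr_ge0.
have ny : 0 < norm y.
  rewrite sqrtr_gt0 lt_neqAle inner_ge0 andbT eq_sym.
  by apply: contra_neq y0; exact: inner_eq0.
rewrite -(ler_pM2l (mulr_gt0 nx ny)).
set a := norm x in h *; set b := norm y in h *; set c := inner x y in h *.
rewrite -subr_ge0; rewrite -(pmulr_rge0 _ (ltr0n R 2 : 0 < 2)).
apply: le_trans h _.
rewrite le_eqVlt; apply/orP; left; apply/eqP.
by rewrite !mulNr !mulrN opprK; ring.
Qed.

Let normD x y : norm (x + y) <= norm x + norm y.
Proof.
rewrite -(@ler_pXn2r _ 2) ?nnegrE ?addr_ge0 ?sqrtr_ge0//.
rewrite sqrrD !norm_sqr innerDl !innerDr (innerC y x).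
by have := cauchy_schwarz x y; lra.
Qed.

Let normZ a x : norm (a *: x) = `|a| * norm x.
Proof.
rewrite /norm innerZl innerZr mulrA -expr2 sqrtrM ?sqr_ge0//.
by rewrite sqrtr_sqr.
Qed.

Let norm0_eq0 x : norm x = 0 -> x = 0.
Proof. by move=> nx; apply: inner_eq0; rewrite -norm_sqr nx expr0n. Qed.

HB.instance Definition _ := Lmodule_isNormed.Build R V normD normZ norm0_eq0.

Let norm_def x : inner x x = `|x| ^+ 2.
Proof. by rewrite -norm_sqr. Qed.

HB.instance Definition _ := NormedModule_isInnerProduct.Build R V
  innerC inner_linear norm_def.

HB.end.

(* R^n with the Euclidean norm; 'cV[R]_n itself carries the max norm. *)
Definition euclid (R : realType) (n : nat) : Type := 'cV[R]_n.

Section euclid.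
Context (R : realType) (n : nat).
Local Notation E := (euclid R n).

HB.instance Definition _ := GRing.Lmodule.copy E 'cV[R]_n.

Let dot (x y : E) : R := \sum_(i < n) x i 0 * y i 0.

Let dotC x y : dot x y = dot y x.
Proof. by apply: eq_bigr => i _; rewrite mulrC. Qed.

Let dot_linear a x y z : dot (a *: x + y) z = a * dot x z + dot y z.
Proof.
rewrite mulr_sumr -big_split; apply: eq_bigr => i _ /=.
by rewrite !mxE mulrDl mulrA.
Qed.

Let dot_ge0 x : 0 <= dot x x.
Proof. by apply: sumr_ge0 => i _; rewrite -expr2 sqr_ge0. Qed.

Let dot_eq0 x : dot x x = 0 -> x = 0.
Proof.
move=> /eqP; rewrite psumr_eq0; last by move=> i _; rewrite -expr2 sqr_ge0.
move=> /allP x0; apply/matrixP => i j; rewrite ord1 mxE.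
have := x0 i (mem_index_enum _); rewrite -expr2 sqrf_eq0.
by move=> /eqP.
Qed.

HB.instance Definition _ :=
  Lmodule_isInnerProduct.Build R E dotC dot_linear dot_ge0 dot_eq0.

Lemma euclid_innerE (x y : E) : inner x y = \sum_(i < n) x i 0 * y i 0.
Proof. by []. Qed.

End euclid.

(* The product with the Hilbert space norm; U * V itself carries the max norm. *)
Definition hprod (R : realType) (U V : innerProductType R) : Type := (U * V)%type.

Section hprod.
Context (R : realType) (U V : innerProductType R).
Local Notation P := (hprod U V).

HB.instance Definition _ := GRing.Lmodule.copy P (U * V)%type.

Let dot (x y : P) : R := inner x.1 y.1 + inner x.2 y.2.

Let dotC x y : dot x y = dot y x.
Proof. by rewrite /dot innerC (innerC x.2). Qed.

Let dot_linear a x y z : dot (a *: x + y) z = a * dot x z + dot y z.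
Proof. by rewrite /dot /= !inner_linear mulrDr addrACA. Qed.

Let dot_ge0 x : 0 <= dot x x.
Proof. by rewrite /dot !inner_norm addr_ge0 ?sqr_ge0. Qed.

Let dot_eq0 x : dot x x = 0 -> x = 0.
Proof.
move=> /eqP; rewrite /dot !inner_norm paddr_eq0 ?sqr_ge0//.
rewrite !sqrf_eq0 !normr_eq0 => /andP[/eqP x1 /eqP x2].
by rewrite [x]surjective_pairing x1 x2.
Qed.

HB.instance Definition _ :=
  Lmodule_isInnerProduct.Build R P dotC dot_linear dot_ge0 dot_eq0.

Lemma hprod_innerE (x y : P) : inner x y = inner x.1 y.1 + inner x.2 y.2.
Proof. by []. Qed.

End hprod.

(* Lebesgue measure restricted to the horizon [0, tf]: functions live on R but
   only their values on [0, tf] matter. *)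
(* Lebesgue measure restricted to the horizon [0, tf]: functions live on R but
   only their values on [0, tf] matter. *)
(* Lebesgue measure restricted to the horizon [0, tf]: functions live on R but
   only their values on [0, tf] matter. *)
(* Lebesgue measure restricted to the horizon [0, tf]: functions live on R but
   only their values on [0, tf] matter. *)
(* Lebesgue measure restricted to the horizon [0, tf]: functions live on R but
   only their values on [0, tf] matter. *)
Definition lebesgue_on (R : realType) (tf : R) :
    {measure set (measurableTypeR R) -> \bar R} :=
  mrestr (@lebesgue_measure R) (measurable_itv `[0, tf]).

Section L2fun.
Context (R : realType) (tf : R) (n : nat).
Local Notation mu := (lebesgue_on tf).

(* Square integrability is required componentwise. *)
(* Square integrability is required componentwise. *)
(* Square integrability is required componentwise. *)
(* Square integrability is required componentwise. *)
(* Square integrability is required componentwise. *)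
Definition L2_pred : {pred R -> euclid R n} :=
  fun f => `[< forall i, (fun t : R => f t i 0) \in Lfun mu 2%:E >].

Lemma L2_predP (f : R -> euclid R n) :
  reflect (forall i, (fun t : R => f t i 0) \in Lfun mu 2%:E) (f \in L2_pred).
Proof. exact: asboolP. Qed.

Let Lfun2_closed : submod_closed (Lfun mu 2%:E).
Proof. by apply: Lfun_submod_closed; rewrite lee_fin ler1n. Qed.

Lemma L2_pred_submod_closed : submod_closed L2_pred.
Proof.
have [L0 LD] := Lfun2_closed; split.
  apply/L2_predP => i; rewrite (_ : (fun t => _) = 0)//.
  by apply/funext => t /=; rewrite mxE.
move=> a f g /L2_predP fL /L2_predP gL; apply/L2_predP => i.
rewrite (_ : (fun t => _) = a *: ((fun t => f t i 0) : R -> R^o) + (fun t => g t i 0)).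
  exact: LD.
by apply/funext => t; rewrite /= !mxE.
Qed.

HB.instance Definition _ :=
  GRing.isSubmodClosed.Build R (R -> euclid R n) L2_pred L2_pred_submod_closed.

Record L2fun := MkL2fun {
  L2fun_val :> R -> euclid R n;
  _ : L2fun_val \in L2_pred
}.

HB.instance Definition _ := [isSub for L2fun_val].
HB.instance Definition _ := [Choice of L2fun by <:].
HB.instance Definition _ := [SubChoice_isSubLmodule of L2fun by <:].

Let aeS (P Q : R -> Prop) : (forall t, P t -> Q t) ->
  (\forall t \ae mu, P t) -> (\forall t \ae mu, Q t).
Proof. by move=> PQ; apply: (@filterS _ _ (ae_filter_ringOfSetsType mu)). Qed.

Let aeS2 (P Q S : R -> Prop) : (forall t, P t -> Q t -> S t) ->
  (\forall t \ae mu, P t) -> (\forall t \ae mu, Q t) -> (\forall t \ae mu, S t).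
Proof. by move=> PQ; apply: (@filterS2 _ _ (ae_filter_ringOfSetsType mu)). Qed.

Definition L2_ae_eq : rel L2fun :=
  fun f g => `[< (f : R -> euclid R n) = g %[ae mu] >].

Let L2_ae_eq_refl : reflexive L2_ae_eq.
Proof. by move=> f; apply/asboolP; exact: aeW. Qed.

Let L2_ae_eq_sym : symmetric L2_ae_eq.
Proof.
by move=> f g; apply/asboolP/asboolP; apply: aeS => t /(_ I) h _; rewrite h.
Qed.

Let L2_ae_eq_trans : transitive L2_ae_eq.
Proof.
move=> g f h /asboolP fg /asboolP gh; apply/asboolP.
by apply: aeS2 fg gh => t /(_ I) fg /(_ I) gh _; rewrite fg.
Qed.

Canonical L2_ae_eq_equiv :=
  EquivRel L2_ae_eq L2_ae_eq_refl L2_ae_eq_sym L2_ae_eq_trans.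

Local Open Scope quotient_scope.

(* L^2([0, tf], R^n): square-integrable functions modulo a.e. equality. The
   record seals the quotient, which is expensive to unfold in unification. *)
Record L2 := MkL2 { L2_quot : {eq_quot L2_ae_eq} }.

HB.instance Definition _ := [isNew for L2_quot].
HB.instance Definition _ := [Choice of L2 by <:].

Definition L2_class (f : L2fun) : L2 := MkL2 (\pi f).

Definition L2_repr (p : L2) : L2fun := repr (L2_quot p).

Definition L2_rep (p : L2) : R -> euclid R n := L2_repr p.

Lemma L2_classP (f g : L2fun) :
  (L2_class f = L2_class g) <-> ((f : R -> euclid R n) = g %[ae mu]).
Proof.
split=> [[/eqmodP/asboolP//]|fg].
by congr MkL2; apply/eqmodP/asboolP.
Qed.

Lemma L2_reprK (p : L2) : L2_class (L2_repr p) = p.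
Proof. by case: p => p; rewrite /L2_class /L2_repr reprK. Qed.

Lemma L2_rep_class (f : L2fun) : L2_rep (L2_class f) = f %[ae mu].
Proof. by apply/L2_classP; rewrite L2_reprK. Qed.

Lemma L2_eqP (p q : L2) : p = q <-> L2_rep p = L2_rep q %[ae mu].
Proof. by rewrite -L2_classP !L2_reprK. Qed.

Lemma L2_ind (P : L2 -> Prop) : (forall f, P (L2_class f)) -> forall p, P p.
Proof. by move=> Pc p; rewrite -(L2_reprK p). Qed.

Definition L2_zero : L2 := L2_class 0.
Definition L2_opp (p : L2) : L2 := L2_class (- L2_repr p).
Definition L2_add (p q : L2) : L2 := L2_class (L2_repr p + L2_repr q).
Definition L2_scale (a : R) (p : L2) : L2 := L2_class (a *: L2_repr p).

Let L2_classN f : L2_opp (L2_class f) = L2_class (- f).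
Proof.
apply/L2_classP; apply: aeS (L2_rep_class f) => t /(_ I) h _.
by rewrite [LHS](_ : _ = - L2_rep (L2_class f) t)// h.
Qed.

Let L2_classD' f g : L2_add (L2_class f) (L2_class g) = L2_class (f + g).
Proof.
apply/L2_classP; apply: aeS2 (L2_rep_class f) (L2_rep_class g).
move=> t /(_ I) h1 /(_ I) h2 _.
by rewrite [LHS](_ : _ = L2_rep (L2_class f) t + L2_rep (L2_class g) t)// h1 h2.
Qed.

Let L2_classZ' a f : L2_scale a (L2_class f) = L2_class (a *: f).
Proof.
apply/L2_classP; apply: aeS (L2_rep_class f) => t /(_ I) h _.
by rewrite [LHS](_ : _ = a *: L2_rep (L2_class f) t)// h.
Qed.

Let L2_addA : associative L2_add.
Proof.
by elim/L2_ind=> f; elim/L2_ind=> g; elim/L2_ind=> h; rewrite !L2_classD' addrA.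
Qed.

Let L2_addC : commutative L2_add.
Proof. by elim/L2_ind=> f; elim/L2_ind=> g; rewrite !L2_classD' addrC. Qed.

Let L2_add0 : left_id L2_zero L2_add.
Proof. by elim/L2_ind=> f; rewrite L2_classD' add0r. Qed.

Let L2_addN : left_inverse L2_zero L2_opp L2_add.
Proof. by elim/L2_ind=> f; rewrite L2_classN L2_classD' addNr. Qed.

HB.instance Definition _ :=
  GRing.isZmodule.Build L2 L2_addA L2_addC L2_add0 L2_addN.

Lemma L2_class0 : L2_class 0 = 0.
Proof. by []. Qed.

Lemma L2_classD f g : L2_class (f + g) = L2_class f + L2_class g.
Proof. by rewrite -L2_classD'. Qed.

Let L2_scaleA a b p : L2_scale a (L2_scale b p) = L2_scale (a * b) p.
Proof. by elim/L2_ind: p => f; rewrite !L2_classZ' scalerA. Qed.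

Let L2_scale1 : left_id 1 L2_scale.
Proof. by elim/L2_ind => f; rewrite !L2_classZ' scale1r. Qed.

Let L2_scaleDr : right_distributive L2_scale +%R.
Proof.
by move=> a; elim/L2_ind => f; elim/L2_ind => g;
  rewrite -L2_classD !L2_classZ' scalerDr L2_classD.
Qed.

Let L2_scaleDl p : {morph L2_scale^~ p : a b / a + b}.
Proof.
by move=> a b; elim/L2_ind: p => f; rewrite !L2_classZ' scalerDl L2_classD.
Qed.

HB.instance Definition _ := GRing.Zmodule_isLmodule.Build R L2
  L2_scaleA L2_scale1 L2_scaleDr L2_scaleDl.

Lemma L2_classZ a f : L2_class (a *: f) = a *: L2_class f.
Proof. by rewrite -L2_classZ'. Qed.

Lemma L2_repD (p q : L2) : L2_rep (p + q) = L2_rep p \+ L2_rep q %[ae mu].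
Proof. exact: (L2_rep_class (L2_repr p + L2_repr q)). Qed.

Lemma L2_repZ a (p : L2) : L2_rep (a *: p) = (fun t => a *: L2_rep p t) %[ae mu].
Proof. exact: (L2_rep_class (a *: L2_repr p)). Qed.

Definition L2_dot (p q : L2) : R := \int[mu]_t inner (L2_rep p t) (L2_rep q t).

Lemma L2_repP (p : L2) i : (fun t : R => L2_rep p t i 0) \in Lfun mu 2%:E.
Proof. by rewrite /L2_rep; case: (L2_repr p) => f /= /L2_predP. Qed.

Lemma L2_dot_integrable (p q : L2) :
  mu.-integrable setT (EFin \o (fun t : R => inner (L2_rep p t) (L2_rep q t))).
Proof.
rewrite (_ : _ \o _ = fun t => \sum_(i < n) (L2_rep p t i 0 * L2_rep q t i 0)%:E)%E.
  apply: integrable_sum => // i _.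
  have := Lfun2_mul_Lfun1 (L2_repP p i) (L2_repP q i).
  by move/Lfun1_integrable.
by apply/funext => t; rewrite /= sumEFin.
Qed.

Lemma L2_dotC p q : L2_dot p q = L2_dot q p.
Proof. by apply: eq_Rintegral => t _; rewrite innerC. Qed.

Lemma ae_eq_L2_int (f g : R -> R) : mu.-integrable setT (EFin \o f) ->
  mu.-integrable setT (EFin \o g) -> f = g %[ae mu] ->
  \int[mu]_t f t = \int[mu]_t g t.
Proof.
move=> /integrableP[mf _] /integrableP[mg _] fg; congr fine.
by apply: ae_eq_integral => //; apply: aeS fg => t /(_ I) h _ /=; rewrite h.
Qed.

Lemma L2_dot_linear a x y z : L2_dot (a *: x + y) z = a * L2_dot x z + L2_dot y z.
Proof.
rewrite /L2_dot -RintegralZl//; last exact: L2_dot_integrable.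
have iZ : mu.-integrable setT
    (EFin \o (fun t : R => a * inner (L2_rep x t) (L2_rep z t))).
  exact: (integrableZl _ a (L2_dot_integrable x z)).
rewrite -RintegralD//; last exact: L2_dot_integrable.
apply: ae_eq_L2_int; first exact: L2_dot_integrable.
  exact: (integrableD _ iZ (L2_dot_integrable y z)).
apply: aeS2 (L2_repD (a *: x) y) (L2_repZ a x) => t /(_ I) h1 /(_ I) h2 _.
by rewrite h1 /= h2 inner_linear.
Qed.

Lemma L2_dot_ge0 p : 0 <= L2_dot p p.
Proof. by apply: Rintegral_ge0 => t _; rewrite inner_norm sqr_ge0. Qed.

Lemma L2_dot_eq0 p : L2_dot p p = 0 -> p = 0.
Proof.
move=> p0.
have ip := L2_dot_integrable p p.
have /integrableP[mp _] := ip.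
have /(ae_eq_integral_abs mu measurableT mp) : (\int[mu]_t
    `|(EFin \o (fun t => inner (L2_rep p t) (L2_rep p t))) t| = 0)%E.
  transitivity (\int[mu]_t (inner (L2_rep p t) (L2_rep p t))%:E)%E.
    by apply: eq_integral => t _; rewrite gee0_abs// lee_fin inner_norm sqr_ge0.
  by rewrite -(fineK (integrable_fin_num measurableT ip)); congr EFin.
move=> p00; elim/L2_ind: p p0 p00 {ip mp} => f _ p0.
rewrite -L2_class0; apply/L2_classP.
apply: aeS2 p0 (L2_rep_class f) => t /(_ I) [] /eqP h /(_ I) ft _.
by move: h; rewrite inner_norm sqrf_eq0 normr_eq0 ft => /eqP.
Qed.

HB.instance Definition _ := Lmodule_isInnerProduct.Build R L2
  L2_dotC L2_dot_linear L2_dot_ge0 L2_dot_eq0.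

Lemma L2_innerE (p q : L2) :
  inner p q = \int[mu]_t inner (L2_rep p t) (L2_rep q t).
Proof. by []. Qed.

End L2fun.

Section L2_mx.
Context (R : realType) (tf : R) (n k : nat) (A : 'M[R]_(k, n)).

Lemma L2_pred_mx (f : L2fun tf n) :
  (fun t : R => A *m (f t : 'cV_n) : euclid R k) \in @L2_pred R tf k.
Proof.
have [L0 LD] : submod_closed (Lfun (lebesgue_on tf) 2%:E).
  by apply: Lfun_submod_closed; rewrite lee_fin ler1n.
case: f => f /= /L2_predP fL; apply/L2_predP => i.
rewrite (_ : (fun t => _) =
    \sum_(j < n) A i j *: ((fun t => f t j 0) : R -> R^o)); last first.
  apply/funext => t; rewrite mxE (big_morph (fun h => h t) (id1 := 0) (op1 := +%R))//.
apply: (big_ind (fun h : R -> R^o => h \in Lfun (lebesgue_on tf) 2%:E)) => [//|g h gL hL|j _].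
  by have := LD 1 g h gL hL; rewrite scale1r.
by rewrite -[X in X \in _]addr0; exact: LD.
Qed.

(* The multiplication operator (A p)(t) = A (p(t)). *)
Definition L2_mx (p : L2 tf n) : L2 tf k :=
  L2_class (MkL2fun (L2_pred_mx (L2_repr p))).

Lemma L2_rep_mx (p : L2 tf n) :
  L2_rep (L2_mx p) = (fun t => A *m (L2_rep p t : 'cV_n) : euclid R k)
    %[ae lebesgue_on tf].
Proof. exact: L2_rep_class. Qed.

End L2_mx.

Section H1.
Context (R : realType) (tf : R) (n : nat).

(* x has the absolutely continuous representative t |-> a + \int_0^t g. *)
Definition primitive (x g : L2 tf n) (a : euclid R n) : Prop :=
  \forall t \ae lebesgue_on tf, L2_rep x t = a +
    (\col_i \int[@lebesgue_measure R]_(s in `[0, t]) (L2_rep g s i 0) : euclid R n).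

(* H^1([0, tf], R^n): the classes in L^2 of the absolutely continuous functions
   whose derivative is in L^2. *)
Definition H1 : set (L2 tf n) := [set x | exists g a, primitive x g a].

(* The derivative and the initial value x(0) of (the absolutely continuous
   representative of) x; both are uniquely determined for x in H1 if 0 < tf. *)
Definition H1_deriv (x : L2 tf n) : L2 tf n :=
  xget 0 [set g | exists a, primitive x g a].

Definition H1_init (x : L2 tf n) : euclid R n :=
  xget 0 [set a | exists g, primitive x g a].

End H1.

Record partial_op (X Y : Type) := PartialOp { dom : set X; app :> X -> Y }.

Section operators.
Context (R : realType).
Implicit Types X Y U : innerProductType R.

(* The Hilbert space adjoint of a densely defined operator T. *)
Definition adjoint X Y (T : partial_op X Y) : partial_op Y X :=
  let is_adj y := [set z : X | forall x, dom T x -> inner (T x) y = inner x z] in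
  PartialOp [set y | is_adj y !=set0] (fun y => xget 0 (is_adj y)).

Definition is_gradient X (F : X -> R) (x g : X) : Prop :=
  differentiable F x /\ forall h, 'd F x h = inner g h.

Definition gradient X (F : X -> R) (x : X) : X := xget 0 (is_gradient F x).

(* Second differentiability in the sense of Frechet; the derivative is
   identified with the gradient through the Riesz isometry. *)
Definition twice_differentiable X (F : X -> R) : Prop :=
  (forall x, exists g, is_gradient F x g) /\
  (forall x, differentiable (gradient F) x).

Definition accretive X (M : partial_op X X) : Prop :=
  forall w1 w2, dom M w1 -> dom M w2 -> 0 <= inner (M w1 - M w2) (w1 - w2).

Definition m_accretive X (M : partial_op X X) : Prop :=
  accretive M /\
  exists2 mu : R, 0 < mu & [set mu *: w + M w | w in dom M] = setT.

(* The system w' = - M w + B u, y = C w; monotone_ph requires C = B^*. *)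
Record io_system X U := IOSystem {
  io_M : partial_op X X;
  io_B : U -> X;
  io_C : X -> U
}.

Definition monotone_ph X U (S : io_system X U) : Prop :=
  [/\ accretive (io_M S), linear (io_B S), continuous (io_B S) &
      forall w u, inner (io_C S w) u = inner w (io_B S u)].

Definition maximally_monotone_ph X U (S : io_system X U) : Prop :=
  monotone_ph S /\ m_accretive (io_M S).

Record simple_fun X := SimpleFun {
  sf_size : nat;
  sf_set : 'I_sf_size -> set (measurableTypeR R);
  sf_val : 'I_sf_size -> X;
  sf_measurable : forall i, measurable (sf_set i)
}.

Definition sf_eval X (s : simple_fun X) (t : R) : X :=
  \sum_i \1_(@sf_set X s i) t *: @sf_val X s i.

Definition sf_integral X (D : set R) (s : simple_fun X) : X :=
  \sum_i fine (@lebesgue_measure R (@sf_set X s i `&` D)) *: @sf_val X s i.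

(* g is Bochner integrable on D, with integral v. *)
Definition bochner_integral X (D : set R) (g : R -> X) (v : X) : Prop :=
  exists s : nat -> simple_fun X,
  [/\ forall t, D t -> sf_eval (s k) t @[k --> \oo] --> g t,
      (\int[@lebesgue_measure R]_(t in D) `|g t - sf_eval (s k) t|%:E)%E
        @[k --> \oo] --> 0%E &
      sf_integral D (s k) @[k --> \oo] --> v].

(* W^{1,1}((0, T], X): primitives of functions which are Bochner integrable on
   [d, T] for all 0 < d < T. *)
Definition W11 X (T : R) (w : R -> X) : Prop :=
  exists g : R -> X, forall s t, 0 < s -> s <= t -> t <= T ->
    bochner_integral `[s, t] g (w t - w s).

Definition strong_solution_on X U (S : io_system X U) (T : R) (u : R -> U)
    (w0 : X) (w : R -> X) : Prop :=
  [/\ {within `[0, T], continuous w}, W11 T w, w 0 = w0 &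
      \forall t \ae @lebesgue_measure R, t \in `]0, T[ ->
        dom (io_M S) (w t) /\
        is_derive t 1 w (- io_M S (w t) + io_B S (u t))].

Definition strong_solution X U (S : io_system X U) (u : R -> U)
    (w0 : X) (w : R -> X) : Prop :=
  forall T, 0 < T -> strong_solution_on S T u w0 w.

End operators.

Section optimal_control.
Context (R : realType) (tf : R) (n m : nat).
Context (A : 'M[R]_n) (B : 'M[R]_(n, m)) (alpha : R) (lx : euclid R n -> R).

(* L^2([0, tf], R^n x R^m), identified with L^2([0, tf], R^n) x L^2([0, tf], R^m) *)
Definition primal : innerProductType R := hprod (L2 tf n) (L2 tf m).

(* The space X_lambda of the multipliers (lambda, lambda_0). *)
Definition dual : innerProductType R := hprod (L2 tf n) (euclid R n).

Definition state : innerProductType R := hprod primal dual.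

Definition cost_x (x : L2 tf n) : R := \int[lebesgue_on tf]_t lx (L2_rep x t).

Definition cost (z : primal) : R :=
  \int[lebesgue_on tf]_t
    (lx (L2_rep z.1 t) + alpha / 2 * `|L2_rep z.2 t| ^+ 2).

Definition feasible (f : L2 tf n) (x0 : euclid R n) (z : primal) : Prop :=
  [/\ H1 z.1, H1_deriv z.1 = L2_mx A z.1 + L2_mx B z.2 + f & H1_init z.1 = x0].

Definition optimal (f : L2 tf n) (x0 : euclid R n) (z : primal) : Prop :=
  feasible f x0 z /\ forall z', feasible f x0 z' -> cost z <= cost z'.

Definition constraint : partial_op primal dual :=
  PartialOp [set z : primal | H1 z.1]
    (fun z => (H1_deriv z.1 - L2_mx A z.1 - L2_mx B z.2, H1_init z.1)).

Definition M_opt : partial_op state state :=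
  PartialOp
    [set w : state | dom constraint w.1 /\ dom (adjoint constraint) w.2]
    (fun w => (gradient cost w.1 - adjoint constraint w.2, constraint w.1)).

Definition optimizer : io_system state dual :=
  IOSystem M_opt (fun v => (0, v)) (fun w => w.2).

End optimal_control.

(* Main.v *)
(** For the saddle-point operator [M = (grad J - T^*, T)] the terms in [T] cancel
    in [<M w1 - M w2, w1 - w2>], so accretivity is monotonicity of [grad J]. The
    resolvent equation is the optimality system of a strongly convex problem,
    which is solvable because [T] is closed. The constraint operator is closed,
    densely defined and onto because the linear differential equation has a
    unique solution depending continuously on the data.

    Let [e = w - wh] be the error along a trajectory. The squared norm of [e]
    decreases at the rate [<grad J z - grad J zh, z - zh>], which coercivity
    bounds below in terms of the primal part of [e] only; since [e] is Lipschitz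
    in time, the primal part tends to zero. The multiplier part enters through
    the Lyapunov function [|e|^2 - 2 eps <e.1, S e.2>], where [S] is the solution
    operator of the differential equation, a bounded right inverse of [T]: once
    the primal part lies in a neighbourhood in which [grad J] is Lipschitz at
    [zh], it decays exponentially, from every initial value; hence [delta = 1]. *)

(* Strong solutions are continuous up to time zero but of class W^{1,1} only away from it, and
   inequalities for their derivatives hold only almost everywhere. A continuous function whose
   derivative is nonpositive almost everywhere may still increase, as the Cantor function does; this
   is excluded by making the increments at the points of a null set negligible. Every energy
   estimate is therefore a Gronwall inequality for scalar functions with this property, started at
   positive times and extended to time zero by continuity.

   Gradients, adjoints, derivatives and initial values are selected by [xget], so each needs a
   uniqueness argument before it can be computed with. Statements about the unbounded constraint
   operator are reduced to the bounded solution operator: [(x, u)] is mapped to [q] exactly if [x]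
   solves the equation with data [q + (B u, 0)].

   The cross term of the Lyapunov function brings in the gradient difference, which is controlled
   only close to the equilibrium. Hence the decay starts at an entry time, and the constant in front
   of the exponential depends on the trajectory, while the rate constructed does not. *)
Require Import Defs.
From HB Require Import structures.
From mathcomp Require Import all_boot all_order all_algebra.
From mathcomp Require Import all_classical all_reals all_analysis measurable_realfun.
From mathcomp Require Import ring lra.

Set Implicit Arguments.
Unset Strict Implicit.
Unset Printing Implicit Defensive.

Import Order.TTheory GRing.Theory Num.Theory.
Import numFieldNormedType.Exports.

Local Open Scope classical_set_scope.
Local Open Scope ring_scope.

(** * Inner product spaces, gradients and saddle-point operators *)

Section inner_product.
Context (R : realType) (X : innerProductType R).
Implicit Types (x y z : X) (a : R).

Lemma innerDl x y z : inner (x + y) z = inner x z + inner y z.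
Proof. by rewrite -{1}[x]scale1r inner_linear mul1r. Qed.

Lemma inner0l z : inner (0 : X) z = 0.
Proof. by apply: (addrI (inner (0 : X) z)); rewrite addr0 -innerDl addr0. Qed.

Lemma innerZl a x z : inner (a *: x) z = a * inner x z.
Proof. by rewrite -[a *: x]addr0 inner_linear inner0l addr0. Qed.

Lemma innerNl x z : inner (- x) z = - inner x z.
Proof. by rewrite -scaleN1r innerZl mulN1r. Qed.

Lemma innerBl x y z : inner (x - y) z = inner x z - inner y z.
Proof. by rewrite innerDl innerNl. Qed.

Lemma innerDr x y z : inner z (x + y) = inner z x + inner z y.
Proof. by rewrite innerC innerDl !(innerC z). Qed.

Lemma inner0r z : inner z (0 : X) = 0.
Proof. by rewrite innerC inner0l. Qed.

Lemma innerZr a x z : inner z (a *: x) = a * inner z x.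
Proof. by rewrite innerC innerZl (innerC z). Qed.

Lemma innerNr x z : inner z (- x) = - inner z x.
Proof. by rewrite innerC innerNl innerC. Qed.

Lemma innerBr x y z : inner z (x - y) = inner z x - inner z y.
Proof. by rewrite innerDr innerNr. Qed.

Definition innerE := (innerDl, innerDr, innerNl, innerNr, innerZl, innerZr,
  inner0l, inner0r).

Lemma sqr_normD x y : `|x + y| ^+ 2 = `|x| ^+ 2 + 2 * inner x y + `|y| ^+ 2.
Proof. by rewrite -!inner_norm !innerE (innerC y x); ring. Qed.

Lemma sqr_normB x y : `|x - y| ^+ 2 = `|x| ^+ 2 - 2 * inner x y + `|y| ^+ 2.
Proof. by rewrite sqr_normD innerNr normrN mulrN. Qed.

Lemma sqr_normZ a x : `|a *: x| ^+ 2 = a ^+ 2 * `|x| ^+ 2.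
Proof. by rewrite -!inner_norm !innerE expr2 mulrA. Qed.

(** Cauchy-Schwarz, by expanding the squared norm of [|y| x - |x| y]. The expansion has to be
    divided by [|x| * |y|], so a vanishing product is treated apart. *)
Lemma inner_le_norm x y : inner x y <= `|x| * `|y|.
Proof.
have h : 2 * (`|x| * `|y|) * inner x y <= 2 * (`|x| * `|y|) * (`|x| * `|y|).
  have := sqr_ge0 `| `|y| *: x - `|x| *: y|.
  by rewrite sqr_normB !sqr_normZ !innerE; lra.
have [x0|x0] := eqVneq (`|x| * `|y|) 0.
  rewrite x0; move/eqP: x0; rewrite mulf_eq0 !normr_eq0.
  by case/orP => /eqP ->; rewrite ?inner0l ?inner0r.
rewrite -(ler_pM2l (_ : 0 < 2 * (`|x| * `|y|)))//.
by rewrite mulr_gt0// lt_neqAle eq_sym x0 mulr_ge0.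
Qed.

Lemma normr_inner_le x y : `|inner x y| <= `|x| * `|y|.
Proof. by rewrite ler_norml inner_le_norm andbT lerNl -innerNl -(normrN x) inner_le_norm. Qed.

Lemma inner_inj x y : (forall h, inner x h = inner y h) -> x = y.
Proof.
move=> xy; apply/eqP; rewrite -subr_eq0 -normr_eq0 -sqrf_eq0 -inner_norm.
by rewrite innerBl xy subrr.
Qed.

(** Young's inequality: expand [|a x - y|^2] and divide by [2 a]. *)
Lemma inner_le_sqr x y a : 0 < a ->
  inner x y <= a / 2 * `|x| ^+ 2 + a^-1 / 2 * `|y| ^+ 2.
Proof.
move=> a0; have := sqr_ge0 `|a *: x - y|; rewrite sqr_normB sqr_normZ innerZl.
rewrite -(pmulr_rge0 _ (_ : 0 < a^-1 / 2)) ?divr_gt0 ?invr_gt0// => h.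
rewrite -subr_ge0; apply: le_trans h _.
by rewrite le_eqVlt; apply/orP; left; apply/eqP; field; rewrite gt_eqF.
Qed.

(** Polarization writes the inner product through norms, whose continuity is known. *)
Lemma cvg_inner (T : Type) (F : set_system T) {FF : Filter F} (f g : T -> X) x y :
  f t @[t --> F] --> x -> g t @[t --> F] --> y ->
  inner (f t) (g t) @[t --> F] --> inner x y.
Proof.
move=> fx gy.
have E (u v : X) : inner u v =
    2^-1 * (`|u + v| * `|u + v| - `|u| * `|u| - `|v| * `|v|) :> R.
  by rewrite -!expr2 sqr_normD; field.
under eq_cvg do rewrite E.
rewrite E; apply: cvgMr; apply: cvgB; first apply: cvgB.
- by apply: cvgM; apply: cvg_norm; exact: cvgD.
- by apply: cvgM; exact: cvg_norm.
- by apply: cvgM; exact: cvg_norm.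
Qed.

End inner_product.

Section hprod_facts.
Context (R : realType) (U V : innerProductType R).
Implicit Types (x y : hprod U V).

Lemma hprod_sqr_norm x : `|x| ^+ 2 = `|x.1| ^+ 2 + `|x.2| ^+ 2.
Proof. by rewrite -inner_norm hprod_innerE !inner_norm. Qed.

Lemma hprod_norm1 x : `|x.1| <= `|x|.
Proof. by rewrite -(@ler_pXn2r _ 2) ?nnegrE// hprod_sqr_norm lerDl sqr_ge0. Qed.

Lemma hprod_norm2 x : `|x.2| <= `|x|.
Proof. by rewrite -(@ler_pXn2r _ 2) ?nnegrE// hprod_sqr_norm lerDr sqr_ge0. Qed.

Lemma hprod_norm_le x : `|x| <= `|x.1| + `|x.2|.
Proof.
rewrite -(@ler_pXn2r _ 2) ?nnegrE ?addr_ge0// hprod_sqr_norm sqrrD.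
by rewrite -subr_ge0; have := mulr_ge0 (normr_ge0 x.1) (normr_ge0 x.2); lra.
Qed.

Lemma cvg_hprod (T : Type) (F : set_system T) {FF : Filter F}
    (f : T -> hprod U V) x :
  (f t).1 @[t --> F] --> x.1 -> (f t).2 @[t --> F] --> x.2 ->
  f t @[t --> F] --> x.
Proof.
move=> f1 f2; apply/cvgrPdist_lt => e e0.
have e2 : 0 < e / 2 by rewrite divr_gt0.
move/cvgrPdist_lt: f1 => /(_ _ e2); move/cvgrPdist_lt: f2 => /(_ _ e2).
apply: filterS2 => t h2 h1.
by rewrite (le_lt_trans (hprod_norm_le _))// (splitr e) ltrD.
Qed.

Lemma cvg_hprod1 (T : Type) (F : set_system T) {FF : Filter F}
    (f : T -> hprod U V) x :
  f t @[t --> F] --> x -> (f t).1 @[t --> F] --> x.1.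
Proof.
move=> /cvgrPdist_lt fx; apply/cvgrPdist_lt => e /fx; apply: filterS => t.
by apply: le_lt_trans; exact: (hprod_norm1 (x - f t)).
Qed.

Lemma cvg_hprod2 (T : Type) (F : set_system T) {FF : Filter F}
    (f : T -> hprod U V) x :
  f t @[t --> F] --> x -> (f t).2 @[t --> F] --> x.2.
Proof.
move=> /cvgrPdist_lt fx; apply/cvgrPdist_lt => e /fx; apply: filterS => t.
by apply: le_lt_trans; exact: (hprod_norm2 (x - f t)).
Qed.

End hprod_facts.

(** Inner product types carry no completeness; this is the form in which minimizing sequences and
    Picard iterates obtain their limits. *)
Definition complete_norm (R : realType) (X : normedModType R) : Prop :=
  forall u : nat -> X,
  (forall e : R, 0 < e -> exists N, forall i j, (N <= i)%N -> (N <= j)%N ->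
    `|u i - u j| < e) ->
  exists l : X, u k @[k --> \oo] --> l.

Lemma hprod_complete (R : realType) (U V : innerProductType R) :
  complete_norm U -> complete_norm V -> complete_norm (hprod U V).
Proof.
move=> cU cV u uC.
have [l1 ul1] : exists l : U, (u k).1 @[k --> \oo] --> l.
  apply: cU => e /uC[N uN]; exists N => i j Ni Nj.
  exact: le_lt_trans (hprod_norm1 (u i - u j)) (uN i j Ni Nj).
have [l2 ul2] : exists l : V, (u k).2 @[k --> \oo] --> l.
  apply: cV => e /uC[N uN]; exists N => i j Ni Nj.
  exact: le_lt_trans (hprod_norm2 (u i - u j)) (uN i j Ni Nj).
by exists (l1, l2); exact: cvg_hprod.
Qed.

Section gradients.
Context (R : realType) (X : innerProductType R).
Implicit Types (F : X -> R) (x g h : X).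

Lemma is_gradient_inj F x g g' : is_gradient F x g -> is_gradient F x g' -> g = g'.
Proof. by move=> [_ h] [_ h']; apply: inner_inj => k; rewrite -h -h'. Qed.

Lemma gradientP F x g : is_gradient F x g -> is_gradient F x (gradient F x).
Proof. by move=> Fg; rewrite /gradient; apply: xgetPex; exists g. Qed.

Lemma gradientE F x g : is_gradient F x g -> gradient F x = g.
Proof. by move=> Fg; exact: is_gradient_inj (gradientP Fg) Fg. Qed.

Lemma gradient_cvg F x g h : is_gradient F x g ->
  t^-1 * (F (x + t *: h) - F x) @[t --> 0^'] --> inner g h.
Proof.
move=> [dF gE]; rewrite -gE -(deriveE h dF).
have : derivable F x h by exact: diff_derivable.
rewrite /derivable /derive; set f := (f in f t @[t --> _]).
have -> : (fun t : R => t^-1 * (F (x + t *: h) - F x)) = f.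
  by apply/funext => t; rewrite /f /= [x + _]addrC.
exact.
Qed.

Lemma gradient_continuous F x g : is_gradient F x g -> {for x, continuous F}.
Proof. by case=> dF _; exact: differentiable_continuous. Qed.

(** Written along [x + t (y - x)], convexity bounds the difference quotient whose limit at [t = 0]
    is the directional derivative. *)
Definition segment_convex F := forall x y t, 0 <= t -> t <= 1 ->
  F (x + t *: (y - x)) <= F x + t * (F y - F x).

(** By convexity each difference quotient along the segment is at most [F y - F x]; let the step
    tend to zero from the right. *)
Lemma gradient_convex_le F x g y : segment_convex F -> is_gradient F x g ->
  inner g (y - x) <= F y - F x.
Proof.
move=> cF /(gradient_cvg (h := y - x)) /cvg_dnbhs_at_right h.
apply: (cvgr_to_le h); near=> t.
have t0 : 0 < t by near: t; exact: nbhs_right_gt.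
rewrite ler_pdivrMl//.
rewrite lerBlDl; apply: cF; first exact: ltW.
by near: t; exact: nbhs_right_le.
Unshelve. all: by end_near. Qed.

Lemma gradient_monotone F x y g k : segment_convex F -> is_gradient F x g ->
  is_gradient F y k -> 0 <= inner (g - k) (x - y).
Proof.
move=> cF /(gradient_convex_le y cF) h /(gradient_convex_le x cF).
by rewrite innerBl -[x - y]opprB !innerNr; lra.
Qed.

End gradients.

Definition linear_op (R : realType) (X Y : innerProductType R)
    (T : partial_op X Y) : Prop :=
  dom T 0 /\ forall a x y, dom T x -> dom T y ->
    dom T (a *: x + y) /\ T (a *: x + y) = a *: T x + T y.

Definition closed_op (R : realType) (X Y : innerProductType R)
    (T : partial_op X Y) : Prop :=
  forall (u : nat -> X) x y, (forall k, dom T (u k)) ->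
    u k @[k --> \oo] --> x -> T (u k) @[k --> \oo] --> y -> dom T x /\ T x = y.

(** For a linear domain in a complete space this is density. A trivial orthogonal complement is
    exactly what makes the value of the adjoint unique. *)
Definition dense_op (R : realType) (X Y : innerProductType R)
    (T : partial_op X Y) : Prop :=
  forall h, (forall x, dom T x -> inner x h = 0) -> h = 0.

(** [M_opt] is convertible to this operator for the constraint operator and the cost, so the
    abstract results apply to it without transport. *)
Definition saddle_op (R : realType) (X Y : innerProductType R)
    (T : partial_op X Y) (J : X -> R) : partial_op (hprod X Y) (hprod X Y) :=
  PartialOp [set w : hprod X Y | dom T w.1 /\ dom (adjoint T) w.2]
    (fun w => (gradient J w.1 - adjoint T w.2, T w.1)).

Section operators.
Context (R : realType) (X Y : innerProductType R).
Variable T : partial_op X Y.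
Hypothesis linT : linear_op T.

Lemma linear_opD x y : dom T x -> dom T y -> dom T (x + y) /\ T (x + y) = T x + T y.
Proof. by move=> dx dy; have := linT.2 1 x y dx dy; rewrite !scale1r. Qed.

Lemma linear_op0 : T 0 = 0.
Proof.
have [_] := linear_opD linT.1 linT.1; rewrite addr0 => h.
by apply: (addrI (T 0)); rewrite addr0.
Qed.

Lemma linear_opZ a x : dom T x -> dom T (a *: x) /\ T (a *: x) = a *: T x.
Proof. by move=> dx; have := linT.2 a x 0 dx linT.1; rewrite linear_op0 !addr0. Qed.

Lemma linear_opB x y : dom T x -> dom T y -> dom T (x - y) /\ T (x - y) = T x - T y.
Proof.
move=> dx dy; have [dy' Ty'] := linear_opZ (-1) dy.
by have := linear_opD dx dy'; rewrite Ty' !scaleN1r.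
Qed.

Lemma adjointP y x : dom (adjoint T) y -> dom T x ->
  inner (T x) y = inner x (adjoint T y).
Proof.
move=> dy; set S := [set z : X | forall x, dom T x -> inner (T x) y = inner x z].
have : S (adjoint T y) by exact: xgetPex dy.
by apply.
Qed.

Lemma adjoint_unique y z : dense_op T ->
  (forall x, dom T x -> inner (T x) y = inner x z) ->
  dom (adjoint T) y /\ adjoint T y = z.
Proof.
move=> dT h; have dy : dom (adjoint T) y by exists z.
split => //; apply/eqP; rewrite -subr_eq0; apply/eqP; apply: dT => x dx.
by rewrite innerBr -adjointP// h// subrr.
Qed.

Lemma adjointB y y' x : dom (adjoint T) y -> dom (adjoint T) y' -> dom T x ->
  inner (T x) (y - y') = inner x (adjoint T y - adjoint T y').
Proof. by move=> dy dy' dx; rewrite !innerBr !adjointP. Qed.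

Variable J : X -> R.
Hypothesis cJ : segment_convex J.
Hypothesis gJ : forall x, exists g, is_gradient J x g.

Let gJP x : is_gradient J x (gradient J x).
Proof. by have [g /gradientP] := gJ x. Qed.

Lemma gradientB_ge0 x y : 0 <= inner (gradient J x - gradient J y) (x - y).
Proof. exact: gradient_monotone cJ (gJP x) (gJP y). Qed.

(** An identity rather than an estimate: besides accretivity it yields the decay rate of the error
    and the uniqueness of the equilibrium. *)
Lemma inner_saddle w1 w2 : dom (saddle_op T J) w1 -> dom (saddle_op T J) w2 ->
  inner (saddle_op T J w1 - saddle_op T J w2) (w1 - w2) =
  inner (gradient J w1.1 - gradient J w2.1) (w1.1 - w2.1).
Proof.
move=> [d1 e1] [d2 e2]; rewrite hprod_innerE.
have [d12 T12] := linear_opB d1 d2.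
have := adjointB e1 e2 d12; rewrite T12 => E.
change (inner (gradient J w1.1 - adjoint T w1.2 - (gradient J w2.1 - adjoint T w2.2))
  (w1.1 - w2.1) + inner (T w1.1 - T w2.1) (w1.2 - w2.2) =
  inner (gradient J w1.1 - gradient J w2.1) (w1.1 - w2.1)); rewrite E.
rewrite (innerC (w1.1 - w2.1)); set v := w1.1 - w2.1; rewrite !(innerDl, innerNl).
by move: (inner _ v) (inner _ v) (inner _ v) (inner _ v) => *; ring.
Qed.

Lemma saddle_accretive : accretive (saddle_op T J).
Proof. by move=> w1 w2 d1 d2; rewrite inner_saddle// gradientB_ge0. Qed.

Hypothesis cX : complete_norm X.
Hypothesis cY : complete_norm Y.
Hypothesis clT : closed_op T.
Hypothesis dT : dense_op T.
Hypothesis J_ge0 : forall x, 0 <= J x.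

Section minimization.
Variables (a : X) (b : Y).

(* [z + grad J z - T^* p = a] and [p + T z = b] are the optimality conditions for
   minimizing Phi, with p = b - T z. As Phi is strongly convex in the graph norm of
   T, its minimizing sequences are Cauchy in that norm. *)
Let Phi z := J z + (`|z - a| ^+ 2 + `|T z - b| ^+ 2) / 2.

Let Phi_ge0 z : 0 <= Phi z.
Proof. by rewrite addr_ge0// divr_ge0// addr_ge0// sqr_ge0. Qed.

(** The parallelogram law lowers each quadratic term at the midpoint by a quarter of the squared
    distance; the factor 1/2 in [Phi] makes it an eighth. *)
Let Phi_mid x y : dom T x -> dom T y -> let z := x + 2^-1 *: (y - x) in
  dom T z /\ (`|x - y| ^+ 2 + `|T x - T y| ^+ 2) / 8 <= (Phi x + Phi y) / 2 - Phi z.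
Proof.
move=> dx dy z; have [dyx Tyx] := linear_opB dy dx.
have [dh Th] := linear_opZ 2^-1 dyx.
have [dz Tz] := linear_opD dx dh; split=> //.
have Jz : J z <= J x + 2^-1 * (J y - J x) by apply: cJ; lra.
rewrite /Phi -/z Tz Th Tyx.
have par (V : innerProductType R) (u v c : V) :
    `|u + 2^-1 *: (v - u) - c| ^+ 2 =
    (`|u - c| ^+ 2 + `|v - c| ^+ 2) / 2 - `|u - v| ^+ 2 / 4.
  by rewrite -!inner_norm !innerE (innerC v u) (innerC c u) (innerC c v); field.
by rewrite !par; lra.
Qed.

Lemma regularized_minimizer : exists2 z, dom T z & forall z', dom T z' -> Phi z <= Phi z'.
Proof.
pose E := [set Phi z | z in dom T].
have E0 : has_inf E.
  split; first by exists (Phi 0); exists 0 => //; exact: linT.1.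
  by exists 0 => _ [z _ <-].
have inf_le z : dom T z -> inf E <= Phi z.
  by move=> dz; apply: ge_inf; [exact: E0.2|exists z].
have /choice[u uP] : forall k : nat, exists z, dom T z /\ Phi z < inf E + k.+1%:R^-1.
  move=> k; have k0 : (0 : R) < k.+1%:R^-1 by rewrite invr_gt0.
  by have [_ [z dz <-] zk] := inf_adherent k0 E0; exists z.
have du k : dom T (u k) by have [] := uP k.
have near_inv (e : R) : 0 < e -> exists N, forall k, (N <= k)%N -> k.+1%:R^-1 < e.
  move=> e0; have : \forall k \near \oo, k.+1%:R^-1 < e by exact: (near_infty_natSinv_lt (PosNum e0)).
  by case=> N _ NE; exists N => k; exact: NE.
have uC (e : R) : 0 < e -> exists N, forall i j, (N <= i)%N -> (N <= j)%N ->
    `|u i - u j| < e /\ `|T (u i) - T (u j)| < e.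
  (* Two values of [Phi] within [e ^+ 2 / 8] of the infimum force both squared distances below
     [e ^+ 2], since the midpoint value is at least the infimum. *)
  move=> e0; have e8 : 0 < e ^+ 2 / 8 by rewrite divr_gt0// exprn_gt0.
  have [N NE] := near_inv _ e8; exists N => i j Ni Nj.
  have [dz] := Phi_mid (du i) (du j); set z := (_ + _) in dz * => zP.
  have zi := inf_le _ dz; have [_ ui] := uP i; have [_ uj] := uP j.
  have hi := NE i Ni; have hj := NE j Nj.
  have s1 := sqr_ge0 `|u i - u j|; have s2 := sqr_ge0 `|T (u i) - T (u j)|.
  move: (Phi z) (Phi (u i)) (Phi (u j)) (i.+1%:R^-1) (j.+1%:R^-1) zP zi ui uj hi hj.
  move=> *.
  by split; rewrite -(@ltr_pXn2r _ 2) ?nnegrE ?(ltW e0)//; lra.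
have [z uz] : exists l : X, u k @[k --> \oo] --> l.
  by apply: cX => e /uC[N NE]; exists N => i j Ni Nj; have [] := NE i j Ni Nj.
have [q uq] : exists l : Y, T (u k) @[k --> \oo] --> l.
  by apply: cY => e /uC[N NE]; exists N => i j Ni Nj; have [] := NE i j Ni Nj.
have [dz Tz] := clT du uz uq.
exists z => // z' /inf_le; apply: le_trans.
have Pu : Phi (u k) @[k --> \oo] --> Phi z.
  rewrite /Phi Tz !expr2; under eq_cvg do rewrite !expr2; apply: cvgD.
    by apply: continuous_cvg => //; apply: gradient_continuous; exact: gJP.
  apply: cvgMl; apply: cvgD; apply: cvgM; apply: cvg_norm; apply: cvgB => //; exact: cvg_cst.
apply/ler_addgt0Pl => e /near_inv[N NE]; rewrite addrC; apply: (cvgr_to_le Pu).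
exists N => // k /= /NE ke; have [_ uk] := uP k.
by apply: ltW; apply: lt_trans uk _; rewrite ltrD2l.
Qed.

Lemma saddle_resolvent : exists2 w, dom (saddle_op T J) w & w + saddle_op T J w = (a, b).
Proof.
have [z dz zmin] := regularized_minimizer.
suff euler h : dom T h -> inner (T h) (b - T z) = inner h (z + gradient J z - a).
  have [dp ap] := adjoint_unique dT euler.
  exists (z, b - T z); first by split.
  change ((z + (gradient J z - adjoint T (b - T z)), b - T z + T z) = (a, b)).
  by rewrite subrK ap addrA opprB addrC subrK.
(* The one-sided derivative of [Phi] at its minimizer is nonnegative in every direction of the
   domain; the directions [h] and [- h] together give the Euler equation. *)
have half v : dom T v ->
    0 <= inner (gradient J z) v + (inner (z - a) v + inner (T z - b) (T v)).
  move=> dv.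
  have lim : t^-1 * (J (z + t *: v) - J z) + (inner (z - a) v + inner (T z - b) (T v)) +
      t * ((`|v| ^+ 2 + `|T v| ^+ 2) / 2) @[t --> 0^'+] -->
      inner (gradient J z) v + (inner (z - a) v + inner (T z - b) (T v)) + 0 * ((`|v| ^+ 2 + `|T v| ^+ 2) / 2).
    apply: cvgD; first apply: cvgD.
    - exact: cvg_dnbhs_at_right (gradient_cvg (gJP z)).
    - exact: cvg_cst.
    - apply: cvgMl; exact: cvg_at_right_filter.
  rewrite mul0r addr0 in lim.
  apply: (cvgr_to_ge lim); near=> t.
  have t0 : 0 < t by near: t; exact: nbhs_right_gt.
  have [dtv Ttv] := linear_opZ t dv.
  have [dztv Tztv] := linear_opD dz dtv.
  have := zmin _ dztv; rewrite /Phi Tztv Ttv (addrAC z) (addrAC (T z)).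
  rewrite (sqr_normD (z - a)) (sqr_normD (T z - b)) !sqr_normZ !innerZr => zv.
  rewrite -(pmulr_rge0 _ t0).
  set d := J _ - J _; set c := _ + inner _ (T v); set k := (_ + _) / 2.
  have -> : t * (t^-1 * d + c + t * k) = d + t * c + t ^+ 2 * k.
    by field; rewrite gt_eqF.
  by rewrite /d /c /k; lra.
move=> dh; have := half _ dh.
have [dh' Th'] := linear_opZ (-1) dh; have := half _ dh'.
rewrite Th' !scaleN1r !innerNr => h1 h2.
rewrite [RHS]innerC innerBl innerDl [LHS]innerC.
by move: h1 h2; rewrite !innerBl; lra.
Unshelve. all: by end_near. Qed.

End minimization.

Lemma saddle_m_accretive : m_accretive (saddle_op T J).
Proof.
split; first exact: saddle_accretive.
exists 1 => //; rewrite -subTset => -[a b] _.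
by have [w dw wE] := saddle_resolvent a b; exists w => //; rewrite scale1r.
Qed.

End operators.

(** * Absolutely continuous functions *)

Section almost_everywhere.
Context (R : realType) (mu : {measure set (measurableTypeR R) -> \bar R}).
Implicit Types P Q S : R -> Prop.

Lemma ae_sub P Q : (forall t, P t -> Q t) ->
  (\forall t \ae mu, P t) -> \forall t \ae mu, Q t.
Proof. by move=> PQ; apply: (@filterS _ _ (ae_filter_ringOfSetsType mu)). Qed.

Lemma ae_sub2 P Q S : (forall t, P t -> Q t -> S t) ->
  (\forall t \ae mu, P t) -> (\forall t \ae mu, Q t) -> \forall t \ae mu, S t.
Proof. by move=> PQ; apply: (@filterS2 _ _ (ae_filter_ringOfSetsType mu)). Qed.

End almost_everywhere.

Section absolute_continuity.
Context (R : realType).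
Local Notation lambda := (@lebesgue_measure R).

Definition continuous_on (X : normedModType R) (a b : R) (f : R -> X) : Prop :=
  forall t, a <= t -> t <= b -> forall e : R, 0 < e ->
  exists2 d : R, 0 < d & forall s, a <= s -> s <= b -> `|s - t| < d ->
    `|f s - f t| < e.

(* Absolute continuity in the only form that is used: near the points of a null
   set N, the increments of f are dominated by those of a nondecreasing theta
   whose total variation is arbitrarily small. Unlike domination by an integral,
   this is readily stable under translations and Lipschitz maps. *)
Definition ac_on (X : normedModType R) (a b : R) (f : R -> X) : Prop :=
  continuous_on a b f /\
  forall N : set (measurableTypeR R), measurable N -> lambda N = 0%E ->
  forall e : R, 0 < e -> exists theta : R -> R,
  [/\ forall s t, a <= s -> s <= t -> t <= b -> theta s <= theta t,
      theta b - theta a <= e &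
      forall t, N t -> a <= t -> t < b -> exists2 d : R, 0 < d &
        forall s, t < s -> s < t + d -> s <= b ->
        `|f s - f t| <= theta s - theta t].

(** One criterion for sums, differences, products of bounded functions and Lipschitz images: the
    dominating functions of [f] and [g] are added and scaled. [K] replaces [C] in order to be
    positive. *)
Lemma ac_on_lip (X Y Z : normedModType R) (a b C : R) (f : R -> X) (g : R -> Y) (h : R -> Z) :
  ac_on a b f -> ac_on a b g ->
  (forall s t, a <= s -> s <= b -> a <= t -> t <= b ->
    `|h s - h t| <= C * (`|f s - f t| + `|g s - g t|)) ->
  ac_on a b h.
Proof.
move=> [cf af] [cg ag] hfg.
pose K := `|C| + 1; have K0 : 0 < K by rewrite ltr_wpDl.
have {}hfg s t : a <= s -> s <= b -> a <= t -> t <= b ->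
    `|h s - h t| <= K * (`|f s - f t| + `|g s - g t|).
  move=> *; apply: le_trans (hfg _ _ _ _ _ _) _ => //.
  by apply: ler_wpM2r; [exact: addr_ge0|rewrite /K ler_wpDr// ler_norm].
split=> [t ta tb e e0|N mN N0 e e0].
  have e' : 0 < e / K / 2 by rewrite !divr_gt0.
  have [d d0 fd] := cf t ta tb _ e'; have [d' d'0 gd] := cg t ta tb _ e'.
  exists (Num.min d d'); first by rewrite lt_min d0.
  move=> s sa sb; rewrite lt_min => /andP[sd sd'].
  apply: le_lt_trans (hfg _ _ sa sb ta tb) _.
  by rewrite -ltr_pdivlMl// mulrC (splitr (e / K)) ltrD ?fd ?gd.
have e' : 0 < e / K / 2 by rewrite !divr_gt0.
have [p [p1 p2 p3]] := af N mN N0 _ e'; have [q [q1 q2 q3]] := ag N mN N0 _ e'.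
exists (fun t => K * (p t + q t)); split=> [s t *|/=|t Nt ta tb].
- by rewrite ler_pM2l// lerD ?p1 ?q1.
- by rewrite -mulrBr -ler_pdivlMl// mulrC (splitr (e / K)) opprD addrACA lerD.
have [d d0 pd] := p3 t Nt ta tb; have [d' d'0 qd] := q3 t Nt ta tb.
exists (Num.min d d'); first by rewrite lt_min d0.
move=> s ts sd sb; have /andP[sd1 sd2] : (s < t + d) && (s < t + d').
  by rewrite -lt_min -addr_minr.
apply: le_trans (hfg _ _ (ltW (le_lt_trans ta ts)) sb ta (ltW tb)) _.
rewrite -mulrBr ler_pM2l// opprD addrACA lerD ?pd ?qd//.
Qed.

Lemma continuous_on_bounded (X : normedModType R) a b (f : R -> X) : a <= b ->
  continuous_on a b f -> exists M, forall t, a <= t -> t <= b -> `|f t| <= M.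
Proof.
move=> ab cf.
have cF : {within `[a, b], continuous (fun t => `|f t|)}.
  apply/subspace_continuousP => t; rewrite /= in_itv /= => /andP[ta tb].
  apply: cvg_norm; apply/cvgrPdist_lt => e e0.
  have [d d0 dP] := cf t ta tb e e0.
  exists d => //= s /= sd; rewrite in_itv /= => /andP[sa sb].
  by rewrite distrC dP// distrC.
have [c _ cM] := EVT_max ab cF.
by exists `|f c| => t ta tb; apply: cM; rewrite in_itv /= ta.
Qed.

(* Continuous induction on phi t - e * t - theta t, where theta absorbs the
   increments of phi at the points without a derivative. *)
Lemma ac_nonincreasing (phi : R -> R) a b : a <= b -> ac_on a b phi ->
  (\forall t \ae lambda, t \in `]a, b[ -> exists2 d, is_derive t (1 : R) phi d & d <= 0) ->
  phi b <= phi a.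
Proof.
move=> ab [cphi aphi] [N0 [mN0 N00 PN0]].
(* The derivative is known only inside the open interval, so the left end joins the exceptional
   set. *)
pose N := N0 `|` [set a].
have mN : measurable (N : set (measurableTypeR R)) by exact: measurableU.
have N_0 : lambda N = 0%E.
  by rewrite measureU0 ?N00//; exact: lebesgue_measure_set1.
apply/ler_addgt0Pl => e0 e0_gt0.
(* The slope [e] costs [e * (b - a)] over the interval and [theta] costs another [e]. *)
pose e := e0 / (b - a + 1).
have ba1 : 0 < b - a + 1 by rewrite ltr_wpDl// subr_ge0.
have e_gt0 : 0 < e by rewrite divr_gt0.
have [theta [theta_nd theta_e thetaP]] := aphi N mN N_0 _ e_gt0.
pose psi t := phi t - e * t - theta t.
have step c : a <= c -> c < b -> exists2 d : R, 0 < d &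
    forall s, c < s -> s < c + d -> s <= b -> psi s <= psi c.
  move=> ac cb; have [Nc|Nc] := pselect (N c).
    have [d d0 dP] := thetaP c Nc ac cb; exists d => // s cs sd sb.
    have := le_trans (ler_norm _) (dP s cs sd sb).
    have : e * c <= e * s by rewrite ler_pM2l// ltW.
    by rewrite /psi; lra.
  have cab : c \in `]a, b[.
    rewrite in_itv /= cb andbT lt_neqAle ac andbT; apply/eqP => E.
    by apply: Nc; right; rewrite E.
  have [dphi [dphi1 dphiE] dphi0] : exists2 d, is_derive c (1 : R) phi d & d <= 0.
    by apply: contrapT => h; apply: Nc; left; apply: PN0 => /= /(_ cab).
  have /cvgrPdist_lt/(_ _ e_gt0) : h^-1 *: (phi (h *: 1 + c) - phi c) @[h --> 0^'] --> dphi.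
    by rewrite -dphiE; exact: dphi1.
  rewrite near_withinE near_simpl => -[d /= d0 dP].
  exists d => // s cs sd sb.
  have sc0 : 0 < s - c by rewrite subr_gt0.
  have /dP : ball_ [eta Num.Def.normr] 0 d (s - c).
    by rewrite /= sub0r normrN gtr0_norm// ltrBlDl.
  rewrite gt_eqF// => /(_ isT); rewrite /GRing.scale /= mulr1 subrK => h.
  have : (s - c)^-1 * (phi s - phi c) < e.
    by move: h; rewrite ltr_norml => /andP[h _]; move: dphi0; lra.
  rewrite ltr_pdivrMl// => h'.
  by have := theta_nd c s ac (ltW cs) sb; rewrite /psi; lra.
pose S := [set t | [/\ a <= t, t <= b & psi t <= psi a]].
have Sa : S a by split.
have hS : has_sup S by split; [exists a|exists b => t []].
pose c := sup S.
have ac : a <= c by apply: sup_upper_bound.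
have cb : c <= b by apply: ge_sup; [exists a|move=> t []].
(* [theta] may jump. It is nondecreasing and enters [psi] with a minus sign, so at the supremum a
   jump only lowers [psi]; continuity is needed of [phi] alone. *)
have Sc : S c.
  split=> //; apply/ler_addgt0Pl => r r0.
  have [d d0 dP] := cphi c ac cb _ r0.
  have [t [ta tb tS] tc] := sup_adherent d0 hS.
  have {}tc : c - d < t := tc.
  have tc' : t <= c by apply: sup_upper_bound.
  have : `|t - c| < d by rewrite ler0_norm ?subr_le0//; lra.
  move=> /dP -/(_ ta tb); rewrite distrC => /ltW /(le_trans (ler_norm _)).
  have := theta_nd t c ta tc' cb; have : e * t <= e * c by rewrite ler_pM2l.
  by move: tS; rewrite /psi; lra.
have cE : c = b.
  apply/eqP; rewrite eq_le cb /= leNgt; apply/negP => cb'.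
  have [d d0 dP] := step c ac cb'.
  pose s := Num.min b (c + d / 2).
  have cs : c < s by rewrite lt_min cb' ltrDl divr_gt0.
  have sb : s <= b by rewrite ge_min lexx.
  have sd : s < c + d.
    by rewrite gt_min; apply/orP; right; rewrite ltrD2l ltr_pdivrMr// ltr_pMr// ltr1n.
  have : S s.
    by split=> //; [exact: ltW (le_lt_trans ac cs)|apply: le_trans (dP s cs sd sb) _; case: Sc].
  by move=> /(sup_upper_bound hS); rewrite leNgt cs.
move: Sc => [_ _]; rewrite cE /psi => h.
have <- : e * (b - a + 1) = e0 by rewrite /e divfK// gt_eqF.
by move: theta_e h; lra.
Qed.

End absolute_continuity.

Section lebesgue_translation.
Context (R : realType).
Local Notation lambda := (@lebesgue_measure R).

Lemma measurable_addr (h : R) :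
  measurable_fun setT ((fun x => x + h) : measurableTypeR R -> measurableTypeR R).
Proof. by apply: measurable_funD => //; exact: measurable_cst. Qed.

(** The image measure under a translation agrees with Lebesgue measure on intervals. Null sets may
    thus be shifted, which turns a time-shifted trajectory into a trajectory. *)
Lemma lebesgue_measure_addr (h : R) (A : set (measurableTypeR R)) : measurable A ->
  lambda ((fun x => x + h) @^-1` A) = lambda A.
Proof.
pose mshift_mixin := isMeasurableFun.Build _ _ _ _ _ (measurable_addr h).
pose mshift : {mfun measurableTypeR R >-> measurableTypeR R} := HB.pack (fun x => x + h) mshift_mixin.
move=> mA; apply/esym/(@lebesgue_measure_unique R (pushforward lambda mshift)) => //= _ [[a b]] _ <-.
rewrite /pushforward /= (_ : _ @^-1` _ = `]a - h, b - h]%classic); last first.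
  by apply/seteqP; split=> x /=; rewrite !in_itv /= ltrBlDr lerBrDr.
rewrite !lebesgue_measure_itv/= !lte_fin ltrD2r -!EFinB.
by have -> : b - h - (a - h) = b - a by ring.
Qed.

Lemma ae_addr (h : R) (P : R -> Prop) :
  (\forall t \ae lambda, P t) -> \forall t \ae lambda, P (t + h).
Proof.
move=> [N [mN N0 PN]]; exists ((fun x => x + h) @^-1` N); split.
- by rewrite -[X in measurable X]setTI; exact: measurable_addr.
- by rewrite lebesgue_measure_addr.
- by move=> t Pt; exact: PN.
Qed.

Lemma ac_on_addr (X : normedModType R) (a b h : R) (f : R -> X) :
  ac_on (a + h) (b + h) f -> ac_on a b (fun t => f (t + h)).
Proof.
move=> [cf af]; split=> [t ta tb e e0|N mN N0 e e0].
  have [||d d0 dP] := cf (t + h) _ _ e e0; rewrite ?lerD2r//.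
  exists d => // s sa sb st; apply: dP; rewrite ?lerD2r//.
  by rewrite opprD addrACA subrr addr0.
pose N' : set (measurableTypeR R) := (fun x => x + (- h)) @^-1` N.
have mN' : measurable N' by rewrite -[X in measurable X]setTI; exact: measurable_addr.
have N'0 : lambda N' = 0%E by rewrite lebesgue_measure_addr.
have [p [p1 p2 p3]] := af _ mN' N'0 _ e0.
exists (fun t => p (t + h)); split=> [s t sa st tb|//|t Nt ta tb].
  by apply: p1; rewrite lerD2r.
have [|||d d0 dP] := p3 (t + h); rewrite ?lerD2r ?ltrD2r//.
  by rewrite /N' /= addrK.
exists d => // s ts sd sb; apply: dP; rewrite ?lerD2r ?ltrD2r//.
by rewrite addrAC ltrD2r.
Qed.

End lebesgue_translation.

Section ac_integral.
Context (R : realType).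
Local Notation lambda := (@lebesgue_measure R).

(** Outer regularity encloses the null set in an open set [U] of small measure. [theta] integrates
    [k] over the part of [U] up to [t]: its variation is small, and next to a point of the null set
    [U] contains a whole interval, so that [theta] has the full increment there. *)
Lemma ac_on_integral (X : normedModType R) (a b : R) (k : R -> R) (f : R -> X) :
  lambda.-integrable setT (EFin \o k) -> (forall t, 0 <= k t) ->
  (forall s t, a <= s -> s <= t -> t <= b ->
    `|f t - f s| <= \int[lambda]_(x in `]s, t]) k x) ->
  ac_on a b f.
Proof.
move=> ik k0 fk.
have ikA (A : set (measurableTypeR R)) : measurable A -> lambda.-integrable A (EFin \o k).
  by move=> mA; apply: integrableS ik.
have [ba|ab] := ltP b a.
  split=> [t ta tb|N _ _ e e0]; first by move: (le_trans ta tb); rewrite leNgt ba.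
  exists (fun=> 0); split=> // [|t _ ta tb]; first by rewrite subrr ltW.
  by move: (le_trans ta (ltW tb)); rewrite leNgt ba.
have kcont e : 0 < e -> exists2 d : R, 0 < d &
    forall A : set (measurableTypeR R), measurable A -> (lambda A < d%:E)%E ->
    \int[lambda]_(x in A) k x < e.
  move=> /(integral_normr_continuous ik)[d [d0 dP]]; exists d => // A mA Ad.
  apply: le_lt_trans (dP A mA Ad); rewrite le_eqVlt; apply/orP; left; apply/eqP.
  by apply: eq_Rintegral => x _; rewrite ger0_norm.
split=> [t ta tb e e0|N mN N0 e e0].
  have [d d0 dP] := kcont _ e0; exists d => // s sa sb.
  wlog : s t sa sb ta tb / s <= t => [H|st] std.
    have [st|/ltW ts] := leP s t; first exact: H.
    by rewrite distrC; apply: H => //; rewrite distrC.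
  rewrite distrC; apply: le_lt_trans (fk s t sa st tb) _; apply: dP => //.
  rewrite lebesgue_measure_itv/= lte_fin; case: ifPn => // _.
  by rewrite -EFinB lte_fin; apply: le_lt_trans std; rewrite distrC ler_norm.
have [d d0 dP] := kcont _ e0.
have [U [oU NU Ud]] : exists U : set R, [/\ open U, N `<=` U & (lambda (U `\` N) < d%:E)%E].
  have Ny : (lambda N < +oo)%E by rewrite N0 ltry.
  exact: lebesgue_regularity_outer.
have mU : measurable (U : set (measurableTypeR R)) by exact: open_measurable.
have {}Ud : (lambda U < d%:E)%E.
  rewrite -(setDUK NU) setUC measureU0//; exact: measurableD.
pose th t := \int[lambda]_(x in `]a, t] `&` U) k x.
have mI s t : measurable ((`]s, t] `&` U) : set (measurableTypeR R)) by exact: measurableI.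
have thB s t : a <= s -> s <= t -> th t - th s = \int[lambda]_(x in `]s, t] `&` U) k x.
  move=> sa st; apply/eqP; rewrite subr_eq addrC; apply/eqP.
  rewrite /th -Rintegral_setU//.
  - by rewrite -setIUl -itv_bndbnd_setU ?bnd_simp.
  - by apply: ikA; exact: measurableU.
  - apply/disj_setPS => x /= [[]]; rewrite !in_itv /= => /andP[_ xs] _ [/andP[sx _] _].
    by move: (lt_le_trans sx xs); rewrite ltxx.
exists th; split=> [s t sa st tb||t Nt ta tb].
- by rewrite -subr_ge0 thB//; exact: Rintegral_ge0.
- rewrite thB//; apply: ltW; apply: dP => //; apply: le_lt_trans Ud.
  by apply: le_measure; rewrite ?inE//; exact: subIsetr.
have [r r0 rU] : exists2 r : R, 0 < r & ball t r `<=` U.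
  by have [r /= r0 rU] := (nbhs_ballP _ _).1 (open_nbhs_nbhs (conj oU (NU _ Nt))); exists r.
exists r => // s ts sr sb; rewrite thB ?(ltW ts)//.
rewrite (_ : _ `&` U = `]t, s]%classic); first by apply: fk => //; exact: ltW.
apply/setIidPl => x /=; rewrite in_itv /= => /andP[tx xs]; apply: rU.
rewrite /ball /= distrC gtr0_norm ?subr_gt0// ltrBlDl; exact: le_lt_trans xs sr.
Qed.

Lemma ac_on_id (a b : R) : ac_on a b (id : R -> R).
Proof.
have mab : measurable (`[a, b] : set (measurableTypeR R)) by exact: measurable_itv.
apply: (@ac_on_integral _ a b (\1_(`[a, b] : set R))).
- exact: integrable_indic_itv.
- by move=> t; rewrite indicE.
move=> s t sa st tb; rewrite ger0_norm ?subr_ge0//.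
rewrite (@eq_Rintegral _ _ _ _ _ (cst 1)); last first.
  move=> x; rewrite inE /= in_itv /= => /andP[sx xt].
  rewrite indicE mem_set//= in_itv /= (le_trans xt)// andbT.
  exact: le_trans sa (ltW sx).
rewrite Rintegral_cst//= mul1r lebesgue_measure_itv/= lte_fin.
case: ifPn => [_|]; first by rewrite -EFinB.
by rewrite -leNgt => ts; rewrite (le_anti (_ : t <= s <= t)) ?ts ?st ?subrr.
Qed.

Lemma expR_lip (x y : R) : x <= y -> `|expR y - expR x| <= expR y * `|y - x|.
Proof.
move=> xy; rewrite !ger0_norm ?subr_ge0 ?ler_expR//.
have := expR_ge1Dx (x - y); rewrite expRD expRN.
rewrite -(ler_pM2r (expR_gt0 y)) -mulrA mulVf ?gt_eqF ?expR_gt0//.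
by lra.
Qed.

(** The product with the integrating factor [expR (omega * (t - a))] is nonincreasing. The rate may
    have any sign: zero gives monotonicity, a negative rate bounds growth. *)
Lemma ac_gronwall (phi : R -> R) (a b omega : R) : a <= b -> ac_on a b phi ->
  (\forall t \ae lambda, t \in `]a, b[ ->
    exists2 d, is_derive t (1 : R) phi d & d <= - omega * phi t) ->
  phi b <= phi a * expR (- omega * (b - a)).
Proof.
move=> ab acphi dphi.
have [M phiM] := continuous_on_bounded ab acphi.1.
pose E := expR (`|omega| * (b - a)).
have leE t : a <= t -> t <= b -> expR (omega * (t - a)) <= E.
  move=> ta tb; rewrite ler_expR; apply: le_trans (ler_norm _) _.
  by rewrite normrM ler_wpM2l// ger0_norm ?subr_ge0// lerD2r.
have E0 : 0 <= E by exact: expR_ge0.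
pose psi t := phi t * expR (omega * (t - a)).
have acpsi : ac_on a b psi.
  apply: (@ac_on_lip R _ _ _ a b (E + `|M| * (E * `|omega|)) phi id) => //; first exact: ac_on_id.
  move=> s t sa sb ta tb.
  have -> : psi s - psi t = (phi s - phi t) * expR (omega * (s - a)) +
      phi t * (expR (omega * (s - a)) - expR (omega * (t - a))) by rewrite /psi; ring.
  apply: le_trans (ler_normD _ _) _; rewrite !normrM (ger0_norm (expR_ge0 _)).
  have h1 : `|phi s - phi t| * expR (omega * (s - a)) <= E * `|phi s - phi t|.
    by rewrite mulrC ler_wpM2r// leE.
  have h2 : `|expR (omega * (s - a)) - expR (omega * (t - a))| <= E * `|omega| * `|s - t|.
    have h x y : a <= x -> x <= b -> a <= y -> y <= b -> omega * (x - a) <= omega * (y - a) ->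
       `|expR (omega * (y - a)) - expR (omega * (x - a))| <= E * `|omega| * `|y - x|.
      move=> xa xb ya yb /expR_lip /le_trans; apply.
      rewrite -mulrBr opprB addrA subrK normrM mulrA.
      by do 2 apply: ler_wpM2r => //; exact: leE.
    have [st|/ltW ts] := leP (omega * (s - a)) (omega * (t - a)); last exact: h.
    by rewrite distrC [`|s - t|]distrC; exact: h.
  have h3 : `|phi t| <= `|M| by apply: le_trans (phiM t ta tb) (ler_norm _).
  have h4 := ler_pM (normr_ge0 _) (normr_ge0 _) h3 h2.
  have := mulr_ge0 (mulr_ge0 (normr_ge0 M) (mulr_ge0 E0 (normr_ge0 omega))) (normr_ge0 (phi s - phi t)).
  have := mulr_ge0 E0 (normr_ge0 (s - t)).
  move: h1 h4; rewrite [`|M| * (_ * `|s - t|)]mulrA.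
  set n1 := `|s - t|; set n2 := `|phi s - phi t|; set c := `|M| * (E * `|omega|).
  by rewrite [(E + c) * _]mulrDl !mulrDr; lra.
have : psi b <= psi a.
  apply: ac_nonincreasing acpsi _ => //.
  apply: ae_sub dphi => t tP tab; have [d dd dle] := tP tab.
  have e1 : is_derive t (1 : R) (fun t => expR (omega * (t - a))) (omega * expR (omega * (t - a))).
    by apply: is_derive_eq; rewrite /GRing.scale /=; ring.
  exists (phi t * (omega * expR (omega * (t - a))) + expR (omega * (t - a)) * d).
    exact: is_deriveM.
  have -> : phi t * (omega * expR (omega * (t - a))) + expR (omega * (t - a)) * d =
    expR (omega * (t - a)) * (omega * phi t + d) by ring.
  by rewrite pmulr_rle0 ?expR_gt0//; lra.
rewrite /psi subrr mulr0 expR0 mulr1 => h.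
by rewrite mulNr expRN ler_pdivlMr ?expR_gt0.
Qed.

End ac_integral.

(** * Bochner integrals and the absolute continuity of strong solutions *)

Section bochner.
Context (R : realType) (X : innerProductType R).
Local Notation lambda := (@lebesgue_measure R).
Implicit Types (s : simple_fun X) (D : set (measurableTypeR R)).

Lemma measurable_sqrt : measurable_fun setT (Num.sqrt : R -> R).
Proof. by apply: nondecreasing_measurable => // x y; exact: ler_wsqrtr. Qed.

(** Inner products of simple functions are finite sums of products of indicators. Norms of
    differences become measurable through them, without a notion of measurability for [X]-valued
    functions. *)
Lemma measurable_sf_inner D s s' :
  measurable_fun D (fun t => inner (sf_eval s t) (sf_eval s' t)).
Proof.
rewrite (_ : (fun t => _) = fun t => \sum_i \sum_j
    (\1_(@sf_set _ _ s i) t * \1_(@sf_set _ _ s' j) t * inner (@sf_val _ _ s i) (@sf_val _ _ s' j))).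
  apply: measurable_sum => i; apply: measurable_sum => j.
  apply: measurable_funM; last exact: measurable_cst.
  by apply: measurable_funM; apply: measurable_indic; exact: sf_measurable.
apply/funext => t; rewrite /sf_eval.
rewrite (big_morph (inner^~ _) (fun x y => innerDl x y _) (inner0l _)).
apply: eq_bigr => i _; rewrite innerZl.
rewrite (big_morph (inner _) (fun x y => innerDr x y _) (inner0r _)) mulr_sumr.
by apply: eq_bigr => j _; rewrite innerZr mulrA.
Qed.

Lemma normE (x : X) : `|x| = Num.sqrt (inner x x).
Proof. by rewrite inner_norm sqrtr_sqr ger0_norm. Qed.

Lemma measurable_norm_sf D s : measurable_fun D (fun t => `|sf_eval s t|).
Proof.
under eq_fun do rewrite normE.
by apply: measurableT_comp; [exact: measurable_sqrt|exact: measurable_sf_inner].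
Qed.

Lemma measurable_norm_sfB D s s' :
  measurable_fun D (fun t => `|sf_eval s t - sf_eval s' t|).
Proof.
under eq_fun do rewrite normE !innerE.
apply: measurableT_comp; first exact: measurable_sqrt.
apply: measurable_funD; apply: measurable_funD; do ?apply: measurable_funN.
all: by apply: measurable_sf_inner.
Qed.

Lemma sf_norm_le s t : `|sf_eval s t| <= \sum_i `|@sf_val _ _ s i|.
Proof.
apply: le_trans (ler_norm_sum _ _ _) _; apply: ler_sum => i _.
by rewrite normrZ ler_piMl// indicE normr_nat lern1 leq_b1.
Qed.

Variable D : set (measurableTypeR R).
Hypotheses (mD : measurable D) (Dy : (lambda D < +oo)%E).

Lemma integrable_norm_sf s : lambda.-integrable D (EFin \o (fun t => `|sf_eval s t|)).
Proof.
apply: measurable_bounded_integrable => //; first exact: measurable_norm_sf.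
exists (\sum_i `|@sf_val _ _ s i|); split; first exact: num_real.
by move=> M /ltW sM t _ /=; rewrite normr_id; apply: le_trans sM; exact: sf_norm_le.
Qed.

(** The sets of a simple function may overlap, so adding the norms of its terms would give too much.
    Instead the integral is tested with its own value [V]: [|V|^2] is the integral of the inner
    products with [V], and Cauchy-Schwarz allows division by [|V|]. *)
Lemma norm_sf_integral s : `|sf_integral D s| <= \int[lambda]_(t in D) `|sf_eval s t|.
Proof.
set V := sf_integral D s.
have [->|V0] := eqVneq V 0; first by rewrite normr0; exact: Rintegral_ge0.
have iind i : lambda.-integrable D (EFin \o \1_(@sf_set _ _ s i)).
  apply: measurable_bounded_integrable => //.
    by apply: measurable_indic; exact: sf_measurable.
  exists 1; split; first exact: num_real.
  by move=> M /ltW M1 t _ /=; apply: le_trans M1; rewrite indicE normr_nat lern1 leq_b1.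
have iindZ i c : lambda.-integrable D (EFin \o (fun t => \1_(@sf_set _ _ s i) t * c)).
  exact: (integrableZr _ c (iind i)).
have VE : `|V| ^+ 2 = \int[lambda]_(t in D) inner (sf_eval s t) V.
  rewrite -inner_norm {1}/V /sf_integral.
  rewrite (big_morph (inner^~ _) (fun x y => innerDl x y _) (inner0l _)).
  under [in RHS]eq_Rintegral => t _.
    rewrite /sf_eval (big_morph (inner^~ _) (fun x y => innerDl x y _) (inner0l _)).
    under eq_bigr do rewrite innerZl.
    over.
  rewrite /Rintegral; under eq_integral do rewrite -sumEFin.
  rewrite integral_sum//; last by move=> i; exact: iindZ.
  rewrite [in RHS](eq_bigr (fun i =>
    (inner (fine (lambda (@sf_set _ _ s i `&` D)) *: @sf_val _ _ s i) V)%:E)); first by rewrite sumEFin.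
  move=> i _; rewrite innerZl -[LHS]fineK; last exact: integrable_fin_num (iindZ i _).
  congr EFin; rewrite -[LHS]/(\int[lambda]_(t in D) (\1_(@sf_set _ _ s i) t * inner (@sf_val _ _ s i) V)).
  by rewrite RintegralZr// /Rintegral integral_indic//; exact: sf_measurable.
have V0' : 0 < `|V| by rewrite normr_gt0.
rewrite -(ler_pM2r V0') -expr2 VE -RintegralZr//; last exact: integrable_norm_sf.
apply: le_Rintegral => //.
- rewrite (_ : EFin \o _ = fun t => \sum_i ((\1_(@sf_set _ _ s i) t * inner (@sf_val _ _ s i) V)%:E))%E.
    by apply: integrable_sum => // i _; exact: iindZ.
  apply/funext => t; rewrite /= /sf_eval sumEFin.
  rewrite (big_morph (inner^~ _) (fun x y => innerDl x y _) (inner0l _)).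
  by congr EFin; apply: eq_bigr => i _; rewrite innerZl.
- exact: (integrableZr _ `|V| (integrable_norm_sf s)).
- by move=> t _; exact: inner_le_norm.
Qed.

Variables (g : R -> X) (v : X).
Hypothesis gv : bochner_integral D g v.

Let approx : exists s : nat -> simple_fun X,
  [/\ measurable_fun D (fun t => `|g t|),
      forall k, measurable_fun D (fun t => `|g t - sf_eval (s k) t|),
      (\int[lambda]_(t in D) `|g t - sf_eval (s k) t|%:E)%E @[k --> \oo] --> 0%E &
      sf_integral D (s k) @[k --> \oo] --> v].
Proof.
have [s [s1 s2 s3]] := gv; exists s; split=> // [|k].
  apply: (@measurable_fun_cvg _ _ _ _ (fun k t => `|sf_eval (s k) t|)).
    by move=> k; exact: measurable_norm_sf.
  by move=> t Dt; apply: cvg_norm; exact: s1.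
apply: (@measurable_fun_cvg _ _ _ _ (fun j t => `|sf_eval (s j) t - sf_eval (s k) t|)).
  by move=> j; exact: measurable_norm_sfB.
by move=> t Dt; apply: cvg_norm; apply: cvgB; [exact: s1|exact: cvg_cst].
Qed.

Let small (e : R) (u : nat -> \bar R) : 0 < e -> u k @[k --> \oo] --> 0%E ->
  \forall k \near \oo, (u k < e%:E)%E.
Proof.
move=> e0 u0; apply: (u0 [set x | (x < e%:E)%E]); apply: open_nbhs_nbhs.
by split; [exact: open_ereal_lt_ereal|rewrite /= lte_fin].
Qed.

Lemma bochner_norm_integrable : lambda.-integrable D (EFin \o (fun t => `|g t|)).
Proof.
have [s [mg mgs s2 _]] := approx.
have [k _ /(_ k (leqnn k)) /= kP] := small ltr01 s2.
have igs : lambda.-integrable D (EFin \o (fun t => `|g t - sf_eval (s k) t|)).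
  apply/integrableP; split; first exact/measurable_EFinP.
  apply: le_lt_trans (lt_trans kP (ltry 1)).
  by under eq_integral do rewrite /= normr_id.
apply: le_integrable (integrableD mD igs (integrable_norm_sf (s k))) => //.
  exact/measurable_EFinP.
move=> t _; rewrite /= normr_id lee_fin; apply: le_trans (ler_norm _).
by rewrite -[X in `|X| <= _](subrK (sf_eval (s k) t)) ler_normD.
Qed.

Lemma norm_bochner_le : `|v| <= \int[lambda]_(t in D) `|g t|.
Proof.
have ig := bochner_norm_integrable.
have [s [mg mgs s2 s3]] := approx.
apply/ler_addgt0Pl => e e0; have e2 : 0 < e / 2 by rewrite divr_gt0.
have [k [kv kP]] : exists k, `|v - sf_integral D (s k)| < e / 2 /\
    (\int[lambda]_(t in D) `|g t - sf_eval (s k) t|%:E < (e / 2)%:E)%E.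
  move/cvgrPdist_lt: s3 => /(_ _ e2) h1; have h2 := small e2 s2.
  have [k _ kP] : \forall k \near \oo, `|v - sf_integral D (s k)| < e / 2 /\
      (\int[lambda]_(t in D) `|g t - sf_eval (s k) t|%:E < (e / 2)%:E)%E by near do split.
  by exists k; exact: kP (leqnn k).
have igs : lambda.-integrable D (EFin \o (fun t => `|g t - sf_eval (s k) t|)).
  apply/integrableP; split; first exact/measurable_EFinP.
  apply: le_lt_trans (lt_trans kP (ltry _)).
  by under eq_integral do rewrite /= normr_id.
have kP' : \int[lambda]_(t in D) `|g t - sf_eval (s k) t| < e / 2.
  by rewrite -lte_fin fineK//; exact: integrable_fin_num igs.
have h1 : \int[lambda]_(t in D) `|sf_eval (s k) t| <=
    \int[lambda]_(t in D) `|g t - sf_eval (s k) t| + \int[lambda]_(t in D) `|g t|.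
  rewrite -RintegralD//; apply: le_Rintegral => //.
  - exact: integrable_norm_sf.
  - exact: (integrableD mD igs ig).
  - move=> t _; rewrite distrC; apply: le_trans (ler_normD _ _).
    by rewrite subrK.
have h2 := norm_sf_integral (s k).
have h3 : `|v| <= `|v - sf_integral D (s k)| + `|sf_integral D (s k)|.
  by rewrite -{1}[v](subrK (sf_integral D (s k))) ler_normD.
rewrite (splitr e) -addrA; apply: le_trans h3 _; apply: lerD; first exact: ltW.
by apply: le_trans h2 (le_trans h1 _); rewrite lerD2r ltW.
Unshelve. all: by end_near. Qed.

End bochner.

Section W11.
Context (R : realType) (X : innerProductType R).
Local Notation lambda := (@lebesgue_measure R).

(** Increments of [w] are Bochner integrals of [g], hence dominated by the integral of [|g|],
    extended by zero outside the interval. The left end is positive because [W11] says nothing at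
    time zero. *)
Lemma W11_ac (T a b : R) (w : R -> X) : W11 T w -> 0 < a -> a <= b -> b <= T -> ac_on a b w.
Proof.
move=> [g gP] a0 ab bT.
have muy (s t : R) : (lambda `[s, t] < +oo)%E.
  by rewrite lebesgue_measure_itv/=; case: ifPn => _; rewrite ?ltry// -EFinB ltry.
have mitv (s t : R) : measurable (`[s, t] : set (measurableTypeR R)) by exact: measurable_itv.
have ig := bochner_norm_integrable (mitv a b) (muy a b) (gP a b a0 ab bT).
apply: (@ac_on_integral _ _ a b ((fun t => `|g t|) \_ `[a, b])).
- by rewrite -restrict_EFin; exact/(integrable_mkcond _ (mitv a b)).
- by move=> t; rewrite patchE; case: ifPn.
move=> s t sa st tb.
have s0 : 0 < s by exact: lt_le_trans sa.
apply: le_trans (norm_bochner_le (mitv s t) (muy s t) (gP s t s0 st (le_trans tb bT))) _.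
rewrite -Rintegral_itv_obnd_cbnd.
  rewrite le_eqVlt; apply/orP; left; apply/eqP; apply: eq_Rintegral => x.
  rewrite inE /= in_itv /= => /andP[sx xt]; rewrite patchE mem_set//= in_itv /=.
  by rewrite (le_trans xt tb) andbT (le_trans sa (ltW sx)).
apply: integrableS ig => //.
by move=> x /=; rewrite !in_itv /= => /andP[sx xt]; rewrite (le_trans xt tb) andbT (le_trans sa (ltW sx)).
Qed.

End W11.

(** * Trajectories and their exponential decay *)

Section derivatives.
Context (R : realType).

Lemma is_deriveP (X : normedModType R) (f : R -> X) (t : R) (d : X) :
  is_derive t 1 f d <-> h^-1 *: (f (h + t) - f t) @[h --> 0^'] --> d.
Proof.
have E : (fun h : R => h^-1 *: ((f \o shift t) (h *: 1) - f t)) =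
    (fun h => h^-1 *: (f (h + t) - f t)).
  by apply/funext => h; rewrite /= /GRing.scale /= mulr1.
split=> [[df fd]|fd].
  by rewrite -fd -E; exact: df.
have df : derivable f t 1 by rewrite /derivable E; apply/cvg_ex; exists d.
by split=> //; rewrite /derive E; exact: cvg_lim.
Qed.

Lemma is_derive_addr (X : normedModType R) (f : R -> X) (t h : R) (d : X) :
  is_derive (t + h) 1 f d -> is_derive t 1 (fun s => f (s + h)) d.
Proof. by move=> /is_deriveP fd; apply/is_deriveP; under eq_cvg do rewrite -addrA. Qed.

Lemma is_derive_cvg (X : normedModType R) (f : R -> X) (t : R) (d : X) :
  is_derive t 1 f d -> f (h + t) @[h --> 0^'] --> f t.
Proof.
move=> /is_deriveP fd.
have h0 : h @[h --> (0 : R)^'] --> (0 : R) by apply: cvg_within_filter; exact: cvg_id.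
have : h *: (h^-1 *: (f (h + t) - f t)) + f t @[h --> 0^'] --> 0 *: d + f t.
  by apply: cvgD; [exact: cvgZ|exact: cvg_cst].
rewrite scale0r add0r; apply: cvg_trans; apply: near_eq_cvg; near=> h.
have hN0 : h != 0 by near: h; exact: nbhs_dnbhs_neq.
by rewrite /= scalerA divff// scale1r subrK.
Unshelve. all: by end_near. Qed.

Lemma is_derive_linear (X Y : normedModType R) (L : X -> Y) (C : R)
    (f : R -> X) (t : R) (d : X) :
  (forall a x y, L (a *: x + y) = a *: L x + L y) -> (forall x, `|L x| <= C * `|x|) ->
  is_derive t 1 f d -> is_derive t 1 (fun s => L (f s)) (L d).
Proof.
move=> lL bL /is_deriveP fd; apply/is_deriveP.
have LB x y : L (x - y) = L x - L y by rewrite addrC -scaleN1r lL scaleN1r addrC.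
have L0 : L 0 = 0 by rewrite -(subrr 0) LB subrr.
have LZ a x : L (a *: x) = a *: L x by rewrite -[a *: x]addr0 lL L0 addr0.
have K0 : 0 < `|C| + 1 by rewrite ltr_wpDl.
apply/cvgrPdist_lt => e e0.
have /cvgrPdist_lt/(_ _ (divr_gt0 e0 K0)) := fd.
apply: filterS => h; rewrite -LB -LZ -LB => hd.
apply: le_lt_trans (bL _) _; move: hd; rewrite ltr_pdivlMr// mulrC.
by apply: le_lt_trans; apply: ler_wpM2r => //; rewrite ler_wpDr// ler_norm.
Qed.

Lemma is_derive_inner (X : innerProductType R) (f g : R -> X) (t : R) (df dg : X) :
  is_derive t 1 f df -> is_derive t 1 g dg ->
  is_derive t 1 (fun s => inner (f s) (g s)) (inner df (g t) + inner (f t) dg).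
Proof.
move=> fd gd; have gc := is_derive_cvg gd.
move/is_deriveP: fd => fd; move/is_deriveP: gd => gd; apply/is_deriveP.
have -> : (fun h => h^-1 *: (inner (f (h + t)) (g (h + t)) - inner (f t) (g t))) =
    (fun h => inner (h^-1 *: (f (h + t) - f t)) (g (h + t)) +
              inner (f t) (h^-1 *: (g (h + t) - g t))).
  apply/funext => h; rewrite innerZl innerZr innerBl innerBr -mulrDr.
  by rewrite addrA subrK.
by apply: cvgD; apply: cvg_inner => //; exact: cvg_cst.
Qed.

End derivatives.

Section local_absolute_continuity.
Context (R : realType).
Local Notation lambda := (@lebesgue_measure R).

(** The regularity that a strong solution offers: continuity up to time zero, absolute continuity
    only on intervals starting at a positive time. *)
Definition locally_ac (X : normedModType R) (T : R) (f : R -> X) : Prop :=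
  continuous_on 0 T f /\ forall a, 0 < a -> a <= T -> ac_on a T f.

Lemma locally_ac_lip (X Y Z : normedModType R) (T C : R)
    (f : R -> X) (g : R -> Y) (h : R -> Z) :
  locally_ac T f -> locally_ac T g ->
  (forall s t, 0 <= s -> s <= T -> 0 <= t -> t <= T ->
    `|h s - h t| <= C * (`|f s - f t| + `|g s - g t|)) ->
  locally_ac T h.
Proof.
move=> [cf af] [cg ag] hfg; split=> [t ta tb e e0|a a0 aT]; last first.
  apply: (ac_on_lip (af a a0 aT) (ag a a0 aT)) => s t sa sT ta tT.
  by apply: hfg => //; apply: ltW; apply: lt_le_trans a0 _.
pose K := `|C| + 1; have K0 : 0 < K by rewrite ltr_wpDl.
have e' : 0 < e / K / 2 by rewrite !divr_gt0.
have [d d0 fd] := cf t ta tb _ e'; have [d' d'0 gd] := cg t ta tb _ e'.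
exists (Num.min d d'); first by rewrite lt_min d0.
move=> s sa sb; rewrite lt_min => /andP[sd sd'].
apply: le_lt_trans (hfg _ _ sa sb ta tb) _.
apply: (@le_lt_trans _ _ (K * (`|f s - f t| + `|g s - g t|))).
  by apply: ler_wpM2r; [exact: addr_ge0|rewrite /K ler_wpDr// ler_norm].
by rewrite -ltr_pdivlMl// mulrC (splitr (e / K)) ltrD ?fd ?gd.
Qed.

Lemma locally_ac_linear (X Y : normedModType R) (T C : R) (f : R -> X) (L : X -> Y) :
  (forall x y, `|L x - L y| <= C * `|x - y|) ->
  locally_ac T f -> locally_ac T (fun s => L (f s)).
Proof.
move=> bL af; apply: (@locally_ac_lip _ _ _ T `|C| f f) => // s t _ _ _ _.
apply: le_trans (bL _ _) _; apply: (@le_trans _ _ (`|C| * `|f s - f t|)).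
  by apply: ler_wpM2r => //; exact: ler_norm.
by apply: ler_wpM2l => //; rewrite lerDl.
Qed.

Lemma locally_acB (X : normedModType R) (T : R) (f g : R -> X) :
  locally_ac T f -> locally_ac T g -> locally_ac T (fun s => f s - g s).
Proof.
move=> af ag; apply: (@locally_ac_lip _ _ _ T 1 f g) => // s t _ _ _ _.
rewrite mul1r opprD opprK addrACA; apply: le_trans (ler_normD _ _) _.
by rewrite (distrC (g s)) [- g s + _]addrC.
Qed.

Lemma locally_acD (T : R) (f g : R -> R) :
  locally_ac T f -> locally_ac T g -> locally_ac T (fun s => f s + g s).
Proof.
move=> af ag; apply: (@locally_ac_lip _ _ _ T 1 f g) => // s t _ _ _ _.
by rewrite mul1r opprD addrACA; exact: ler_normD.
Qed.

Lemma locally_ac_cst (X : normedModType R) (T : R) (x : X) : locally_ac T (fun=> x).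
Proof.
split=> [t _ _ e e0|a a0 aT]; first by exists 1 => // s *; rewrite subrr normr0.
apply: (@ac_on_lip _ _ _ _ _ _ 1 id id); do ?exact: ac_on_id.
by move=> s t *; rewrite subrr normr0 mul1r addr_ge0.
Qed.

Lemma locally_ac_id (T : R) : locally_ac T (id : R -> R).
Proof.
by split=> [t _ _ e e0|a a0 aT]; [exists e|exact: ac_on_id].
Qed.

Lemma locally_ac_inner (X : innerProductType R) (T : R) (f g : R -> X) : 0 <= T ->
  locally_ac T f -> locally_ac T g -> locally_ac T (fun s => inner (f s) (g s)).
Proof.
move=> T0 af ag.
have [M fM] := continuous_on_bounded T0 af.1; have [N gN] := continuous_on_bounded T0 ag.1.
apply: (@locally_ac_lip _ _ _ T (`|M| + `|N|) f g) => // s t s0 sT t0 tT.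
have -> : inner (f s) (g s) - inner (f t) (g t) =
    inner (f s - f t) (g s) + inner (f t) (g s - g t) by rewrite innerBl innerBr addrA subrK.
apply: le_trans (ler_normD _ _) _.
have h1 := normr_inner_le (f s - f t) (g s); have h2 := normr_inner_le (f t) (g s - g t).
have h3 : `|f s - f t| * `|g s| <= `|f s - f t| * `|N|.
  by rewrite ler_wpM2l// (le_trans (gN _ s0 sT))// ler_norm.
have h4 : `|f t| * `|g s - g t| <= `|M| * `|g s - g t|.
  by rewrite ler_wpM2r// (le_trans (fM _ t0 tT))// ler_norm.
have h5 := mulr_ge0 (normr_ge0 M) (normr_ge0 (f s - f t)).
have h6 := mulr_ge0 (normr_ge0 N) (normr_ge0 (g s - g t)).
rewrite mulrDl !mulrDr.
by move: `|_ + _| `|_| h1 h2 h3 h4 h5 h6 => *; lra.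
Qed.

(** For [s = 0] the estimate is applied from a small positive time [r], and continuity at zero lets
    [r] tend to zero. *)
Lemma locally_ac_gronwall (phi : R -> R) (omega s t : R) :
  0 <= s -> s <= t -> locally_ac t phi ->
  (\forall r \ae lambda, r \in `]s, t[ ->
    exists2 d, is_derive r (1 : R) phi d & d <= - omega * phi r) ->
  phi t <= phi s * expR (- omega * (t - s)).
Proof.
move=> s0 st [cphi aphi] dphi.
have pos r : s <= r -> 0 < r -> r <= t -> phi t <= phi r * expR (- omega * (t - r)).
  move=> sr r0 rt; apply: ac_gronwall => //; first exact: aphi.
  apply: ae_sub dphi => x xP; rewrite in_itv /= => /andP[rx xt].
  by apply: xP; rewrite in_itv /= xt andbT (le_lt_trans sr rx).
move: s0; rewrite le_eqVlt => /predU1P[s0|s0]; last exact: pos.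
subst s.
move: st; rewrite le_eqVlt => /predU1P[->|st]; first by rewrite subrr mulr0 expR0 mulr1.
have : phi r * expR (- omega * (t - r)) @[r --> 0^'+] --> phi 0 * expR (- omega * (t - 0)).
  apply: cvgM.
    apply/cvgrPdist_lt => e e0.
    have [d d0 dP] := cphi 0 (lexx _) (ltW st) e e0.
    near=> r; rewrite distrC.
    have r0 : 0 < r by near: r; exact: nbhs_right_gt.
    apply: dP; first exact: ltW.
    - by near: r; exact: nbhs_right_le.
    - by rewrite subr0 gtr0_norm//; near: r; exact: nbhs_right_lt.
  apply: cvg_at_right_filter.
  apply: (@continuous_comp _ _ _ (fun r => - omega * (t - r)) expR); last exact: continuous_expR.
  by apply: cvgMr; apply: cvgB; [exact: cvg_cst|exact: cvg_id].
move=> /cvgr_to_ge; apply; near=> r.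
have r0 : 0 < r by near: r; exact: nbhs_right_gt.
apply: pos (ltW r0) r0 _.
by near: r; exact: nbhs_right_le.
Unshelve. all: by end_near. Qed.

End local_absolute_continuity.

Section trajectories.
Context (R : realType) (Z : innerProductType R).
Variables (M : partial_op Z Z) (b : Z).
Local Notation lambda := (@lebesgue_measure R).
Implicit Types (w : R -> Z) (T t h : R).

Definition trajectory_on T w : Prop := locally_ac T w /\
  \forall t \ae lambda, t \in `]0, T[ -> dom M (w t) /\ is_derive t 1 w (b - M (w t)).

Lemma strong_solution_trajectory (U : innerProductType R) (S : io_system Z U)
    (u : U) (w0 : Z) w T :
  io_M S = M -> io_B S u = b -> 0 < T ->
  strong_solution S (fun=> u) w0 w -> trajectory_on T w.
Proof.
move=> SM Sb T0 /(_ T T0)[cw ww _ dw]; split; last first.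
  by apply: ae_sub dw => t tP /tP; rewrite SM Sb addrC.
split=> [t t0 tT e e0|a a0 aT]; last exact: W11_ac ww a0 aT (lexx T).
have tT' : `[0, T]%classic t by rewrite /= in_itv /= t0.
move/subspace_continuousP: cw => /(_ t tT') /cvgrPdist_lt /(_ e e0)[d /= d0 dP].
exists d => // s s0 sT sd; rewrite distrC; apply: dP; first by rewrite /= distrC.
by rewrite /= in_itv /= s0.
Qed.

Lemma trajectory_addr T h w : 0 <= h -> trajectory_on (T + h) w ->
  trajectory_on T (fun t => w (t + h)).
Proof.
move=> h0 [[cw aw] dw]; split; last first.
  apply: ae_sub (ae_addr h dw) => t tP; rewrite in_itv /= => /andP[t0 tT].
  have [|dt wt] := tP; first by rewrite in_itv /= ltr_pwDl// ltrD2r.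
  by split=> //; exact: is_derive_addr.
split=> [t t0 tT e e0|a a0 aT]; last first.
  by apply: ac_on_addr; apply: aw; [exact: ltr_pwDl|rewrite lerD2r].
have [||d d0 dP] := cw (t + h) _ _ e e0; [exact: addr_ge0|by rewrite lerD2r|].
exists d => // s s0 sT sd; apply: dP; [exact: addr_ge0|by rewrite lerD2r|].
by rewrite opprD addrACA subrr addr0.
Qed.

Lemma trajectory_cst T z : dom M z -> M z = b -> trajectory_on T (fun=> z).
Proof.
move=> dz Mz; split; first exact: locally_ac_cst.
by apply: aeW => t _; split=> //; rewrite Mz subrr; exact: is_derive_cst.
Qed.

Hypothesis accM : accretive M.

Lemma trajectory_contract w1 w2 s t : 0 <= s -> s <= t ->
  trajectory_on t w1 -> trajectory_on t w2 ->
  `|w1 t - w2 t| <= `|w1 s - w2 s|.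
Proof.
move=> s0 st [a1 d1] [a2 d2].
rewrite -(@ler_pXn2r _ 2) ?nnegrE// -!inner_norm.
(* The factor one is written as an exponential in order to match Gronwall's inequality with rate
   zero. *)
rewrite -[leRHS]mulr1 -expR0 -(mul0r (t - s)) -[X in X * (t - s)]oppr0.
have a12 := locally_acB a1 a2.
apply: (@locally_ac_gronwall _ (fun s => inner (w1 s - w2 s) (w1 s - w2 s))) => //.
  by apply: locally_ac_inner => //; exact: le_trans st.
apply: ae_sub2 d1 d2 => r r1 r2; rewrite in_itv /= => /andP[sr rt].
have r0t : r \in `]0, t[ by rewrite in_itv /= rt andbT; exact: le_lt_trans sr.
have [dom1 {}r1] := r1 r0t; have [dom2 {}r2] := r2 r0t.
have d12 := is_deriveB r1 r2.
exists (inner (b - M (w1 r) - (b - M (w2 r))) (w1 r - w2 r) +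
    inner (w1 r - w2 r) (b - M (w1 r) - (b - M (w2 r)))); first exact: is_derive_inner.
rewrite oppr0 mul0r (innerC (w1 r - w2 r)) -mulr2n.
have -> : b - M (w1 r) - (b - M (w2 r)) = - (M (w1 r) - M (w2 r)).
  by rewrite !opprB addrC addrA subrK.
by rewrite innerNl mulNrn oppr_le0 mulrn_wge0// accM.
Qed.

(** By accretivity [|w - w 0|^2] has derivative at most [2 <b - M (w 0), w - w 0>], and Young's
    inequality with weight [h] bounds this by [h^-1 (|w - w 0|^2 + (L h)^2)]. Gronwall with rate
    [- h^-1] over time [h] costs the factor [expR 1] only. *)
Lemma trajectory_init_lip w h : 0 <= h -> trajectory_on h w -> dom M (w 0) ->
  `|w h - w 0| <= `|b - M (w 0)| * expR 1 * h.
Proof.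
rewrite le_eqVlt => /predU1P[<-|h0]; first by rewrite subrr normr0 mulr0.
move=> [aw dw] dw0; set L := `|b - M (w 0)|.
have e1 : 1 <= expR 1 :> R by rewrite -expR0 ler_expR.
have : inner (w h - w 0) (w h - w 0) + (L * h) ^+ 2 <=
    (inner (w 0 - w 0) (w 0 - w 0) + (L * h) ^+ 2) * expR (- (- h^-1) * (h - 0)).
  apply: (@locally_ac_gronwall _ (fun s => inner (w s - w 0) (w s - w 0) + (L * h) ^+ 2)) => //.
  - exact: ltW.
  - apply: locally_acD; last exact: locally_ac_cst.
    by apply: locally_ac_inner; rewrite ?(ltW h0)//; apply: locally_acB => //; exact: locally_ac_cst.
  apply: ae_sub dw => r /[apply] -[dr wr].
  have d0 : is_derive r 1 (fun s => w s - w 0) (b - M (w r) - 0) by exact: is_deriveB.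
  exists (inner (b - M (w r) - 0) (w r - w 0) + inner (w r - w 0) (b - M (w r) - 0) + 0).
    by apply: is_deriveD; exact: is_derive_inner.
  rewrite subr0 addr0 opprK (innerC (w r - w 0)).
  have h1 := accM dr dw0; rewrite innerBl in h1.
  have h2 : inner (b - M (w 0)) (w r - w 0) <= h / 2 * L ^+ 2 + h^-1 / 2 * `|w r - w 0| ^+ 2.
    exact: inner_le_sqr.
  have h3 : h^-1 * (L * h) ^+ 2 = h * L ^+ 2 by field; rewrite gt_eqF.
  move: h2; rewrite mulrDr h3 inner_norm !(innerBl b); lra.
rewrite subrr inner0l add0r subr0 opprK mulVf ?gt_eqF// inner_norm => hh.
rewrite -(@ler_pXn2r _ 2) ?nnegrE ?mulr_ge0 ?expR_ge0 ?(ltW h0) ?/L//.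
have -> : (L * expR 1 * h) ^+ 2 = (L * h) ^+ 2 * (expR 1 * expR 1) by ring.
have h4 : (L * h) ^+ 2 * expR 1 <= (L * h) ^+ 2 * (expR 1 * expR 1).
  by rewrite ler_wpM2l ?sqr_ge0// ler_peMl ?expR_ge0.
by have := sqr_ge0 (L * h); lra.
Qed.

(** The trajectory and its shift by [h] are both trajectories, so their distance at time [t] is at
    most the one at time zero. *)
Lemma trajectory_lip w t h : 0 <= t -> 0 <= h -> (forall T, 0 < T -> trajectory_on T w) ->
  dom M (w 0) -> `|w (t + h) - w t| <= `|b - M (w 0)| * expR 1 * h.
Proof.
rewrite le_eqVlt => /predU1P[<-|t0]; rewrite le_eqVlt => /predU1P[<-|h0] tw dw.
- by rewrite addr0 subrr normr0 mulr0.
- by rewrite add0r; apply: trajectory_init_lip (ltW h0) _ dw; exact: tw.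
- by rewrite addr0 subrr normr0 mulr0.
apply: le_trans (trajectory_init_lip (ltW h0) (tw h h0) dw).
rewrite -[in X in _ <= `|X - _|](add0r h).
apply: (@trajectory_contract (fun s => w (s + h)) w 0 t) => //; [exact: ltW| |exact: tw].
by apply: trajectory_addr; [exact: ltW|apply: tw; exact: addr_gt0].
Qed.

End trajectories.

Section saddle_convergence.
Context (R : realType) (X Y : innerProductType R).
Variables (T : partial_op X Y) (J : X -> R) (S : Y -> X) (CS CP : R).
Local Notation lambda := (@lebesgue_measure R).
Local Notation M := (saddle_op T J).
Local Notation g := (gradient J).
Hypothesis linT : linear_op T.
Hypothesis cJ : segment_convex J.
Hypothesis gJ : forall x, exists d, is_gradient J x d.
Hypothesis linS : forall a x y, S (a *: x + y) = a *: S x + S y.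
Hypothesis bS : forall y, `|S y| <= CS * `|y|.
Hypothesis TS : forall y, dom T (S y) /\ T (S y) = y.
(** The time derivative of [S e.2] is [- S (T e.1)]; although [T] is unbounded, this has to be
    controlled by [e.1] itself. *)
Hypothesis ST : forall x, dom T x -> `|S (T x)| <= CP * `|x|.
Variables (b wh : hprod X Y) (c rho L : R).
Hypotheses (dwh : dom M wh) (Mwh : M wh = b).
Hypotheses (c0 : 0 < c) (rho0 : 0 < rho).
Hypothesis coercive : forall z, c * Num.min `|z - wh.1| rho ^+ 2 <=
  inner (g z - g wh.1) (z - wh.1).
Hypothesis lip : forall z, `|z - wh.1| < rho -> `|g z - g wh.1| <= L * `|z - wh.1|.
Variable w : R -> hprod X Y.
Hypothesis traj : forall T, 0 < T -> trajectory_on M b T w.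
Hypothesis dw0 : dom M (w 0).

Let accM : accretive M.
Proof. exact: saddle_accretive. Qed.

Let e t : hprod X Y := w t - wh.

Let e_decr s t : 0 <= s -> s <= t -> `|e t| <= `|e s|.
Proof.
move=> s0; rewrite le_eqVlt => /predU1P[->//|st]; have t0 := le_lt_trans s0 st.
by apply: (trajectory_contract accM s0 (ltW st) (traj t0)); exact: trajectory_cst.
Qed.

Let e_ac t : 0 < t -> locally_ac t e.
Proof. by move=> t0; apply: locally_acB; [have [] := traj t0|exact: locally_ac_cst]. Qed.

Let e_derive t : 0 < t -> \forall r \ae lambda, r \in `]0, t[ ->
  dom M (w r) /\ is_derive r 1 e (- (M (w r) - M wh)).
Proof.
move=> t0; have [_ dw] := traj t0; apply: ae_sub dw => r /[apply] -[dr wr].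
split=> //; rewrite opprB Mwh -[_ - _]subr0; exact: is_deriveB.
Qed.

(** Adding the guaranteed drop to the squared error leaves a function that is still nonincreasing,
    by Gronwall with rate zero. *)
Let e_rate r s t : 0 <= r -> 0 <= s -> s <= t ->
  (forall u, s <= u -> u <= t -> r <= `|(e u).1|) ->
  `|e t| ^+ 2 + 2 * (c * Num.min r rho ^+ 2) * (t - s) <= `|e s| ^+ 2.
Proof.
move=> r0 s0; rewrite le_eqVlt => /predU1P[<-|st] re; first by rewrite subrr mulr0 addr0.
have t0 := le_lt_trans s0 st; set d := c * _.
rewrite -!inner_norm.
have := @locally_ac_gronwall _ (fun u => inner (e u) (e u) + 2 * d * (u - s)) 0 s t s0 (ltW st).
rewrite subrr mulr0 addr0 oppr0 mul0r expR0 mulr1; apply.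
  apply: locally_acD; first by apply: locally_ac_inner; rewrite ?(ltW t0)//; exact: e_ac.
  apply: (@locally_ac_linear _ _ _ t `|2 * d| id (fun u => 2 * d * (u - s))); last exact: locally_ac_id.
  by move=> x y; rewrite -mulrBr normrM opprB addrA subrK.
apply: ae_sub (e_derive t0) => u uP; rewrite in_itv /= => /andP[su ut].
have [|du eu] := uP; first by rewrite in_itv /= ut andbT (le_lt_trans s0 su).
have lu : is_derive u (1 : R) (fun u => 2 * d * (u - s)) (2 * d).
  by apply: is_derive_eq; rewrite /GRing.scale /=; ring.
have ieu := is_derive_inner eu eu.
exists (inner (- (M (w u) - M wh)) (e u) + inner (e u) (- (M (w u) - M wh)) + 2 * d).
  exact: is_deriveD.
rewrite mul0r (innerC (e u)) innerNl inner_saddle//.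
have dP : d <= inner (g (w u).1 - g wh.1) ((w u).1 - wh.1).
  apply: le_trans (coercive _); rewrite ler_pM2l//.
  rewrite ler_pXn2r ?nnegrE ?le_min ?r0 ?(ltW rho0) ?normr_ge0//.
  by rewrite !ge_min lexx orbT andbT; apply/orP; left; apply: re; exact: ltW.
by move: (inner _ _) dP => *; lra.
Qed.

(* |e|^2 has a limit and e is Lipschitz in time: if |e.1| were at least r at a
   late time, it would stay above r / 2 for a fixed duration, during which |e|^2
   would drop by more than is left. *)
Let primal_small r : 0 < r -> exists2 t0, 0 <= t0 & forall t, t0 <= t -> `|(e t).1| < r.
Proof.
move=> r0; pose K := `|b - M (w 0)| * expR 1 + 1.
have K0 : 0 < K by rewrite ltr_wpDl// mulr_ge0 ?expR_ge0.
(* [K] bounds the speed of the trajectory, so within time [h] the primal error changes by at most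
   [r / 2]. *)
pose h := r / 2 / K; have h0 : 0 < h by rewrite !divr_gt0.
pose d := c * Num.min (r / 2) rho ^+ 2.
have d0 : 0 < d by rewrite mulr_gt0// exprn_gt0// lt_min rho0 divr_gt0.
pose E := [set `|e t| ^+ 2 | t in [set t | 0 <= t]].
have E0 : has_inf E.
  split; first by exists (`|e 0| ^+ 2), 0 => /=.
  by exists 0 => _ [t _ <-]; exact: sqr_ge0.
have dh0 : 0 < d * h by exact: mulr_gt0.
have [_ [s /= s0 <-] sE] := inf_adherent dh0 E0; exists s => // t st.
rewrite ltNge; apply/negP => rt; have t0 := le_trans s0 st.
have th : t <= t + h by rewrite lerDl ltW.
have : `|e (t + h)| ^+ 2 + 2 * d * (t + h - t) <= `|e t| ^+ 2.
  apply: e_rate => //; first by rewrite divr_ge0// ltW.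
  move=> u tu uh; have ut0 : 0 <= u - t by rewrite subr_ge0.
  have : `|(e u).1 - (e t).1| <= r / 2.
    apply: le_trans (hprod_norm1 (e u - e t)) _; rewrite /e opprB addrA subrK.
    have := trajectory_lip accM t0 ut0 traj dw0; rewrite (addrC t) subrK => /le_trans; apply.
    apply: (@le_trans _ _ (K * h)); last by rewrite /h mulrC divfK// gt_eqF.
    apply: ler_pM; [by rewrite mulr_ge0 ?expR_ge0|by []|by rewrite lerDl|].
    by rewrite lerBlDl.
  have := ler_normB (e u).1 ((e u).1 - (e t).1); rewrite opprB addrC subrK; lra.
have : inf E <= `|e (t + h)| ^+ 2.
  by apply: ge_inf; [exact: E0.2|exists (t + h) => //=; exact: le_trans t0 th].
have : `|e t| ^+ 2 <= `|e s| ^+ 2 by rewrite ler_pXn2r ?nnegrE// e_decr.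
rewrite addrAC subrr add0r -mulrA; lra.
Qed.

(** [K0] collects the coefficients of [eps * |e.1|^2] in the derivative of the Lyapunov function:
    from the gradient paired with [S e.2], from [S (T e.1)], and one for the rate itself. The first
    bound in [eps] lets coercivity absorb them, the second keeps the Lyapunov function equivalent to
    the squared norm. *)
Let K0 := L ^+ 2 * CS ^+ 2 + 2 * `|CP| + 1.
Let eps := Num.min (c / K0) (2 * (`|CS| + 1))^-1.

Let K0_ge1 : 1 <= K0.
Proof. by rewrite /K0 lerDr; apply: addr_ge0; apply: mulr_ge0; rewrite ?sqr_ge0. Qed.

Let eps_gt0 : 0 < eps.
Proof.
by rewrite lt_min divr_gt0 ?(lt_le_trans ltr01 K0_ge1)// invr_gt0 mulr_gt0// ltr_wpDl.
Qed.

Let epsK : eps * K0 <= c.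
Proof.
by rewrite -ler_pdivlMr ?(lt_le_trans ltr01 K0_ge1)// ge_min lexx.
Qed.

Let epsS : eps * `|CS| <= 2^-1.
Proof.
have CS1 : 0 < `|CS| + 1 by rewrite ltr_wpDl.
have : eps <= 2^-1 * (`|CS| + 1)^-1 by rewrite -invfM ge_min lexx orbT.
rewrite ler_pdivlMr// mulrDr mulr1; have := ltW eps_gt0; lra.
Qed.

(* Along a trajectory the derivative of <e.1, S e.2> contains |e.2|^2, the part
   that the decrease of |e|^2 does not control. *)
Let V (v : hprod X Y) : R := inner v v - 2 * eps * inner v.1 (S v.2).

Let V_bounds v : `|v| ^+ 2 / 2 <= V v /\ V v <= 2 * `|v| ^+ 2.
Proof.
have h : `|2 * eps * inner v.1 (S v.2)| <= `|v| ^+ 2 / 2.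
  rewrite normrM gtr0_norm ?mulr_gt0//.
  have h1 := normr_inner_le v.1 (S v.2).
  have h2 : `|v.1| * `|S v.2| <= `|v.1| * (`|CS| * `|v.2|).
    rewrite ler_wpM2l//; apply: le_trans (bS _) _.
    by rewrite ler_wpM2r// ler_norm.
  have h3 : 2 * (`|v.1| * `|v.2|) <= `|v| ^+ 2.
    by rewrite hprod_sqr_norm; have := sqr_ge0 (`|v.1| - `|v.2|); rewrite sqrrB; lra.
  apply: (@le_trans _ _ (2 * eps * (`|v.1| * (`|CS| * `|v.2|)))).
    by rewrite ler_wpM2l ?mulr_ge0 ?(ltW eps_gt0)//; exact: le_trans h1 h2.
  have -> : 2 * eps * (`|v.1| * (`|CS| * `|v.2|)) = eps * `|CS| * (2 * (`|v.1| * `|v.2|)) by ring.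
  apply: (@le_trans _ _ (2^-1 * (2 * (`|v.1| * `|v.2|)))); last by lra.
  by rewrite ler_wpM2r// !mulr_ge0.
move: h; rewrite ler_norml /V inner_norm => /andP[h1 h2]; split; lra.
Qed.

Let V_decay s t : 0 <= s -> s <= t -> (forall u, s <= u -> `|(e u).1| < rho) ->
  V (e t) <= V (e s) * expR (- (eps / 2) * (t - s)).
Proof.
move=> s0; rewrite le_eqVlt => /predU1P[<-|st] small; first by rewrite subrr mulr0 expR0 mulr1.
have t0 := le_lt_trans s0 st.
have LB x y : S (x - y) = S x - S y by rewrite addrC -scaleN1r linS scaleN1r addrC.
have lin1 a (x y : hprod X Y) : (a *: x + y).1 = a *: x.1 + y.1 by [].
have lin2 a (x y : hprod X Y) : S (a *: x + y).2 = a *: S x.2 + S y.2 by rewrite -linS.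
have b1 (x : hprod X Y) : `|x.1| <= 1 * `|x| by rewrite mul1r hprod_norm1.
have b2 (x : hprod X Y) : `|S x.2| <= `|CS| * `|x|.
  apply: le_trans (bS _) _; apply: (@le_trans _ _ (`|CS| * `|x.2|)).
    by rewrite ler_wpM2r// ler_norm.
  by rewrite ler_wpM2l// hprod_norm2.
have ac1 : locally_ac t (fun u => (e u).1).
  by apply: (@locally_ac_linear _ _ _ t 1 e (fun x : hprod X Y => x.1)) (e_ac t0) => x y; exact: (b1 (x - y)).
have ac2 : locally_ac t (fun u => S (e u).2).
  apply: (@locally_ac_linear _ _ _ t `|CS| e (fun x : hprod X Y => S x.2)) (e_ac t0) => x y.
  by rewrite -LB; exact: (b2 (x - y)).
have t0' := ltW t0.
apply: (@locally_ac_gronwall _ (fun u => V (e u)) (eps / 2)) => //; first exact: ltW.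
  apply: locally_acB; first by apply: locally_ac_inner => //; exact: e_ac.
  apply: (@locally_ac_linear _ _ _ t `|2 * eps| _ (fun u => 2 * eps * u)); last exact: locally_ac_inner.
  by move=> x y; rewrite -mulrBr normrM.
apply: ae_sub (e_derive t0) => u uP; rewrite in_itv /= => /andP[su ut].
have [|du eu] := uP; first by rewrite in_itv /= ut andbT (le_lt_trans s0 su).
set de := - (M (w u) - M wh) in eu.
have eu1 := is_derive_linear lin1 b1 eu.
have eu2 := is_derive_linear lin2 b2 eu.
exists (inner de (e u) + inner (e u) de -
  2 * eps * (inner de.1 (S (e u).2) + inner (e u).1 (S de.2))).
  apply: is_deriveB; first exact: is_derive_inner.
  by apply: is_deriveZ; exact: is_derive_inner.
have [du1 du2] := du; have [dh1 dh2] := dwh.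
have [dz Tz] := linear_opB linT du1 dh1.
have [dS TSe] := TS (e u).2.
(* As [T (S p) = p], pairing the adjoint part of the velocity with [S e.2] returns [|e.2|^2]. *)
have adj := adjointB du2 dh2 dS; rewrite TSe in adj.
set gd := g (w u).1 - g wh.1.
have de1 : inner de.1 (S (e u).2) = - inner gd (S (e u).2) + `|(e u).2| ^+ 2.
  rewrite -inner_norm [X in _ + X]adj (innerC (S _)) -innerNl -innerDl; congr inner.
  rewrite -[de.1]/(- (g (w u).1 - adjoint T (w u).2 - (g wh.1 - adjoint T wh.2))) /gd.
  set a1 := adjoint T (w u).2; set a2 := adjoint T wh.2.
  set g1 := g (w u).1; set g2 := g wh.1.
  by rewrite !opprB [a1 - g1]addrC addrACA [- a2 + a1]addrC.
have de2 : S de.2 = - S (T (e u).1).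
  rewrite -[de.2]/(- (T (w u).1 - T wh.1)) -Tz -[- _]sub0r LB.
  by have := LB 0 0; rewrite subr0 => ->; rewrite subrr sub0r.
have dM : inner de (e u) = - inner gd (e u).1 by rewrite innerNl inner_saddle.
rewrite (innerC (e u)) dM de1 de2 innerNr.
have /lip : `|(w u).1 - wh.1| < rho by apply: small; exact: ltW.
have := coercive (w u).1; rewrite -/gd.
have -> : (w u).1 - wh.1 = (e u).1 by [].
have -> : Num.min `|(e u).1| rho = `|(e u).1|.
  by apply/min_idPl; apply: ltW; apply: small; exact: ltW.
move=> coer lipu.
(* Young's inequality spends half of the gained [2 * eps * |e.2|^2] on the gradient term; the other
   half pays for the decay, since [V] is at most twice the squared norm. *)
have h1 : `|inner gd (S (e u).2)| <= (`|(e u).2| ^+ 2 + L ^+ 2 * CS ^+ 2 * `|(e u).1| ^+ 2) / 2.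
  apply: le_trans (normr_inner_le _ _) _.
  apply: (@le_trans _ _ ((L * `|(e u).1|) * (CS * `|(e u).2|))); first exact: ler_pM.
  have := sqr_ge0 (L * `|(e u).1| * CS - `|(e u).2|); rewrite sqrrB !exprMn; lra.
have h2 : `|inner (e u).1 (S (T (e u).1))| <= `|CP| * `|(e u).1| ^+ 2.
  apply: le_trans (normr_inner_le _ _) _; rewrite expr2 mulrCA ler_wpM2l//.
  by apply: le_trans (ST dz) _; rewrite ler_wpM2r// ler_norm.
have [_ hV] := V_bounds (e u).
have hV' : eps / 2 * V (e u) <= eps * (`|(e u).1| ^+ 2 + `|(e u).2| ^+ 2).
  have -> : eps * (`|(e u).1| ^+ 2 + `|(e u).2| ^+ 2) = eps / 2 * (2 * `|e u| ^+ 2).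
    by rewrite hprod_sqr_norm; field.
  by rewrite ler_wpM2l// divr_ge0// ltW.
have z0 := sqr_ge0 `|(e u).1|; have p0 := sqr_ge0 `|(e u).2|.
have hK : eps * K0 * `|(e u).1| ^+ 2 <= c * `|(e u).1| ^+ 2 by rewrite ler_wpM2r.
have h1' := le_trans (ler_norm _) h1; have h2' := le_trans (ler_norm _) h2.
have h1e := ler_wpM2l (ltW eps_gt0) h1'; have h2e := ler_wpM2l (ltW eps_gt0) h2'.
have hec : 0 <= c * `|(e u).1| ^+ 2 by rewrite mulr_ge0// ltW.
rewrite -[X in _ <= _ * X]/(V (e u)); move: (V (e u)) hV' => v hV'.
move: hK h1e h2e coer hec hV' z0 p0; rewrite /K0.
move: (inner gd (S _)) (inner gd (e u).1) (inner (e u).1 _) (`|_| ^+ 2) (`|_| ^+ 2) => *.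
by lra.
Qed.

Lemma saddle_exponential : exists K omega : R, 0 < omega /\
  forall t, 0 <= t -> `|w t - wh| <= K * expR (- omega * t).
Proof.
have [s s0 small] := primal_small rho0.
(* After the entry time [s] the bounds on [V] give [|e t|^2 <= 4 |e 0|^2 expR (- (eps / 2) * (t -
   s))], and the square root produces [2] and [eps / 4]. Before [s] the factor [expR (eps / 4 * s)]
   makes the bound follow from contraction. *)
exists (2 * `|e 0| * expR (eps / 4 * s)), (eps / 4); split; first by rewrite divr_gt0.
move=> t t0; rewrite -[X in _ <= X]mulrA -expRD mulNr -mulrBr -/(e t).
have [ts|/ltW st] := leP t s.
  apply: le_trans (e_decr (lexx 0) t0) _.
  have E1 : 1 <= expR (eps / 4 * (s - t)).
    by rewrite -expR0 ler_expR mulr_ge0 ?subr_ge0// divr_ge0// ltW.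
  by have := ler_wpM2l (normr_ge0 (e 0)) E1; have := normr_ge0 (e 0); lra.
rewrite -(@ler_pXn2r _ 2) ?nnegrE ?mulr_ge0 ?expR_ge0// !exprMn -expRM_natl.
have decay := V_decay s0 st small.
have [lb _] := V_bounds (e t); have [_ ub] := V_bounds (e s).
have es : `|e s| ^+ 2 <= `|e 0| ^+ 2 by rewrite ler_pXn2r ?nnegrE// e_decr.
have -> : 2%:R * (eps / 4 * (s - t)) = - (eps / 2) * (t - s) by field.
have : V (e s) * expR (- (eps / 2) * (t - s)) <= 2 * `|e 0| ^+ 2 * expR (- (eps / 2) * (t - s)).
  by rewrite ler_wpM2r ?expR_ge0//; lra.
lra.
Qed.

End saddle_convergence.

(** * Completeness of L^2 *)

Section riesz_fischer.
Context (disp : measure_display) (T : measurableType disp) (R : realType) (mu : {measure set T -> \bar R}).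

Lemma Lfun2P (f : T -> R) : measurable_fun setT f ->
  (\int[mu]_t ((f t ^+ 2)%:E) < +oo)%E -> f \in Lfun mu 2%:E.
Proof.
move=> mf fy; rewrite inE; apply/andP; split; rewrite inE//=.
rewrite /finite_norm unlock /= poweR_lty//.
rewrite [X in (X < _)%E](_ : _ = \int[mu]_t ((f t ^+ 2)%:E))%E//.
by apply: eq_integral => t _; rewrite /= powR_mulrn// real_normK// num_real.
Qed.

Lemma Lfun_measurable (p : \bar R) (f : T -> R) : f \in Lfun mu p -> measurable_fun setT f.
Proof. by rewrite inE => /andP[+ _]; rewrite inE. Qed.

Lemma Lfun2B (f g : T -> R) : f \in Lfun mu 2%:E -> g \in Lfun mu 2%:E ->
  (fun t => f t - g t) \in Lfun mu 2%:E.
Proof.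
have [_ LD] : submod_closed (Lfun mu 2%:E).
  by apply: Lfun_submod_closed; rewrite lee_fin ler1n.
move=> fL gL; have := LD (-1) g f gL fL; rewrite scaleN1r.
by rewrite (_ : - g + f = fun t => f t - g t)//; apply/funext => t; rewrite addrC.
Qed.

Hypothesis muT : (mu setT < +oo)%E.

Lemma fin_integrable_cst (c : R) : mu.-integrable setT (EFin \o cst c).
Proof.
apply: measurable_bounded_integrable => //; exists `|c|; split; first exact: num_real.
by move=> r /ltW cr t _.
Qed.

Variable f : nat -> T -> R.
Hypothesis fL : forall k, f k \in Lfun mu 2%:E.
Hypothesis fC : forall e : R, 0 < e -> exists N, forall i j, (N <= i)%N -> (N <= j)%N ->
  \int[mu]_t (f i t - f j t) ^+ 2 < e.

Let mf k : measurable_fun setT (f k).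
Proof. exact: Lfun_measurable (fL k). Qed.

Let ifB i j : mu.-integrable setT (EFin \o (fun t => (f i t - f j t) ^+ 2)).
Proof. by apply: Lfun2_integrable_sqr; exact: Lfun2B. Qed.

Let fast_subsequence : exists phi : nat -> nat, (forall k, (k <= phi k)%N) /\
  forall k, \int[mu]_t (f (phi k.+1) t - f (phi k) t) ^+ 2 < (4^-1) ^+ k.
Proof.
have /choice[N NP] : forall k, exists N, forall i j, (N <= i)%N -> (N <= j)%N ->
    \int[mu]_t (f i t - f j t) ^+ 2 < (4^-1) ^+ k.
  by move=> k; apply: fC; rewrite exprn_gt0.
(* The running sum dominates both [k] and [N k], so the terms [phi k] and [phi k.+1] lie beyond
   [N k]. *)
exists (fun k => \sum_(l < k.+1) (N l).+1)%N; split=> k.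
  elim: k => // k IH; rewrite big_ord_recr /= addnS ltnS.
  exact: leq_trans IH (leq_addr _ _).
apply: NP; last by rewrite big_ord_recr /= (leq_trans (leqnSn _))// leq_addl.
by rewrite 2!big_ord_recr /= addnAC (leq_trans (leqnSn _))// leq_addl.
Qed.

(** Riesz-Fischer: along a fast subsequence the sum of the absolute increments is integrable, hence
    finite almost everywhere, which gives a pointwise limit. Fatou's lemma carries the Cauchy
    estimate over to it. *)
Lemma Lfun2_complete : exists2 g : T -> R, g \in Lfun mu 2%:E &
  forall e : R, 0 < e -> exists N, forall i, (N <= i)%N ->
    \int[mu]_t (f i t - g t) ^+ 2 <= e.
Proof.
have [phi [phik phiP]] := fast_subsequence.
pose dd k t := `|f (phi k.+1) t - f (phi k) t|.
have muTfin : mu setT \is a fin_num by rewrite ge0_fin_numE.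
have id k : mu.-integrable setT (EFin \o dd k).
  apply/Lfun1_integrable.
  apply: (@Lfun_norm _ _ _ mu (fun t => f (phi k.+1) t - f (phi k) t)).
  by apply: Lfun_subset12 => //; exact: Lfun2B.
have dd0 k t : (0 <= (dd k t)%:E)%E by rewrite lee_fin /dd.
have md k : measurable_fun setT (dd k) by have /integrableP[/measurable_EFinP] := id k.
pose C := (fine (mu setT) + 1) / 2.
have C0 : 0 <= C by rewrite divr_ge0// addr_ge0// fine_ge0.
(* Finite measure turns quadratic smallness into an L^1 bound: [|x| <= 2^-k / 2 + 2^k / 2 * x^2],
   where the integral of [x^2] is below [4^-k]. The result is written as a term of the series in
   [epsilon_trick0]. *)
have intd k : (\int[mu]_t (dd k t)%:E <= (2 * C / (2 ^ k.+1)%:R)%:E)%E.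
  rewrite -(fineK (integrable_fin_num measurableT (id k))) lee_fin.
  have p0 : 0 < 2%:R ^+ k :> R by rewrite exprn_gt0.
  have icst c : mu.-integrable setT (EFin \o cst (c : R)) by exact: fin_integrable_cst.
  have isq : mu.-integrable setT (EFin \o (fun t => 2 ^+ k / 2 * (f (phi k.+1) t - f (phi k) t) ^+ 2)).
    exact: (integrableZl _ (2 ^+ k / 2) (ifB _ _)).
  apply: (@le_trans _ _ (\int[mu]_t ((2 ^+ k)^-1 / 2 + 2 ^+ k / 2 * (f (phi k.+1) t - f (phi k) t) ^+ 2))).
    apply: le_Rintegral => //; first exact: (integrableD measurableT (icst _) isq).
    move=> t _; rewrite /dd -(real_normK (num_real (f (phi k.+1) t - f (phi k) t))).
    have := sqr_ge0 (2 ^+ k * `|f (phi k.+1) t - f (phi k) t| - 1).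
    move: `|_| => x; rewrite -(pmulr_rge0 _ (_ : 0 < (2 ^+ k)^-1 / 2)) ?divr_gt0 ?invr_gt0// => h.
    rewrite -subr_ge0; apply: le_trans h _; rewrite le_eqVlt; apply/orP; left; apply/eqP.
    by field; rewrite gt_eqF.
  rewrite RintegralD//; last exact: icst.
  rewrite Rintegral_cst// RintegralZl//.
  have : 2 ^+ k / 2 * \int[mu]_t (f (phi k.+1) t - f (phi k) t) ^+ 2 <= 2 ^+ k / 2 * (4^-1) ^+ k.
    by rewrite ler_wpM2l ?divr_ge0 ?(ltW p0)// ltW.
  have -> : 2 ^+ k / 2 * 4^-1 ^+ k = (2 ^+ k)^-1 / 2 :> R.
    by rewrite exprVn (_ : 4 = 2 * 2 :> R) ?exprMn; [field; rewrite gt_eqF|ring].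
  rewrite natrX exprS.
  have -> : 2 * C / (2%:R * 2%:R ^+ k) = (2 ^+ k)^-1 / 2 * fine (mu setT) + (2 ^+ k)^-1 / 2.
    by rewrite /C; field; rewrite gt_eqF.
  lra.
have sumd : (\int[mu]_t (\sum_(0 <= k <oo) (dd k t)%:E) < +oo)%E.
  rewrite integral_nneseries//; last by move=> k; exact/measurable_EFinP.
  apply: le_lt_trans (ltry (2 * C)).
  apply: le_trans (epsilon_trick0 xpredT _); last by rewrite mulr_ge0.
  apply: lee_nneseries => [k _ _|k _]; last exact: intd.
  by apply: integral_ge0 => t _; exact: dd0.
have aecvg : {ae mu, forall t, cvgn (fun k => f (phi k) t)}.
  have isum : mu.-integrable setT (fun t => (\sum_(0 <= k <oo) (dd k t)%:E)%E).
    apply/integrableP; split.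
      apply: ge0_emeasurable_sum => k; first by move=> t _ _; exact: dd0.
      by move=> _; exact/measurable_EFinP.
    apply: le_lt_trans sumd; rewrite le_eqVlt; apply/orP; left; apply/eqP.
    by apply: eq_integral => t _; rewrite gee0_abs// nneseries_ge0// => k _ _; exact: dd0.
  apply: (@filterS _ _ (ae_filter_ringOfSetsType mu)) (integrable_ae measurableT isum) => t /(_ I) tfin.
  have cd : cvgn (series (fun k => dd k t)).
    apply: nondecreasing_is_cvgn.
      by apply: nondecreasing_series => k _ _; exact: normr_ge0.
    exists (fine (\sum_(0 <= k <oo) (dd k t)%:E)%E) => _ [m _ <-].
    rewrite -lee_fin fineK// /series /= -sumEFin.
    by apply: nneseries_lim_ge => k _ _; exact: dd0.
  have : cvgn (series (telescope (fun k => f (phi k) t))) by exact: normed_cvg cd.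
  rewrite telescopeK => c.
  rewrite (_ : (fun k => f (phi k) t) = fun k => (f (phi k) t - f (phi 0%N) t) + f (phi 0%N) t).
    by apply: is_cvgD => //; exact: is_cvg_cst.
  by apply/funext => k; rewrite subrK.
have [N0 [mN0 N00 N0P]] := aecvg.
(* Set to zero on the exceptional null set, the subsequence converges everywhere, so its limit is
   measurable. *)
pose h k t := f (phi k) t * \1_(~` N0) t.
have mh k : measurable_fun setT (h k).
  by apply: measurable_funM => //; apply: measurable_indic; exact: measurableC.
have ch t : cvgn (h^~ t).
  have [Nt|Nt] := pselect (N0 t); last first.
    by apply: is_cvgM; [apply: contrapT => c; apply: Nt; exact: N0P|exact: is_cvg_cst].
  rewrite (_ : h^~ t = cst 0); first exact: is_cvg_cst.
  by apply/funext => k; rewrite /h indicE memNset ?mulr0// => /(_ Nt).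
pose g t := limn (h^~ t).
have mg : measurable_fun setT g.
  by apply: (@measurable_fun_cvg _ _ _ _ h) => // t _; exact: ch.
have gP e : 0 < e -> exists N, forall i, (N <= i)%N ->
    (\int[mu]_t ((f i t - g t) ^+ 2)%:E <= e%:E)%E.
  move=> e0; have [N NP] := fC e0; exists N => i Ni.
  pose u k t := ((f i t - h k t) ^+ 2)%:E.
  have mu_ k : measurable_fun setT (u k).
    by apply/measurable_EFinP; apply: measurable_funX; exact: measurable_funB.
  have u0 k t : (0 <= u k t)%E by rewrite lee_fin sqr_ge0.
  have intu k : (N <= k)%N -> (\int[mu]_t u k t <= e%:E)%E.
    move=> Nk.
    have -> : (\int[mu]_t u k t = \int[mu]_t ((f i t - f (phi k) t) ^+ 2)%:E)%E.
      apply: ae_eq_integral => //.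
        by apply/measurable_EFinP; apply: measurable_funX; exact: measurable_funB.
      exists N0; split=> // t /= tP; apply: contrapT => Nt; apply: tP => _.
      by rewrite /u /h indicE mem_set// mulr1.
    rewrite -(fineK (integrable_fin_num measurableT (ifB i (phi k)))) lee_fin.
    by apply: ltW; apply: NP => //; exact: leq_trans Nk (phik k).
  have -> : (\int[mu]_t ((f i t - g t) ^+ 2)%:E = \int[mu]_t limn_einf (u^~ t))%E.
    apply: eq_integral => t _.
    have : u k t @[k --> \oo] --> ((f i t - g t) ^+ 2)%:E.
      apply: cvg_EFin; first by apply: nearW.
      rewrite /u; under eq_cvg do rewrite /= expr2; rewrite expr2.
      by apply: cvgM; (apply: cvgB; [exact: cvg_cst|exact: ch]).
    by move=> /cvg_limn_einf_sup[-> _].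
  apply: le_trans (fatou mu measurableT mu_ (fun k t _ => u0 k t)) _.
  rewrite limn_einf_lim; apply: lime_le; first exact: is_cvg_einfs.
  exists N => // k /= Nk; apply: le_trans (intu k Nk).
  by apply: ereal_inf_lbound; exists k => /=.
have gL : g \in Lfun mu 2%:E.
  have [N NP] := gP 1 ltr01.
  have fgL : (fun t => f N t - g t) \in Lfun mu 2%:E.
    apply: Lfun2P; first exact: measurable_funB.
    exact: le_lt_trans (NP N (leqnn _)) (ltry _).
  rewrite (_ : g = fun t => f N t - (f N t - g t)); first exact: Lfun2B.
  by apply/funext => t; rewrite opprB addrC subrK.
exists g => // e e0; have [N NP] := gP e e0; exists N => i /NP.
rewrite -lee_fin fineK//; apply: integrable_fin_num => //.
by apply: (Lfun2_integrable_sqr (f := fun t => f i t - g t)); exact: Lfun2B.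
Qed.

End riesz_fischer.

(** * The measure on the horizon and vector-valued L^2 *)

Section lebesgue_on_facts.
Context (R : realType) (tf : R).
Local Notation mu := (lebesgue_on tf).
Local Notation lambda := (@lebesgue_measure R).
Local Notation D := (`[0, tf]%classic : set (measurableTypeR R)).

Lemma lebesgue_onE (A : set (measurableTypeR R)) : mu A = lambda (A `&` D).
Proof. by []. Qed.

Lemma itv_measure_lty (a b : R) : (lambda `[a, b] < +oo)%E.
Proof. by rewrite lebesgue_measure_itv/=; case: ifPn => _; rewrite ?ltry// -EFinB ltry. Qed.

Lemma itv_measureE (a b : R) : a <= b -> lambda `[a, b] = (b - a)%:E.
Proof.
rewrite le_eqVlt lebesgue_measure_itv/= lte_fin => /predU1P[->|->]; last by [].
by rewrite ltxx subrr.
Qed.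

Lemma lebesgue_on_lty : (mu setT < +oo)%E.
Proof. by rewrite lebesgue_onE setTI; exact: itv_measure_lty. Qed.

Lemma ae_lebesgue_on (P : R -> Prop) :
  (\forall t \ae mu, P t) <-> (\forall t \ae lambda, t \in `[0, tf] -> P t).
Proof.
have mD : measurable D by exact: measurable_itv.
split=> [] [N [mN N0 PN]].
  exists (N `&` D); split=> //; first exact: measurableI.
  move=> t /= tP; split; last by apply: contrapT => tD; apply: tP => /tD.
  by apply: PN => Pt; apply: tP.
exists (N `|` ~` D); split.
- by apply: measurableU => //; exact: measurableC.
- rewrite lebesgue_onE setIUl (setIC (~` D)) setICr setU0.
  apply/eqP; rewrite -measure_le0 -N0 le_measure ?inE//; exact: measurableI.
- move=> t /= Pt; have [tD|tD] := pselect (D t); last by right.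
  by left; apply: PN => /= tP; exact: Pt (tP tD).
Qed.

Lemma ae_lebesgue_on_itv (P : R -> Prop) :
  (forall t, 0 <= t -> t <= tf -> P t) -> \forall t \ae mu, P t.
Proof.
move=> tP; apply/ae_lebesgue_on; apply: aeW => t; rewrite in_itv /= => /andP[].
exact: tP.
Qed.

Lemma integral_lebesgue_on (f : R -> \bar R) : measurable_fun setT (f : measurableTypeR R -> _) ->
  (\int[mu]_x f x = \int[lambda]_(x in D) f x)%E.
Proof.
move=> mf; have mD : measurable D by exact: measurable_itv.
transitivity (\int[mu]_(x in D) f x)%E; last first.
  by apply: eq_measure_integral => A mA AD; rewrite /= lebesgue_onE setIidl.
rewrite [RHS]integral_mkcond; apply: ae_eq_integral => //.
  by apply/(measurable_restrictT f mD); exact: measurable_funS mf.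
apply: ae_lebesgue_on_itv => t t0 tT _.
by rewrite patchE mem_set//= in_itv /= t0.
Qed.

Lemma integrable_lebesgue_on (f : R -> \bar R) : mu.-integrable setT f ->
  lambda.-integrable D f.
Proof.
move=> /integrableP[mf fy]; apply/integrableP; split; first exact: measurable_funS mf.
by move: fy; rewrite (integral_lebesgue_on (f := fun x => `|f x|%E))//; exact: measurableT_comp.
Qed.

Lemma Rintegral_lebesgue_on (f : R -> R) : measurable_fun setT (f : measurableTypeR R -> R) ->
  \int[mu]_x f x = \int[lambda]_(x in D) f x.
Proof. by move=> mf; congr fine; apply: integral_lebesgue_on; exact/measurable_EFinP. Qed.

End lebesgue_on_facts.

Section euclid_facts.
Context (R : realType) (n : nat).
Implicit Types x y : euclid R n.

Lemma euclid_sqr_norm x : `|x| ^+ 2 = \sum_(i < n) x i 0 ^+ 2.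
Proof. by rewrite -inner_norm euclid_innerE; apply: eq_bigr => i _; rewrite expr2. Qed.

Lemma euclid_coord_le x i : `|x i 0| <= `|x|.
Proof.
rewrite -(@ler_pXn2r _ 2) ?nnegrE// euclid_sqr_norm real_normK ?num_real//.
by rewrite (bigD1 i)//= lerDl sumr_ge0// => j _; exact: sqr_ge0.
Qed.

Lemma euclid_norm_le x : `|x| <= \sum_(i < n) `|x i 0|.
Proof.
have s0 (s : seq 'I_n) : 0 <= \sum_(i <- s) `|x i 0| by apply: sumr_ge0.
rewrite -(@ler_pXn2r _ 2) ?nnegrE ?s0// euclid_sqr_norm.
elim: (index_enum _) => [|i s IH]; first by rewrite !big_nil expr0n.
rewrite !big_cons sqrrD real_normK ?num_real// -addrA lerD2l.
by apply: le_trans IH _; rewrite lerDr mulrn_wge0// mulr_ge0.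
Qed.

Lemma euclid_complete : complete_norm (euclid R n).
Proof.
move=> u uC.
have ci i : cvgn (fun k => u k i 0 : R).
  apply/cauchy_cvgP/cauchy_exP => e /uC[N NP]; exists (u N i 0); exists N => // k /= Nk.
  rewrite /ball /=; apply: le_lt_trans (NP N k (leqnn N) Nk).
  by apply: le_trans (euclid_coord_le (u N - u k) i); rewrite !mxE.
pose l : euclid R n := \col_i limn (fun k => u k i 0 : R).
exists l; apply/cvgrPdist_lt => e e0.
have : (\sum_(i < n) `|(l - u k) i 0|) @[k --> \oo] --> (\sum_(i < n) (0 : R)).
  elim: (index_enum _) => [|i s IH].
    by under eq_cvg do rewrite big_nil; rewrite big_nil; exact: cvg_cst.
  under eq_cvg do rewrite big_cons; rewrite big_cons; apply: cvgD => //.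
  rewrite -[X in _ --> X](normr0 R) -[X in `|X|](subrr (l i 0)).
  under eq_cvg do rewrite !mxE; rewrite !mxE.
  by apply: cvg_norm; apply: cvgB; [exact: cvg_cst|exact: ci].
rewrite big1// => /cvgrPdist_lt /(_ e e0); apply: filterS => k.
rewrite sub0r normrN ger0_norm ?sumr_ge0//; apply: le_lt_trans; exact: euclid_norm_le.
Qed.

End euclid_facts.

Section euclid_mulmx.
Context (R : realType) (n : nat).
Implicit Types x : euclid R n.

(** The type annotation makes [|_|] on the product the Euclidean norm; a bare matrix product would
    carry the max norm. *)
Definition euclid_mulmx (k : nat) (A : 'M[R]_(k, n)) (x : euclid R n) : euclid R k :=
  A *m (x : 'cV_n).

(** The added one keeps the constant positive even for the zero matrix, as later estimates divide by
    it. *)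
Lemma euclid_mulmx_bound (k : nat) (A : 'M[R]_(k, n)) : exists2 C : R, 0 < C &
  forall x, `|euclid_mulmx A x| <= C * `|x|.
Proof.
exists (\sum_(i < k) \sum_(j < n) `|A i j| + 1).
  by rewrite ltr_wpDl// sumr_ge0// => i _; rewrite sumr_ge0.
move=> x; apply: le_trans (euclid_norm_le _) _.
apply: (@le_trans _ _ ((\sum_(i < k) \sum_(j < n) `|A i j|) * `|x|)); last first.
  by rewrite ler_wpM2r// lerDl.
rewrite mulr_suml; apply: ler_sum => i _; rewrite mxE mulr_suml.
apply: le_trans (ler_norm_sum _ _ _) _; apply: ler_sum => j _.
by rewrite normrM ler_wpM2l// euclid_coord_le.
Qed.

End euclid_mulmx.

Section L2_facts.
Context (R : realType) (tf : R) (n : nat).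
Local Notation mu := (lebesgue_on tf).
Local Notation lambda := (@lebesgue_measure R).
Local Notation D := (`[0, tf]%classic : set (measurableTypeR R)).
Implicit Types p q : L2 tf n.

Lemma L2_repB p q : L2_rep (p - q) = (fun t => L2_rep p t - L2_rep q t) %[ae mu].
Proof.
apply: ae_sub2 (L2_repD p (-1 *: q)) (L2_repZ (-1) q) => t + + _ => /(_ I) h1 /(_ I) h2.
by rewrite -scaleN1r h1 /= h2 scaleN1r.
Qed.

Lemma L2_rep_linear (a : R) p q :
  L2_rep (a *: p + q) = (fun t => a *: L2_rep p t + L2_rep q t) %[ae mu].
Proof.
apply: ae_sub2 (L2_repD (a *: p) q) (L2_repZ a p) => t + + _ => /(_ I) h1 /(_ I) h2.
by rewrite h1 /= h2.
Qed.

Lemma L2_sqr_norm p : `|p| ^+ 2 = \int[mu]_t (`|L2_rep p t| ^+ 2).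
Proof. by rewrite -inner_norm L2_innerE; apply: eq_Rintegral => t _; rewrite inner_norm. Qed.

Lemma L2_rep_measurable p i :
  measurable_fun setT ((fun t => L2_rep p t i 0) : measurableTypeR R -> R).
Proof. exact: Lfun_measurable (L2_repP p i). Qed.

Lemma L2_norm_rep_measurable p :
  measurable_fun setT ((fun t => `|L2_rep p t|) : measurableTypeR R -> R).
Proof.
under eq_fun do rewrite normE euclid_innerE.
apply: measurableT_comp; first exact: measurable_sqrt.
apply: measurable_sum => i; apply: measurable_funM; exact: L2_rep_measurable.
Qed.

Lemma L2_norm_rep_sqr_integrable p :
  mu.-integrable setT (EFin \o (fun t => `|L2_rep p t| ^+ 2)).
Proof.
apply: eq_integrable (L2_dot_integrable p p) => // t _.
by rewrite /= inner_norm.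
Qed.

Lemma L2_norm_rep_Lfun p : (fun t => `|L2_rep p t|) \in Lfun mu 2%:E.
Proof.
apply: Lfun2P; first exact: L2_norm_rep_measurable.
rewrite -ge0_fin_numE; last by apply: integral_ge0 => t _; rewrite lee_fin sqr_ge0.
exact: integrable_fin_num (L2_norm_rep_sqr_integrable p).
Qed.

Lemma L2_norm_rep_integrable p :
  lambda.-integrable D (EFin \o (fun t => `|L2_rep p t|)).
Proof.
apply: integrable_lebesgue_on; apply/Lfun1_integrable.
by apply: Lfun_subset12; [rewrite ge0_fin_numE//; exact: lebesgue_on_lty|exact: L2_norm_rep_Lfun].
Qed.

Lemma L2_rep_integrable p i : lambda.-integrable D (EFin \o (fun t => L2_rep p t i 0)).
Proof.
apply: integrable_lebesgue_on; apply/Lfun1_integrable.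
by apply: Lfun_subset12; [rewrite ge0_fin_numE//; exact: lebesgue_on_lty|exact: L2_repP].
Qed.

Lemma L2_dist_class p (f : L2fun tf n) :
  `|p - L2_class f| ^+ 2 = \sum_(i < n) \int[mu]_t (L2_rep p t i 0 - f t i 0) ^+ 2.
Proof.
have fL i : (fun t : R => f t i 0) \in Lfun mu 2%:E by case: f => f /= /L2_predP.
have isq i : mu.-integrable setT (EFin \o (fun t => (L2_rep p t i 0 - f t i 0) ^+ 2)).
  by apply: Lfun2_integrable_sqr; apply: Lfun2B; [exact: L2_repP|exact: fL].
have isum : mu.-integrable setT (fun t => \sum_(i < n) (((L2_rep p t i 0 - f t i 0) ^+ 2)%:E))%E.
  by apply: integrable_sum => // i _; exact: isq.
rewrite L2_sqr_norm.
transitivity (\int[mu]_t (\sum_(i < n) (L2_rep p t i 0 - f t i 0) ^+ 2)).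
  apply: ae_eq_L2_int; first exact: L2_norm_rep_sqr_integrable.
    by apply: eq_integrable isum => // t _; rewrite /= sumEFin.
  apply: ae_sub2 (L2_repB p (L2_class f)) (L2_rep_class f) => t + + _ => /(_ I) h1 /(_ I) h2.
  by rewrite h1 euclid_sqr_norm h2; apply: eq_bigr => i _; rewrite !mxE.
rewrite /Rintegral; under eq_integral do rewrite -sumEFin.
rewrite integral_sum//.
rewrite (eq_bigr (fun i => (\int[mu]_t (L2_rep p t i 0 - f t i 0) ^+ 2)%:E)); first by rewrite sumEFin.
by move=> i _; rewrite fineK//; exact: integrable_fin_num (isq i).
Qed.

Lemma L2_complete : complete_norm (L2 tf n).
Proof.
move=> u uC.
have /choice[g gP] : forall i : 'I_n, exists g : R -> R, g \in Lfun mu 2%:E /\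
    forall e : R, 0 < e -> exists N, forall k, (N <= k)%N ->
    \int[mu]_t (L2_rep (u k) t i 0 - g t) ^+ 2 <= e.
  move=> i; have [|k|e e0|g gL gP] := @Lfun2_complete _ _ _ mu _ (fun k t => L2_rep (u k) t i 0).
  - exact: lebesgue_on_lty.
  - exact: L2_repP.
  - have se0 : 0 < Num.sqrt e by rewrite sqrtr_gt0.
    have [N NP] := uC _ se0; exists N => k l Nk Nl.
    apply: (@le_lt_trans _ _ (`|u k - u l| ^+ 2)); last first.
      by rewrite -[ltRHS](sqr_sqrtr (ltW e0)) ltr_pXn2r ?nnegrE ?sqrtr_ge0// NP.
    rewrite -[u l in leRHS]L2_reprK L2_dist_class (bigD1 i)//= lerDl sumr_ge0// => j _.
    by apply: Rintegral_ge0 => t _; exact: sqr_ge0.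
  by exists g.
have gL : (fun t => \col_i g i t : euclid R n) \in @L2_pred R tf n.
  apply/L2_predP => i; rewrite (_ : (fun t => _) = g i); first by have [] := gP i.
  by apply/funext => t; rewrite mxE.
exists (L2_class (MkL2fun gL)); apply/cvgrPdist_le => e e0.
have e' : 0 < e ^+ 2 / (n%:R + 1) by rewrite divr_gt0 ?exprn_gt0// ltr_wpDl.
have /choice[N NP] : forall i : 'I_n, exists N, forall k, (N <= k)%N ->
    \int[mu]_t (L2_rep (u k) t i 0 - g i t) ^+ 2 <= e ^+ 2 / (n%:R + 1).
  by move=> i; have [_ /(_ _ e')] := gP i.
exists (\max_i N i)%N => // k /= Nk; rewrite distrC.
rewrite -(@ler_pXn2r _ 2) ?nnegrE ?(ltW e0)// L2_dist_class.
apply: (@le_trans _ _ (\sum_(i < n) e ^+ 2 / (n%:R + 1))).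
  apply: ler_sum => i _; under eq_Rintegral do rewrite /= mxE.
  by apply: NP; apply: leq_trans Nk; exact: leq_bigmax.
rewrite sumr_const card_ord -[leLHS]mulr_natr mulrAC ler_pdivrMr ?ltr_wpDl//.
by rewrite ler_wpM2l ?sqr_ge0// lerDl.
Qed.

End L2_facts.

Section itv_integral.
Context (R : realType).
Local Notation lambda := (@lebesgue_measure R).

Lemma itv_integral_ac (k : R -> R) (a b : R) : lambda.-integrable setT (EFin \o k) ->
  ac_on a b (fun t : R => \int[lambda]_(s in `[0, t]) k s).
Proof.
move=> ik; pose F (r : R) : R := \int[lambda]_(s in `[0, r]) k s.
suff : ac_on a b F by [].
have ikn : lambda.-integrable setT (EFin \o (fun s => `|k s|)) by exact: (integrable_norm ik).
apply: (ac_on_integral ikn) => [s|s r _ sr _]; first exact: normr_ge0.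
(* For [s < 0] the interval of integration is empty and the primitive vanishes. *)
have [s0|s0] := ltP s 0; last first.
  rewrite /F (_ : `[0, r]%classic = `[0, s] `|` `]s, r]); last first.
    by rewrite -itv_bndbnd_setU// ?bnd_simp.
  rewrite Rintegral_setU//.
  - rewrite addrC addKr; apply: le_normr_Rintegral => //; exact: integrableS ik.
  - apply: integrableS ik => //; apply: measurableU; exact: measurable_itv.
  - apply/disj_setPS => x /= []; rewrite !in_itv /= => /andP[_ xs] /andP[sx _].
    by move: (lt_le_trans sx xs); rewrite ltxx.
rewrite /F (_ : `[0, s]%classic = set0) ?Rintegral_set0 ?subr0; last first.
  apply/seteqP; split=> // x /=; rewrite in_itv /= => /andP[x0 xs].
  by move: (le_lt_trans (le_trans x0 xs) s0); rewrite ltxx.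
apply: le_trans (le_normr_Rintegral _ _) _; [exact: measurable_itv|exact: integrableS ik|].
rewrite -lee_fin !fineK; try by apply: integrable_fin_num => //; exact: integrableS ikn.
apply: ge0_subset_integral => //.
- have /integrableP[] // : lambda.-integrable `]s, r] (EFin \o (fun s => `|k s|)).
  exact: integrableS ikn.
- by move=> x /=; rewrite !in_itv /= => /andP[x0 ->]; rewrite andbT (lt_le_trans s0).
Qed.

Lemma itv_integral_continuous (k : R -> R) : lambda.-integrable setT (EFin \o k) ->
  continuous (fun t : R => \int[lambda]_(s in `[0, t]) k s).
Proof.
move=> ik t; pose N := `|t| + 1.
have [cN _] := itv_integral_ac (- N) N ik.
have tN : `|t| < N by rewrite ltrDl.
move: (tN); rewrite ltr_norml => /andP[Nt tN'].
apply/cvgrPdist_lt => e e0; have [d d0 dP] := cN t (ltW Nt) (ltW tN') e e0.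
near=> s; rewrite distrC; apply: dP.
- by apply: ltW; near: s; exact: lt_nbhsr.
- by apply: ltW; near: s; exact: lt_nbhsl.
- by rewrite distrC; near: s; exact: (nbhs_ball_norm t (PosNum d0)).
Unshelve. all: by end_near. Qed.

End itv_integral.

Section volterra.
Context (R : realType) (tf : R) (n : nat).
Local Notation mu := (lebesgue_on tf).
Local Notation lambda := (@lebesgue_measure R).
Local Notation D := (`[0, tf]%classic : set (measurableTypeR R)).
Implicit Types (p q : L2 tf n) (a : euclid R n).

Definition prim p (t : R) : euclid R n := \col_i \int[lambda]_(s in `[0, t]) L2_rep p s i 0.

Lemma primitiveE p q a : primitive p q a = (\forall t \ae mu, L2_rep p t = a + prim q t).
Proof. by []. Qed.

Let mitv (x y : R) : measurable (`[x, y] : set (measurableTypeR R)).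
Proof. exact: measurable_itv. Qed.

Let itvS t : t <= tf -> `[0, t]%classic `<=` D.
Proof. by move=> tT s; rewrite /= !in_itv /= => /andP[-> /le_trans]; exact. Qed.

Let itv_int t p i : t <= tf -> lambda.-integrable `[0, t] (EFin \o (fun s => L2_rep p s i 0)).
Proof. by move=> /itvS tS; apply: integrableS (L2_rep_integrable p i). Qed.

Let itv_norm_int t p : t <= tf -> lambda.-integrable `[0, t] (EFin \o (fun s => `|L2_rep p s|)).
Proof. by move=> /itvS tS; apply: integrableS (L2_norm_rep_integrable p). Qed.

Lemma prim_linear c p q t : t <= tf -> prim (c *: p + q) t = c *: prim p t + prim q t.
Proof.
move=> tT; apply/matrixP => i j; rewrite !mxE.
have iZ : lambda.-integrable `[0, t] (EFin \o (fun s => c * L2_rep p s i 0)).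
  exact: (integrableZl _ c (itv_int p i tT)).
rewrite -RintegralZl//; last exact: itv_int.
rewrite -RintegralD//; last exact: itv_int.
congr fine; apply: ae_eq_integral => //.
- by have /integrableP[] := itv_int (c *: p + q) i tT.
- by have /integrableP[] := integrableD (mitv _ _) iZ (itv_int q i tT).
have /ae_lebesgue_on h := L2_rep_linear c p q.
apply: ae_sub h => s sP; rewrite /= in_itv /= => /andP[s0 st].
by rewrite sP ?mxE// in_itv /= s0 (le_trans st).
Qed.

(** The coordinatewise integral is tested with its own value [v], which gives the sharp bound by the
    Euclidean norm instead of a sum over coordinates. *)
Lemma prim_norm_le p t : t <= tf -> `|prim p t| <= \int[lambda]_(s in `[0, t]) `|L2_rep p s|.
Proof.
move=> tT; set v := prim p t.
have [->|v0] := eqVneq v 0; first by rewrite normr0; exact: Rintegral_ge0.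
have {}v0 : 0 < `|v| by rewrite normr_gt0.
have iZ i : lambda.-integrable `[0, t] (EFin \o (fun s => v i 0 * L2_rep p s i 0)).
  exact: (integrableZl _ (v i 0) (itv_int p i tT)).
have isum : lambda.-integrable `[0, t] (EFin \o (fun s => inner v (L2_rep p s))).
  rewrite (_ : EFin \o _ = fun s => \sum_(i < n) ((v i 0 * L2_rep p s i 0)%:E))%E.
    by apply: integrable_sum => // i _; exact: iZ.
  by apply/funext => s; rewrite /= sumEFin euclid_innerE.
have vE : `|v| ^+ 2 = \int[lambda]_(s in `[0, t]) inner v (L2_rep p s).
  rewrite euclid_sqr_norm /Rintegral; under [in RHS]eq_integral do rewrite euclid_innerE -sumEFin.
  rewrite integral_sum//.
  rewrite [in RHS](eq_bigr (fun i => (v i 0 ^+ 2)%:E)); first by rewrite sumEFin.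
  move=> i _; rewrite -[LHS]fineK; last exact: integrable_fin_num (iZ i).
  congr EFin; rewrite -[LHS]/(\int[lambda]_(s in `[0, t]) (v i 0 * L2_rep p s i 0)).
  by rewrite RintegralZl ?expr2//; [rewrite {2}/v mxE|exact: itv_int].
rewrite -(ler_pM2l v0) -expr2 vE -RintegralZl//; last exact: itv_norm_int.
apply: le_Rintegral => //; last by move=> s _; exact: inner_le_norm.
exact: (integrableZl _ `|v| (itv_norm_int p tT)).
Qed.

(** The pointwise bound [|x| <= c + c^-1 * x^2] is integrated over the horizon and used with
    [c = |p|], which produces the constant [tf + 1]. For [p = 0] an arbitrarily small [c] is
    taken. *)
Lemma prim_norm_le_L2 p t : 0 <= t -> t <= tf -> `|prim p t| <= (tf + 1) * `|p|.
Proof.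
move=> t0 tT; have tf0 := le_trans t0 tT.
have main (c : R) : 0 < c -> `|prim p t| <= c * tf + c^-1 * `|p| ^+ 2.
  move=> c0; apply: le_trans (prim_norm_le p tT) _.
  have isq := integrable_lebesgue_on (L2_norm_rep_sqr_integrable p).
  have icst : lambda.-integrable D (EFin \o cst c).
    apply: measurable_bounded_integrable => //; first exact: itv_measure_lty.
    by exists `|c|; split; [exact: num_real|move=> r /ltW cr s _].
  have isqZ : lambda.-integrable D (EFin \o (fun s => c^-1 * `|L2_rep p s| ^+ 2)).
    exact: (integrableZl _ c^-1 isq).
  apply: (@le_trans _ _ (\int[lambda]_(s in D) `|L2_rep p s|)).
    rewrite -lee_fin !fineK; [|exact: integrable_fin_num (L2_norm_rep_integrable p)|exact: integrable_fin_num (itv_norm_int p tT)].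
    apply: ge0_subset_integral => //; last exact: itvS.
    by have /integrableP[] := L2_norm_rep_integrable p.
  apply: (@le_trans _ _ (\int[lambda]_(s in D) (c + c^-1 * `|L2_rep p s| ^+ 2))).
    apply: le_Rintegral => //; first exact: L2_norm_rep_integrable.
      exact: (integrableD (mitv _ _) icst isqZ).
    move=> s _; move: (`|L2_rep p s|) => x.
    rewrite -(ler_pM2l c0) mulrDr mulrA divff ?gt_eqF// mul1r.
    by have := sqr_ge0 (c - x); have := sqr_ge0 x; have := sqr_ge0 c; rewrite sqrrB; lra.
  rewrite RintegralD// Rintegral_cst// RintegralZl//.
  rewrite L2_sqr_norm Rintegral_lebesgue_on; last first.
    by apply: measurable_funX; exact: L2_norm_rep_measurable.
  have muD : lambda D = (tf - 0)%:E by exact: itv_measureE.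
  have muDf : fine (lambda D) <= tf by rewrite muD subr0.
  by rewrite lerD2r; apply: ler_wpM2l; [exact: ltW|exact: muDf].
have [p0|p0] := eqVneq `|p| 0; last first.
  have p1 : 0 < `|p| by rewrite lt_neqAle eq_sym p0 normr_ge0.
  apply: le_trans (main _ p1) _.
  by rewrite expr2 mulrA mulVf// mul1r mulrDl mul1r mulrC.
rewrite p0 mulr0; apply/ler_addgt0Pl => e e0; rewrite addr0.
have tf1 : 0 < tf + 1 by rewrite ltr_wpDl.
apply: le_trans (main (e / (tf + 1)) _) _; first by rewrite divr_gt0.
rewrite p0 expr0n/= mulr0 addr0 -mulrA ler_piMr ?(ltW e0)// mulrC ler_pdivrMr// mul1r lerDl//.
Qed.

Lemma primitive_exists q a : exists p, primitive p q a.
Proof.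
(* Cut off outside the horizon, the integrand is integrable on the whole line, and its primitive is
   continuous and bounded there, hence in L^2. *)
pose k i := (fun s => L2_rep q s i 0) \_ D.
have ik i : lambda.-integrable setT (EFin \o k i).
  rewrite /k -restrict_EFin; apply/(integrable_mkcond _ (mitv _ _)); exact: L2_rep_integrable.
have ikn i : lambda.-integrable setT (EFin \o (fun s => `|k i s|)).
  exact: (integrable_norm (ik i)).
pose F i t := a i 0 + \int[lambda]_(s in `[0, t]) k i s.
have cF i : continuous (F i : R -> R).
  by move=> t; apply: cvgD; [exact: cvg_cst|exact: itv_integral_continuous].
have mF i : measurable_fun setT (F i : measurableTypeR R -> R) by exact: continuous_measurable_fun.
have FB i t : `|F i t| <= `|a i 0| + \int[lambda]_s `|k i s|.
  apply: le_trans (ler_normD _ _) _; rewrite lerD2l.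
  apply: le_trans (le_normr_Rintegral _ _) _; [exact: measurable_itv|exact: integrableS (ik i)|].
  rewrite -lee_fin !fineK; try by apply: integrable_fin_num => //; exact: integrableS (ikn i).
  by apply: ge0_subset_integral => //; have /integrableP[] := ikn i.
have fL : (fun t => \col_i F i t : euclid R n) \in @L2_pred R tf n.
  apply/L2_predP => i; rewrite (_ : (fun t => _) = F i); last by apply/funext => t; rewrite mxE.
  have iF2 : mu.-integrable setT (EFin \o (fun t => F i t ^+ 2)).
    apply: measurable_bounded_integrable => //; first exact: lebesgue_on_lty.
      exact: measurable_funX.
    exists ((`|a i 0| + \int[lambda]_s `|k i s|) ^+ 2); split; first exact: num_real.
    move=> r /ltW Br t _; apply: le_trans Br; rewrite /= normrX ler_pXn2r ?nnegrE//.
    exact: le_trans (FB i t).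
  apply: Lfun2P => //; rewrite -ge0_fin_numE; first exact: integrable_fin_num iF2.
  by apply: integral_ge0 => t _; rewrite lee_fin sqr_ge0.
exists (L2_class (MkL2fun fL)); rewrite primitiveE.
have tP : \forall t \ae mu, 0 <= t /\ t <= tf by exact: ae_lebesgue_on_itv.
apply: ae_sub2 (L2_rep_class (MkL2fun fL)) tP => t /(_ I) -> [t0 tT].
apply/matrixP => i j; rewrite !mxE ord1 /F; congr (_ + _).
apply: eq_Rintegral => s; rewrite inE /= in_itv /= => /andP[s0 st].
by rewrite /k patchE mem_set//= in_itv /= s0 (le_trans st).
Qed.

End volterra.

(** * The linear differential equation *)

Section primitives.
Context (R : realType) (tf : R) (n : nat).
Hypothesis tf0 : 0 < tf.
Local Notation mu := (lebesgue_on tf).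
Local Notation lambda := (@lebesgue_measure R).
Local Notation D := (`[0, tf]%classic : set (measurableTypeR R)).
Implicit Types (p q x y g h : L2 tf n) (a b : euclid R n).

Let tf_ge0 : 0 <= tf. Proof. exact: ltW. Qed.

Let ae_itv : \forall t \ae mu, 0 <= t /\ t <= tf.
Proof. exact: ae_lebesgue_on_itv. Qed.

Lemma L2_rep0 : L2_rep (0 : L2 tf n) = (fun=> 0) %[ae mu].
Proof. by rewrite -L2_class0; exact: L2_rep_class. Qed.

Lemma primitive_linear c x y g h a b : primitive x g a -> primitive y h b ->
  primitive (c *: x + y) (c *: g + h) (c *: a + b).
Proof.
rewrite !primitiveE => xg yh.
have xyE := L2_rep_linear c x y.
have {}xg := ae_sub2 (fun t (P : L2_rep x t = a + prim g t) Q => conj P Q) xg yh.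
apply: ae_sub2 (ae_sub2 (fun t P Q => conj P Q) ae_itv xyE) xg.
move=> t [[t0 tT] /(_ I) ->] [-> ->].
by rewrite prim_linear// scalerDr addrACA.
Qed.

Lemma itv_integral_derive (k : R -> R) (T : R) : lambda.-integrable setT (EFin \o k) ->
  \forall t \ae lambda, t \in `]0, T[ ->
    is_derive t (1 : R) (fun t : R => \int[lambda]_(s in `[0, t]) k s) (k t).
Proof.
move=> ik.
have iitv (y : R) : lambda.-integrable [set` Interval (BLeft (0 : R)) (BRight y)] (EFin \o k).
  by apply: integrableS ik.
have ftc := FTC1 iitv (open_integrable_locally openT ik).
apply: ae_sub ftc => t tP; rewrite in_itv /= => /andP[t0 _].
have [|dF0 F0x] := tP; first by rewrite lte_fin.
by split => //; rewrite -derive1E.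
Qed.

(* A continuous function vanishing almost everywhere vanishes, and by Lebesgue's
   differentiation theorem so does its derivative. *)
Lemma itv_integral_eq0 (k : R -> R) (c : R) : lambda.-integrable setT (EFin \o k) ->
  (\forall t \ae lambda, t \in `[0, tf] -> c + \int[lambda]_(s in `[0, t]) k s = 0) ->
  c = 0 /\ \forall t \ae lambda, t \in `[0, tf] -> k t = 0.
Proof.
move=> ik [N [mN N0 PN]].
pose F t : R := c + \int[lambda]_(s in `[0, t]) k s.
have cF : continuous F.
  by move=> t; apply: cvgD; [exact: cvg_cst|exact: itv_integral_continuous].
have Fz t : 0 < t -> t < tf -> F t = 0.
  move=> t0 tT; apply: contrapT => Ft.
  have h : \forall s \near t, `|F t - F s| < `|F t|.
    by have /cvgrPdist_lt := cF t; apply; rewrite normr_gt0; exact/eqP.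
  have : \forall s \near t, F s != 0 /\ (0 < s /\ s < tf).
    near=> s; split; last split.
    - have : `|F t - F s| < `|F t| by near: s.
      by apply: contraTneq => ->; rewrite subr0 ltxx.
    - by near: s; exact: lt_nbhsr.
    - by near: s; exact: lt_nbhsl.
  move=> /nbhs_ballP[r /= r0 rP].
  have mb : measurable (ball t r : set (measurableTypeR R)) by exact: measurable_ball.
  have : (lambda (ball t r) <= lambda N)%E.
    rewrite le_measure ?inE// => s /rP[/eqP Fs [s0 sT]]; apply: PN => /= sP.
    by apply: Fs; apply: sP; rewrite in_itv /= !ltW.
  by rewrite N0 lebesgue_measure_ball ?(ltW r0)// lee_fin leNgt mulrn_wgt0.
have k0 : \forall t \ae lambda, t \in `[0, tf] -> k t = 0.
  pose F0 (t : R) : R := \int[lambda]_(s in `[0, t]) k s.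
  have endpoints : \forall t \ae lambda, t != 0 /\ t != tf.
    exists ([set 0] `|` [set tf]); split; first exact: measurableU.
      by rewrite measureU0//; exact: lebesgue_measure_set1.
    by move=> t /= /not_andP[] /negP; rewrite negbK => /eqP ->; [left|right].
  apply: ae_sub2 (itv_integral_derive tf ik) endpoints => x dF [x0 xT].
  rewrite in_itv /= => /andP[x0' xT'].
  have {}x0 : 0 < x by rewrite lt_neqAle eq_sym x0.
  have {}xT : x < tf by rewrite lt_neqAle xT.
  have h1 : h^-1 *: (F0 (h + x) - F0 x) @[h --> 0^'] --> k x.
    by apply/is_deriveP; apply: dF; rewrite in_itv /= x0.
  have h2 : h^-1 *: (F0 (h + x) - F0 x) @[h --> 0^'] --> (0 : R).
    apply/cvgrPdist_lt => e e0; near=> h.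
    have hx : 0 < h + x /\ h + x < tf.
      have : `|h| < Num.min x (tf - x).
        by near: h; apply: dnbhs0_lt; rewrite lt_min x0 subr_gt0.
      by rewrite lt_min !ltr_norml => /andP[/andP[? ?] /andP[? ?]]; split; lra.
    have := Fz _ x0 xT; have := Fz _ hx.1 hx.2; rewrite /F => e1 e2.
    have -> : F0 (h + x) = F0 x by rewrite /F0; lra.
    by rewrite subrr scaler0 subr0 normr0.
  exact: (cvg_unique _ h1 h2).
split => //.
have c0 : c + \int[lambda]_(s in `[0, tf / 2]) k s = 0.
  by apply: Fz; rewrite ?divr_gt0// ltr_pdivrMr// ltr_pMr// ltr1n.
move: c0; rewrite (_ : \int[lambda]_(s in `[0, tf / 2]) k s = 0) ?addr0//.
rewrite /Rintegral (_ : (\int[lambda]_(s in `[0%R, (tf / 2)%R]) (k s)%:E = 0)%E)//.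
rewrite -(integral0 lambda `[0, tf / 2]); apply: ae_eq_integral => //.
  by have /integrableP[+ _] := ik; exact: measurable_funS.
apply: ae_sub k0 => s sP; rewrite /= in_itv /= => /andP[s0 sT].
by rewrite sP// in_itv /= s0 (le_trans sT)// ler_pdivrMr// ler_peMr// ler1n.
Unshelve. all: by end_near. Qed.

Lemma primitive0_inj g a : primitive 0 g a -> g = 0 /\ a = 0.
Proof.
rewrite primitiveE => g0.
have coord i : a i 0 = 0 /\ \forall t \ae lambda, t \in `[0, tf] -> L2_rep g t i 0 = 0.
  pose k := (fun s => L2_rep g s i 0) \_ D.
  have ik : lambda.-integrable setT (EFin \o k).
    rewrite /k -restrict_EFin; apply/(integrable_mkcond _ (measurable_itv _ : measurable D)).
    exact: L2_rep_integrable.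
  have kE t : t \in `[0, tf] -> k t = L2_rep g t i 0 by move=> tD; rewrite /k patchE mem_set.
  have [] := itv_integral_eq0 (c := a i 0) ik.
    move/ae_lebesgue_on: L2_rep0 => z0; move/ae_lebesgue_on: g0; move: z0.
    apply: ae_sub2 => t z0 gt tD; have := gt tD; rewrite (z0 tD I).
    move=> /(congr1 (fun v : euclid R n => v i 0)).
    rewrite !mxE => E; rewrite [RHS]E; congr (_ + _); apply: eq_Rintegral => s.
    move: tD; rewrite inE /= !in_itv /= => /andP[t0 tT] /andP[s0 st].
    by rewrite kE// in_itv /= s0 (le_trans st).
  by move=> -> k0; split=> //; apply: ae_sub k0 => t tP tD; rewrite -kE// tP.
split; last by apply/matrixP => i j; rewrite ord1 mxE; have [] := coord i.
apply/L2_eqP.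
have /ae_lebesgue_on h : \forall t \ae lambda, t \in `[0, tf] -> L2_rep g t = 0.
  have : \forall t \ae lambda, forall i, t \in `[0, tf] -> L2_rep g t i 0 = 0.
    by apply: (@filter_forall _ _ _ _ (ae_filter_ringOfSetsType lambda)) => i; have [] := coord i.
  by apply: ae_sub => t tP tD; apply/matrixP => i j; rewrite ord1 mxE tP.
by apply: ae_sub2 h L2_rep0 => t -> + _ => /(_ I) ->.
Qed.

(** This is what makes the choices by [xget] in [H1_deriv] and [H1_init] determinate; linearity
    reduces it to the primitive zero. *)
Lemma primitive_inj x g h a b : primitive x g a -> primitive x h b -> g = h /\ a = b.
Proof.
move=> xg xh; have := primitive_linear (-1) xg xh; rewrite !scaleN1r addNr.
by move=> /primitive0_inj[/eqP + /eqP]; rewrite !(addrC (- _)) !subr_eq0 => /eqP -> /eqP ->.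
Qed.

End primitives.

Section ode.
Context (R : realType) (tf : R) (n : nat).
Hypothesis tf0 : 0 < tf.
Local Notation mu := (lebesgue_on tf).
Local Notation lambda := (@lebesgue_measure R).
Local Notation D := (`[0, tf]%classic : set (measurableTypeR R)).
Implicit Types (p q x y g h b : L2 tf n) (a : euclid R n).

Let tf_ge0 : 0 <= tf. Proof. exact: ltW. Qed.

(* For omega = 2 * |A| the Picard iteration contracts this weighted sup norm. *)
Definition exp_bound (omega M : R) x := \forall t \ae mu, `|L2_rep x t| <= M * expR (omega * t).

Lemma integral_expR (omega M t : R) : 0 < omega -> 0 <= M -> 0 <= t ->
  lambda.-integrable `[0, t] (EFin \o (fun s => M * expR (omega * s))) /\
  \int[lambda]_(s in `[0, t]) (M * expR (omega * s)) <= M / omega * expR (omega * t).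
Proof.
move=> omega0 M0 t0.
have cE c : continuous (fun s : R => c * expR (omega * s)).
  move=> s; apply: cvgMr; apply: continuous_comp; last exact: continuous_expR.
  by apply: cvgMr; exact: cvg_id.
split.
  apply: continuous_compact_integrable; first exact: segment_compact.
  by apply: continuous_subspaceT; exact: cE.
move: t0; rewrite le_eqVlt => /predU1P[<-|t0].
  by rewrite set_itv1 Rintegral_set1 mulr_ge0 ?expR_ge0// divr_ge0// ltW.
pose F s := M / omega * expR (omega * s).
have dF (s : R) : is_derive s (1 : R) F (M * expR (omega * s)).
  by apply: is_derive_eq; rewrite /GRing.scale /=; field; rewrite gt_eqF.
have E : (\int[lambda]_(s in `[(0 : R)%R, t]) (M * expR (omega * s))%:E = (F t)%:E - (F 0)%:E)%E.
  apply: (@continuous_FTC2 R (fun s => M * expR (omega * s)) F) => //.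
  - by apply: continuous_subspaceT; exact: cE.
  - split; first by move=> s _; exact: ex_derive.
      by apply: cvg_at_right_filter; exact: cE.
    by apply: cvg_at_left_filter; exact: cE.
  - by move=> s _; rewrite derive1E derive_val.
by rewrite /Rintegral E /= gerBl /F mulr_ge0 ?expR_ge0// divr_ge0// ltW.
Qed.

Lemma exp_bound_primitive (omega M : R) x g : 0 < omega -> 0 <= M -> exp_bound omega M g ->
  primitive x g 0 -> exp_bound omega (M / omega) x.
Proof.
move=> omega0 M0 gM; rewrite primitiveE => xg.
have ae_itv : \forall t \ae mu, 0 <= t /\ t <= tf by exact: ae_lebesgue_on_itv.
apply: ae_sub2 ae_itv xg => t [t0 tT] ->; rewrite add0r.
have [iE intE] := integral_expR omega0 M0 t0.
apply: le_trans (prim_norm_le g tT) _; apply: le_trans intE.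
have ig : lambda.-integrable `[0, t] (EFin \o (fun s => `|L2_rep g s|)).
  apply: integrableS (L2_norm_rep_integrable g) => // s.
  by rewrite /= !in_itv /= => /andP[-> /le_trans]; exact.
rewrite -lee_fin !fineK; [|exact: integrable_fin_num iE|exact: integrable_fin_num ig].
apply: ae_ge0_le_integral => //.
- by have /integrableP[] := ig.
- by move=> s _; rewrite lee_fin mulr_ge0// expR_ge0.
- by have /integrableP[] := iE.
move/ae_lebesgue_on: gM; apply: ae_sub => s sP; rewrite /= in_itv /= => /andP[s0 st].
by rewrite lee_fin sP// in_itv /= s0 (le_trans st).
Qed.

(** The weight is largest at [tf], and [tf + 1] stands in for the square root of [tf]. *)
Lemma exp_bound_norm (omega M : R) x : 0 <= omega -> 0 <= M -> exp_bound omega M x ->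
  `|x| <= M * (expR (omega * tf) * (tf + 1)).
Proof.
move=> omega0 M0 xM.
have C0 : 0 <= M * expR (omega * tf) by rewrite mulr_ge0 ?expR_ge0.
rewrite -(@ler_pXn2r _ 2) ?nnegrE ?mulr_ge0 ?expR_ge0 ?addr_ge0//.
have icst := fin_integrable_cst (lebesgue_on_lty tf) ((M * expR (omega * tf)) ^+ 2).
have isq := L2_norm_rep_sqr_integrable x.
apply: (@le_trans _ _ (\int[mu]_t (M * expR (omega * tf)) ^+ 2)).
  rewrite L2_sqr_norm -lee_fin !fineK; [|exact: integrable_fin_num icst|exact: integrable_fin_num isq].
  apply: ae_ge0_le_integral => //.
  - by have /integrableP[] := isq.
  - by move=> t _; rewrite lee_fin sqr_ge0.
  have ae_itv : \forall t \ae mu, 0 <= t /\ t <= tf by exact: ae_lebesgue_on_itv.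
  apply: ae_sub2 ae_itv xM => t [t0 tT] xt _; rewrite lee_fin ler_pXn2r ?nnegrE//.
  by apply: le_trans xt _; rewrite ler_wpM2l// ler_expR ler_wpM2l.
rewrite Rintegral_cst//.
have -> : fine (mu setT) = tf.
  have muD : lambda D = (tf - 0)%:E by exact: itv_measureE.
  by rewrite lebesgue_onE setTI muD subr0.
have -> : (M * (expR (omega * tf) * (tf + 1))) ^+ 2 = (M * expR (omega * tf)) ^+ 2 * (tf + 1) ^+ 2 by ring.
by rewrite ler_wpM2l ?sqr_ge0//; have := sqr_ge0 tf; nra.
Qed.

Lemma exp_bound_primitive_L2 (omega : R) x g a : 0 <= omega -> primitive x g a ->
  exp_bound omega (`|a| + (tf + 1) * `|g|) x.
Proof.
move=> omega0; rewrite primitiveE => xg.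
have ae_itv : \forall t \ae mu, 0 <= t /\ t <= tf by exact: ae_lebesgue_on_itv.
apply: ae_sub2 ae_itv xg => t [t0 tT] ->.
apply: le_trans (ler_normD _ _) _.
apply: (@le_trans _ _ (`|a| + (tf + 1) * `|g|)); first by rewrite lerD2l prim_norm_le_L2.
rewrite ler_peMr//; first by rewrite addr_ge0// mulr_ge0// addr_ge0.
by rewrite -expR0 ler_expR mulr_ge0.
Qed.

End ode.

Section L2_mx_facts.
Context (R : realType) (tf : R) (n k : nat) (A : 'M[R]_(k, n)).
Local Notation mu := (lebesgue_on tf).
Implicit Types x y : L2 tf n.

Lemma L2_mx_linear c x y : L2_mx A (c *: x + y) = c *: L2_mx A x + L2_mx A y.
Proof.
apply/L2_eqP; have h1 := L2_rep_mx A (c *: x + y).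
have h2 := ae_sub2 (fun t P Q => conj P Q) (L2_rep_mx A x) (L2_rep_mx A y).
have h3 := ae_sub2 (fun t P Q => conj P Q) (L2_rep_linear c x y) (L2_rep_linear c (L2_mx A x) (L2_mx A y)).
apply: ae_sub2 h1 (ae_sub2 (fun t P Q => conj P Q) h2 h3).
move=> t /(_ I) -> [[/(_ I) e1 /(_ I) e2] [/(_ I) -> /(_ I) ->]] _.
by rewrite e1 e2 mulmxDr -scalemxAr.
Qed.

Lemma L2_mxB x y : L2_mx A (x - y) = L2_mx A x - L2_mx A y.
Proof. by rewrite addrC -scaleN1r L2_mx_linear scaleN1r addrC. Qed.

Lemma L2_mx0 : L2_mx A (0 : L2 tf n) = 0.
Proof. by rewrite -(subrr 0) L2_mxB subrr. Qed.

Lemma L2_mx_bound (C : R) x : 0 <= C -> (forall v, `|euclid_mulmx A v| <= C * `|v|) ->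
  `|L2_mx A x| <= C * `|x|.
Proof.
move=> C0 CA; rewrite -(@ler_pXn2r _ 2) ?nnegrE ?mulr_ge0// exprMn !L2_sqr_norm.
have i1 := L2_norm_rep_sqr_integrable (L2_mx A x); have i2 := L2_norm_rep_sqr_integrable x.
have i3 : mu.-integrable setT (EFin \o (fun t => C ^+ 2 * `|L2_rep x t| ^+ 2)).
  exact: (integrableZl _ (C ^+ 2) i2).
rewrite -RintegralZl// -lee_fin !fineK; [|exact: integrable_fin_num i3|exact: integrable_fin_num i1].
apply: ae_ge0_le_integral => //.
- by have /integrableP[] := i1.
- by move=> t _; rewrite lee_fin mulr_ge0// sqr_ge0.
- by have /integrableP[] := i3.
apply: ae_sub (L2_rep_mx A x) => t /(_ I) -> _.
by rewrite lee_fin -exprMn ler_pXn2r ?nnegrE ?mulr_ge0//; exact: CA.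
Qed.

Lemma exp_bound_mx (C omega M : R) x : 0 <= C -> (forall v, `|euclid_mulmx A v| <= C * `|v|) ->
  exp_bound omega M x -> exp_bound omega (C * M) (L2_mx A x).
Proof.
move=> C0 CA xM; apply: ae_sub2 xM (L2_rep_mx A x) => t xt /(_ I) ->.
by apply: le_trans (CA _) _; rewrite -mulrA ler_wpM2l.
Qed.

End L2_mx_facts.

Lemma geometric_cvg (R : realType) (X : normedModType R) (u : nat -> X) (K : R) :
  complete_norm X -> 0 <= K -> (forall k, `|u k.+1 - u k| <= K / 2 ^+ k) ->
  exists2 l : X, u k @[k --> \oo] --> l & `|l - u 0%N| <= 2 * K.
Proof.
move=> cX K0 uK.
have p0 k : 0 < 2 ^+ k :> R by rewrite exprn_gt0.
(* Subtracting the remaining tail makes the bound telescope, so the induction on [m] closes. *)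
have diff k m : `|u (k + m)%N - u k| <= 2 * K / 2 ^+ k - 2 * K / 2 ^+ (k + m).
  elim: m => [|m IH]; first by rewrite addn0 !subrr normr0.
  have -> : u (k + m.+1)%N - u k = (u (k + m).+1 - u (k + m)%N) + (u (k + m)%N - u k).
    by rewrite addnS addrA subrK.
  apply: le_trans (ler_normD _ _) _; have := uK (k + m)%N.
  have -> : 2 * K / 2 ^+ (k + m.+1) = K / 2 ^+ (k + m).
    by rewrite addnS exprS; field; rewrite gt_eqF.
  have := IH; rewrite -[2 * K / 2 ^+ (k + m)]mulrA; lra.
have diff' k m : `|u (k + m)%N - u k| <= 2 * K / 2 ^+ k.
  by apply: le_trans (diff k m) _; rewrite gerBl divr_ge0 ?mulr_ge0 ?(ltW (p0 _)).
have [e e0|l ul] := cX u _.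
  have K1 : 0 < 4 * K + 1 by rewrite ltr_wpDl// mulr_ge0.
  have e' : 0 < e / (4 * K + 1) by rewrite divr_gt0.
  have [N _ NP] := near_infty_natSinv_lt (PosNum e').
  have {NP} small : 4 * K / 2 ^+ N < e.
    have := NP N (leqnn N); rewrite /= ltr_pdivlMr// => h.
    apply: le_lt_trans h; rewrite mulrC; apply: ler_pM => //.
    - by rewrite mulr_ge0.
    - rewrite lef_pV2 ?posrE//; rewrite -natrX ler_nat; exact: ltn_expl.
    - by rewrite lerDl.
  exists N => i j Ni Nj; apply: le_lt_trans small.
  have := diff' N (i - N)%N; have := diff' N (j - N)%N; rewrite !subnKC// => hj hi.
  have -> : u i - u j = (u i - u N) - (u j - u N) by rewrite opprB addrA subrK.
  apply: le_trans (ler_normB _ _) _; move: hi hj; rewrite -!mulrA.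
  by move: (K / _) (`|_|) (`|_|) => *; lra.
have h : `|u k - u 0%N| @[k --> \oo] --> `|l - u 0%N|.
  by apply: cvg_norm; apply: cvgB; [exact: ul|exact: cvg_cst].
exists l => //; apply: (cvgr_to_le h).
by apply: nearW => k; have := diff' 0%N k; rewrite add0n expr0 divr1.
Qed.

Section ode_solution.
Context (R : realType) (tf : R) (n : nat) (A : 'M[R]_n).
Hypothesis tf0 : 0 < tf.
Implicit Types (x b : L2 tf n) (a : euclid R n).

(** The Picard iterates start at zero. [K] bounds the first one, [E] passes from the weighted sup
    norm to L^2, and the factor [2] is the sum of the geometric series. *)
Lemma ode_exists : exists2 C : R, 0 <= C &
  forall b a, exists2 x, primitive x (L2_mx A x + b) a & `|x| <= C * (`|a| + `|b|).
Proof.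
have [CA CA0 CAP] := euclid_mulmx_bound A.
pose omega := 2 * CA; have omega0 : 0 < omega by rewrite mulr_gt0.
pose E := expR (omega * tf) * (tf + 1).
have tf1 : 0 <= tf + 1 by rewrite addr_ge0// ltW.
have E0 : 0 <= E by rewrite mulr_ge0 ?expR_ge0.
exists (2 * ((tf + 1) * E)) => [|b a]; first by rewrite !mulr_ge0.
pose K := `|a| + (tf + 1) * `|b|.
have K0 : 0 <= K by rewrite addr_ge0// mulr_ge0.
have /choice[step stepP] : forall x, exists y, primitive y (L2_mx A x + b) a.
  by move=> x; exact: primitive_exists.
pose u k := iter k step 0.
have uP k : primitive (u k.+1 - u k.+2) (L2_mx A (u k - u k.+1)) 0.
  have := primitive_linear (-1) (stepP (u k.+1)) (stepP (u k)).
  rewrite !scaleN1r !(addrC (- _)) subrr opprD addrACA subrr addr0 -L2_mxB.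
  exact.
have uB k : exp_bound omega (K / 2 ^+ k) (u k - u k.+1).
  elim: k => [|k IH].
    rewrite expr0 divr1 sub0r -scaleN1r.
    have := exp_bound_primitive_L2 tf0 (ltW omega0) (stepP 0).
    rewrite L2_mx0 add0r; apply: ae_sub2 (L2_repZ (-1) (u 1%N)) => t + h => /(_ I) ->.
    by rewrite normrZ normrN1 mul1r.
  have -> : K / 2 ^+ k.+1 = CA * (K / 2 ^+ k) / omega.
    by rewrite exprS /omega; field; rewrite !gt_eqF// exprn_gt0.
  have Kk0 : 0 <= CA * (K / 2 ^+ k).
    by rewrite mulr_ge0 ?divr_ge0 ?exprn_ge0// ltW.
  apply: (exp_bound_primitive omega0 Kk0 _ (uP k)).
  exact: exp_bound_mx (ltW CA0) CAP IH.
have udist k : `|u k.+1 - u k| <= K * E / 2 ^+ k.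
  rewrite distrC mulrAC; apply: (exp_bound_norm tf0 (ltW omega0) _ (uB k)).
  by rewrite divr_ge0// exprn_ge0.
have [x ux x0] := geometric_cvg (@L2_complete R tf n) (mulr_ge0 K0 E0) udist.
(* [x] is only an L^2 limit of iterates. [y] is the primitive demanded of it, and the next iterates
   converge to [y] as well, whence [y = x]. *)
have [y yP] := primitive_exists (L2_mx A x + b) a.
have uy k : `|y - u k.+1| <= (tf + 1) * CA * E * `|x - u k|.
  have := primitive_linear (-1) (stepP (u k)) yP.
  rewrite !scaleN1r !(addrC (- _)) subrr opprD addrACA subrr addr0 -L2_mxB => h.
  have := exp_bound_primitive_L2 tf0 (ltW omega0) h; rewrite normr0 add0r.
  have c0 : 0 <= (tf + 1) * `|L2_mx A (x - u k)| by rewrite mulr_ge0.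
  move=> /(exp_bound_norm tf0 (ltW omega0) c0) /le_trans; apply.
  rewrite -/E (_ : _ * CA * E * _ = (tf + 1) * (CA * `|x - u k|) * E); last by ring.
  rewrite ler_wpM2r// ler_wpM2l//.
  by apply: L2_mx_bound => //; exact: ltW.
have u1y : u k.+1 @[k --> \oo] --> y.
  apply/cvgrPdist_le => e e0.
  have c1 : 0 < (tf + 1) * CA * E + 1 by rewrite ltr_wpDl// !mulr_ge0// ltW.
  move/cvgrPdist_le: ux => /(_ _ (divr_gt0 e0 c1)); apply: filterS => k.
  rewrite ler_pdivlMr// mulrC => h; apply: le_trans (uy k) _; apply: le_trans h.
  by rewrite ler_wpM2r// lerDl.
have xy : y = x.
  apply: (cvg_unique _ u1y); first exact: norm_hausdorff.
  by have : [sequence u k.+1]_k @ \oo --> x by rewrite cvg_shiftS.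
exists x; first by rewrite -{1}xy.
move: x0; rewrite subr0 => /le_trans; apply.
rewrite (_ : 2 * (_ * E) * _ = 2 * ((tf + 1) * (`|a| + `|b|) * E)); last by ring.
rewrite ler_wpM2l// ler_wpM2r//.
by rewrite mulrDr lerD2r ler_peMl// lerDr ltW.
Qed.

(** A fixed point of the homogeneous Picard map satisfies the contraction estimate with itself, so
    its weighted bound can be halved indefinitely. *)
Lemma ode_unique x : primitive x (L2_mx A x) 0 -> x = 0.
Proof.
move=> xP; have [CA CA0 CAP] := euclid_mulmx_bound A.
pose omega := 2 * CA; have omega0 : 0 < omega by rewrite mulr_gt0.
pose E := expR (omega * tf) * (tf + 1).
have tf1 : 0 <= tf + 1 by rewrite addr_ge0// ltW.
have E0 : 0 <= E by rewrite mulr_ge0 ?expR_ge0.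
pose K := (tf + 1) * `|L2_mx A x|.
have K0 : 0 <= K by rewrite mulr_ge0.
have xB k : exp_bound omega (K / 2 ^+ k) x.
  elim: k => [|k IH].
    rewrite expr0 divr1; have := exp_bound_primitive_L2 tf0 (ltW omega0) xP.
    by rewrite normr0 add0r.
  have -> : K / 2 ^+ k.+1 = CA * (K / 2 ^+ k) / omega.
    by rewrite exprS /omega; field; rewrite !gt_eqF// exprn_gt0.
  have Kk0 : 0 <= CA * (K / 2 ^+ k).
    by rewrite mulr_ge0 ?divr_ge0 ?exprn_ge0// ltW.
  apply: (exp_bound_primitive omega0 Kk0 _ xP).
  exact: exp_bound_mx (ltW CA0) CAP IH.
apply/eqP; rewrite -normr_eq0 eq_le normr_ge0 andbT.
apply/ler_addgt0Pl => e e0; rewrite addr0.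
have KE : 0 < K * E + 1 by rewrite ltr_wpDl// mulr_ge0.
have e' : 0 < e / (K * E + 1) by rewrite divr_gt0.
have [k _ kP] := near_infty_natSinv_lt (PosNum e').
have := kP k (leqnn k); rewrite /= ltr_pdivlMr// => h.
have Kk : 0 <= K / 2 ^+ k by rewrite divr_ge0// exprn_ge0.
apply: le_trans (exp_bound_norm tf0 (ltW omega0) Kk (xB k)) _; apply: le_trans (ltW h).
rewrite -/E mulrAC mulrC; apply: ler_pM.
- by rewrite invr_ge0 exprn_ge0.
- by rewrite mulr_ge0.
- by rewrite lef_pV2 ?posrE ?exprn_gt0// -natrX ler_nat; exact: ltn_expl.
- by rewrite lerDl.
Qed.

End ode_solution.

(** * The constraint operator *)

(** [F ^+ 2 - 2 * G] has derivative zero almost everywhere and starts at zero. That it does not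
    increase already gives [F T ^+ 2 <= 2 * G T], which bounds the integral [G T] from below. *)
Lemma ge0_integral_primitive (R : realType) (k : R -> R) (T : R) (mu := @lebesgue_measure R)
    (F := fun t => \int[mu]_(s in `[0, t]) k s) : 0 <= T -> mu.-integrable setT (EFin \o k) ->
  mu.-integrable setT (EFin \o (F \* k)) -> 0 <= \int[mu]_(s in `[0, T]) (F s * k s).
Proof.
move=> T0 ik iFk.
have acF : ac_on 0 T F by exact: itv_integral_ac.
pose G t := \int[mu]_(s in `[0, t]) (F \* k) s.
have acG : ac_on 0 T G by exact: itv_integral_ac.
have [M FM] := continuous_on_bounded T0 acF.1.
pose phi t := F t * F t - 2 * G t.
have : phi T <= phi 0.
  apply: ac_nonincreasing => //.
    apply: (@ac_on_lip _ _ _ _ _ _ (2 * `|M| + 2) _ _ _ acF acG) => s t s0 sT t0 tT.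
    have -> : phi s - phi t = (F s - F t) * (F s + F t) - 2 * (G s - G t) by rewrite /phi; ring.
    apply: le_trans (ler_normB _ _) _; rewrite !normrM (ger0_norm (ler0n R 2)).
    have h : `|F s + F t| <= 2 * `|M|.
      apply: le_trans (ler_normD _ _) _; have := FM s s0 sT; have := FM t t0 tT.
      by have := ler_norm M; lra.
    have := ler_wpM2l (normr_ge0 (F s - F t)) h.
    have := mulr_ge0 (normr_ge0 M) (normr_ge0 (G s - G t)).
    by have := normr_ge0 (F s - F t); lra.
  apply: ae_sub2 (itv_integral_derive T ik) (itv_integral_derive T iFk) => t + + tT.
  move=> /(_ tT) dF /(_ tT) dG; exists 0 => //.
  change (is_derive t 1 F (k t)) in dF; change (is_derive t 1 G (F t * k t)) in dG.
  have -> : phi = (F * F - 2%:R *: G) by apply/funext => s.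
  by apply: is_derive_eq; rewrite /GRing.scale /=; ring.
have z (h : R -> R) : \int[mu]_(s in `[0, 0]) h s = 0 by rewrite set_itv1 Rintegral_set1.
rewrite /phi /F /G !z mulr0 mulr0 subr0 -/(F T) => h.
have := sqr_ge0 (F T); rewrite expr2; lra.
Qed.

Section primitive_inner.
Context (R : realType) (tf : R) (n : nat).
Hypothesis tf0 : 0 < tf.
Local Notation mu := (lebesgue_on tf).
Local Notation lambda := (@lebesgue_measure R).
Local Notation D := (`[0, tf]%classic : set (measurableTypeR R)).

(** The inner product of a function with its derivative is half the squared norm of the final value
    when the initial value is zero; the sign suffices and is obtained coordinatewise. *)
Lemma primitive_inner_ge0 (x g : L2 tf n) : primitive x g 0 -> 0 <= inner x g.
Proof.
rewrite primitiveE => xg.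
have mD : measurable D by exact: measurable_itv.
have int i : mu.-integrable setT (EFin \o (fun t => L2_rep x t i 0 * L2_rep g t i 0)).
  exact/Lfun1_integrable/Lfun2_mul_Lfun1/L2_repP/L2_repP.
have -> : inner x g = \sum_i \int[mu]_t (L2_rep x t i 0 * L2_rep g t i 0).
  rewrite L2_innerE /Rintegral sum_fine; last first.
    by move=> i _; exact: integrable_fin_num (int i).
  congr fine; rewrite -integral_sum//.
  by apply: eq_integral => t _; rewrite euclid_innerE sumEFin.
apply: sumr_ge0 => i _.
have /integrableP[/measurable_EFinP mi _] := int i.
rewrite Rintegral_lebesgue_on//.
pose k := (fun s => L2_rep g s i 0) \_ D.
have kE t : t \in `[0, tf] -> k t = L2_rep g t i 0 by move=> tD; rewrite /k patchE mem_set.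
have ik : lambda.-integrable setT (EFin \o k).
  rewrite /k -restrict_EFin; apply/(integrable_mkcond _ mD); exact: L2_rep_integrable.
pose F t := \int[lambda]_(s in `[0, t]) k s.
have xE : \forall t \ae lambda, t \in `[0, tf] -> L2_rep x t i 0 = F t.
  move/ae_lebesgue_on: xg; apply: ae_sub => t xt tD; rewrite (xt tD) !mxE add0r.
  apply: eq_Rintegral => s; move: tD; rewrite inE /= !in_itv /= => /andP[t0 tT] /andP[s0 st].
  by rewrite kE// in_itv /= s0 (le_trans st).
have mF : measurable_fun setT (F : measurableTypeR R -> R).
  by apply: continuous_measurable_fun; exact: itv_integral_continuous.
have mk : measurable_fun setT (k : measurableTypeR R -> R).
  by have /integrableP[/measurable_EFinP] := ik.
pose p := (fun s => L2_rep x s i 0 * L2_rep g s i 0) \_ D.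
have ip : lambda.-integrable setT (EFin \o p).
  rewrite /p -restrict_EFin; apply/(integrable_mkcond _ mD); exact: integrable_lebesgue_on.
have pE : \forall t \ae lambda, p t = F t * k t.
  apply: ae_sub xE => t xt; have [tD|tD] := boolP (t \in `[0, tf]).
    by rewrite /p patchE mem_set// xt// kE.
  by rewrite /p /k !patchE memNset ?mulr0//; exact/negP.
have iFk : lambda.-integrable setT (EFin \o (F \* k)).
  have mFk : measurable_fun setT (EFin \o (F \* k) : measurableTypeR R -> \bar R).
    by apply/measurable_EFinP; exact: measurable_funM.
  have /integrableP[mp py] := ip; apply/integrableP; split => //.
  rewrite (_ : (\int[lambda]_t _ = \int[lambda]_t `|(EFin \o p) t|)%E)//.
  apply: ae_eq_integral => //; [exact: measurableT_comp|exact: measurableT_comp|].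
  by apply: ae_sub pE => t pt _; rewrite /= pt.
have -> : \int[lambda]_(t in D) (L2_rep x t i 0 * L2_rep g t i 0) =
    \int[lambda]_(t in D) (F t * k t).
  congr fine; apply: ae_eq_integral => //.
  - by apply/measurable_EFinP; exact: measurable_funS mi.
  - by apply/measurable_EFinP; apply: (measurable_funS (E := setT)) => //; exact: measurable_funM.
  - by apply: ae_sub xE => t xt tD; rewrite xt// kE.
exact: ge0_integral_primitive (ltW tf0) ik iFk.
Qed.

End primitive_inner.

Section H1_facts.
Context (R : realType) (tf : R) (n : nat).
Hypothesis tf0 : 0 < tf.
Implicit Types (x g : L2 tf n) (a : euclid R n).

Lemma primitive_H1 x g a : primitive x g a -> [/\ H1 x, H1_deriv x = g & H1_init x = a].
Proof.
move=> xg; split; first by exists g, a.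
  apply: xget_unique; first by exists a.
  by move=> h [b xh]; have [] := primitive_inj tf0 xg xh.
apply: xget_unique; first by exists g.
by move=> b [h xh]; have [] := primitive_inj tf0 xg xh.
Qed.

Lemma H1_primitive x : H1 x -> primitive x (H1_deriv x) (H1_init x).
Proof. by move=> [g [a xg]]; have [_ -> ->] := primitive_H1 xg. Qed.

End H1_facts.

Section constraint.
Context (R : realType) (tf : R) (n m : nat) (A : 'M[R]_n) (B : 'M[R]_(n, m)).
Hypothesis tf0 : 0 < tf.
Local Notation C := (@constraint R tf n m A B).
Implicit Types (q : dual tf n) (z : primal tf n m) (v : L2 tf m).

Lemma constraintP z q : dom C z /\ C z = q <->
  primitive z.1 (L2_mx A z.1 + (L2_mx B z.2 + q.1)) q.2.
Proof.
split=> [[zH <-]|zq].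
  have := H1_primitive tf0 zH; congr primitive.
  rewrite -[RHS]/(L2_mx A z.1 + (L2_mx B z.2 + (H1_deriv z.1 - L2_mx A z.1 - L2_mx B z.2))).
  by rewrite [L2_mx B z.2 + _]addrC subrK addrC subrK.
have [zH zd zi] := primitive_H1 tf0 zq; split=> //.
rewrite -[LHS]/((H1_deriv z.1 - L2_mx A z.1 - L2_mx B z.2, H1_init z.1)) zd zi.
by rewrite [L2_mx A _ + _]addrC addrK [_ + q.1]addrC addrK -surjective_pairing.
Qed.

Definition ode_solution q : L2 tf n := xget 0 [set x | primitive x (L2_mx A x + q.1) q.2].
Local Notation S := ode_solution.

Lemma ode_solutionP q x : primitive x (L2_mx A x + q.1) q.2 <-> x = S q.
Proof.
have ex : exists x, primitive x (L2_mx A x + q.1) q.2.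
  by have [c _ /(_ q.1 q.2)[y yP _]] := ode_exists A tf0; exists y.
have SP : primitive (S q) (L2_mx A (S q) + q.1) q.2 by exact: xgetPex ex.
split=> [xP|->//]; apply/eqP; rewrite -subr_eq0; apply/eqP; apply: (ode_unique tf0 (A := A)).
have := primitive_linear (-1) SP xP.
by rewrite !scaleN1r !(addrC (- _)) subrr opprD addrACA subrr addr0 -L2_mxB.
Qed.

Lemma ode_solution_linear a q r : S (a *: q + r) = a *: S q + S r.
Proof.
apply/esym/ode_solutionP; rewrite L2_mx_linear.
have := primitive_linear a (proj2 (ode_solutionP q _) erefl) (proj2 (ode_solutionP r _) erefl).
by rewrite scalerDr addrACA.
Qed.

Lemma ode_solution_bound : exists2 c : R, 0 <= c & forall q, `|S q| <= c * `|q|.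
Proof.
have [c c0 cP] := ode_exists A tf0; exists (2 * c) => [|q]; first by rewrite mulr_ge0.
have [x /ode_solutionP <- xq] := cP q.1 q.2; apply: le_trans xq _.
rewrite mulrAC mulrC ler_wpM2r//.
by have := hprod_norm1 q; have := hprod_norm2 q; lra.
Qed.

(** Describes the graph of the unbounded operator by the bounded map [S]. Linearity and closedness
    of the operator, and the determination of the state by control and data, are read off from
    it. *)
Lemma constraint_solution z q : dom C z /\ C z = q <-> z.1 = S (q + (L2_mx B z.2, 0)).
Proof.
rewrite -ode_solutionP constraintP.
rewrite -[(q + _).1]/(q.1 + L2_mx B z.2) -[(q + _).2]/(q.2 + 0) addr0.
by rewrite [L2_mx B z.2 + _]addrC.
Qed.

Lemma constraint_ode_solution q : dom C (S q, 0) /\ C (S q, 0) = q.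
Proof.
apply/constraint_solution; rewrite /= L2_mx0.
by rewrite (_ : ((0, 0) : dual tf n) = 0)// addr0.
Qed.

Let source v : dual tf n := (L2_mx B v, 0).

Let source_linear a u v : source (a *: u + v) = a *: source u + source v.
Proof.
by rewrite -[RHS]/(a *: L2_mx B u + L2_mx B v, a *: 0 + 0) /source L2_mx_linear scaler0 addr0.
Qed.

Lemma constraint_linear : linear_op C.
Proof.
split.
  suff [] : dom C 0 /\ C 0 = 0 by [].
  apply/constraint_solution; rewrite add0r -/(source _).
  have -> : source (0 : primal tf n m).2 = 0 by congr pair; rewrite L2_mx0.
  have := ode_solution_linear (-1) 0 0; rewrite scaler0 add0r scaleN1r addNr.
  by move->.
move=> a x y dx dy; apply/constraint_solution.
have := proj1 (constraint_solution x (C x)) (conj dx erefl).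
have := proj1 (constraint_solution y (C y)) (conj dy erefl).
rewrite -!/(source _) -[(a *: x + y).1]/(a *: x.1 + y.1) -[(a *: x + y).2]/(a *: x.2 + y.2).
move=> -> ->; rewrite -ode_solution_linear source_linear; congr S.
by rewrite scalerDr addrACA.
Qed.

(** [S (C z)] differs from [z.1] only by the response of the equation to the control, which is
    bounded in [z.2]. *)
Lemma constraint_ode_bound : exists c : R, forall z, dom C z -> `|S (C z)| <= c * `|z|.
Proof.
have [c c0 cP] := ode_solution_bound.
have [CB CB0 CBP] := euclid_mulmx_bound B.
exists (1 + c * CB) => z dz.
have := proj1 (constraint_solution z (C z)) (conj dz erefl).
rewrite -/(source _) addrC -[source _]scale1r ode_solution_linear scale1r => /eqP.
rewrite addrC -subr_eq => /eqP <-.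
apply: le_trans (ler_normB _ _) _; rewrite mulrDl mul1r; apply: lerD; first exact: hprod_norm1.
apply: le_trans (cP _) _; rewrite -mulrA ler_wpM2l//.
apply: le_trans (hprod_norm_le _) _; rewrite normr0 addr0.
apply: le_trans (L2_mx_bound _ (ltW CB0) CBP) _; rewrite ler_wpM2l//; first exact: ltW.
exact: hprod_norm2.
Qed.

Lemma constraint_closed : closed_op C.
Proof.
move=> u x y du ux uy; apply/constraint_solution.
have [c c0 cP] := ode_solution_bound.
have [CB CB0 CBP] := euclid_mulmx_bound B.
have cS (v : nat -> dual tf n) l : v k @[k --> \oo] --> l -> S (v k) @[k --> \oo] --> S l.
  move=> /cvgrPdist_lt vl; apply/cvgrPdist_lt => e e0.
  have c1 : 0 < c + 1 by rewrite ltr_wpDl.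
  apply: filterS (vl (e / (c + 1)) (divr_gt0 e0 c1)) => k; rewrite ltr_pdivlMr// => h.
  apply: le_lt_trans h; rewrite mulrC.
  have -> : S l - S (v k) = S (l - v k).
    by rewrite -scaleN1r addrC -ode_solution_linear scaleN1r addrC.
  by apply: le_trans (cP _) _; rewrite ler_wpM2r// lerDl.
have u1 : (u k).1 @[k --> \oo] --> x.1 by exact: cvg_hprod1.
have u2 : (u k).2 @[k --> \oo] --> x.2 by exact: cvg_hprod2.
have Bu : L2_mx B (u k).2 @[k --> \oo] --> L2_mx B x.2.
  move/cvgrPdist_lt: u2 => u2; apply/cvgrPdist_lt => e e0.
  apply: filterS (u2 (e / CB) (divr_gt0 e0 CB0)) => k; rewrite ltr_pdivlMr// mulrC => h.
  by rewrite -L2_mxB; exact: le_lt_trans (L2_mx_bound _ (ltW CB0) CBP) h.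
have : S (C (u k) + source (u k).2) @[k --> \oo] --> S (y + source x.2).
  apply: cS; apply: cvgD => //; apply: cvg_hprod => //; exact: cvg_cst.
have E k : (u k).1 = S (C (u k) + source (u k).2).
  exact: (proj1 (constraint_solution (u k) (C (u k))) (conj (du k) erefl)).
under eq_cvg do rewrite -E.
by move=> h; apply: (cvg_unique _ u1 h); exact: norm_hausdorff.
Qed.

Lemma constraint_dense : dense_op C.
Proof.
move=> h hP.
have h2 : h.2 = 0.
  (* Two elements of the domain with the same state, one with control [h.2] and one with control
     zero, isolate [h.2]. *)
  have [dz _] : dom C (S (source h.2), h.2) /\ C (S (source h.2), h.2) = 0.
    by apply/constraint_solution; rewrite add0r.
  have [dz' _] := constraint_ode_solution (source h.2).
  have := hP _ dz; rewrite hprod_innerE /=; have := hP _ dz'; rewrite hprod_innerE /=.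
  rewrite inner0l addr0 => ->; rewrite add0r inner_norm => /eqP.
  by rewrite sqrf_eq0 normr_eq0 => /eqP.
suff h1 : h.1 = 0 by rewrite [h]surjective_pairing h1 h2.
(* Test with the solution of x' = h.1 - x, x(0) = 0: as <x', x> >= 0, it vanishes. *)
have [c _ /(_ h.1 0)[x xP _]] := ode_exists (-1%:M : 'M[R]_n) tf0.
have Nx : L2_mx (-1%:M) x = - x.
  apply/L2_eqP; apply: ae_sub2 (L2_rep_mx (-1%:M) x) (L2_repZ (-1) x).
  move=> t /(_ I) -> /(_ I) + _; rewrite scaleN1r => ->.
  by rewrite mulNmx mul1mx scaleN1r.
have [dx _] : dom C (x, 0) /\ C (x, 0) = (H1_deriv x - L2_mx A x, H1_init x).
  have [xH _ _] := primitive_H1 tf0 xP; split => //.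
  by congr pair; rewrite /= L2_mx0 subr0.
have xh : inner x h.1 = 0 by have := hP _ dx; rewrite hprod_innerE /= inner0l addr0.
have x0 : x = 0.
  have := primitive_inner_ge0 tf0 xP; rewrite Nx innerDr xh addr0 innerNr inner_norm.
  rewrite oppr_ge0 => x0; apply/eqP; rewrite -normr_eq0 -sqrf_eq0 eq_le x0 sqr_ge0.
  by [].
move: xP; rewrite Nx x0 oppr0 add0r => /(primitive0_inj tf0)[].
by [].
Qed.

End constraint.

(** * The cost functional *)

Section differential.
Context (R : realType) (X : innerProductType R).
Implicit Types (F : X -> R) (x g h : X).

(** A named function, so that the linear structure needed to identify the differential can be
    attached to it. *)
Definition inner_fun g (h : X) : R := inner g h.

Let inner_fun_linear g : linear (inner_fun g : X -> R^o).
Proof. by move=> a h k; rewrite /inner_fun innerDr innerZr. Qed.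

HB.instance Definition _ g :=
  GRing.isLinear.Build R X R^o _ (inner_fun g : X -> R^o) (inner_fun_linear g).

Lemma is_gradientP F x g : is_gradient F x g <-> forall e : R, 0 < e ->
  \forall h \near (0 : X), `|F (h + x) - (F x + inner g h)| <= e * `|h|.
Proof.
split=> [[dF gE] e e0|Fg].
  have /diff_locally/eqaddoP/(_ e e0) := dF; apply: filterS => h.
  rewrite -[X in `|X| <= _]/(F (h + x) - (F x + 'd F x h)) gE.
  exact.
have cg : continuous (inner_fun g : X -> R).
  by move=> h; apply: cvg_inner; [exact: cvg_cst|exact: cvg_id].
have Fo : F \o shift x = cst (F x) + (inner_fun g : X -> R^o) +o_ (0 : X) id.
  apply/eqaddoP => e /Fg; apply: filterS => h.
  exact.
have dE := diff_unique cg Fo.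
split; last by move=> h; rewrite dE.
by apply/diff_locallyP; rewrite dE.
Qed.

(** The differential is bounded and the remainder is at most [|z - x|] nearby, hence [1 + k]. For
    the gradient of the cost this converts second differentiability into the Lipschitz bound at the
    equilibrium. *)
Lemma differentiable_lipschitz (Y : normedModType R) (G : X -> Y) x :
  differentiable G x -> exists L rho : R, 0 < rho /\
    forall z, `|z - x| < rho -> `|G z - G x| <= L * `|z - x|.
Proof.
move=> dG; have [k k0 kP] := linear_lipschitz (diff_continuous dG).
have /diff_locally/eqaddoP/(_ 1 ltr01)/nbhs_ballP[r /= r0 rP] := dG.
exists (1 + k), r; split => // z zx.
have : ball (0 : X) r (z - x) by rewrite -ball_normE /= sub0r normrN.
move/rP; rewrite -[X in `|X| <= _]/(G (z - x + x) - (G x + 'd G x (z - x))) mul1r subrK.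
have : `|'d G x (z - x)| <= k * `|z - x| := kP (z - x).
move: ('d G x (z - x)) => v vz h; rewrite mulrDl mul1r; apply: le_trans (lerD h vz).
have -> : G z - G x = (G z - (G x + v)) + v by rewrite opprD addrA subrK.
exact: ler_normD.
Qed.

End differential.

(* Far from x0, monotonicity of g along the ray from x0 takes over. *)
Lemma coercive_min (R : realType) (X : innerProductType R) (g : X -> X) (x0 : X) (c : R) :
  0 < c -> (forall x y, 0 <= inner (g x - g y) (x - y)) ->
  (\forall x \near x0, inner (g x - g x0) (x - x0) >= c * `|x - x0| ^+ 2) ->
  exists2 rho : R, 0 < rho &
    forall x, c * Num.min `|x - x0| rho ^+ 2 <= inner (g x - g x0) (x - x0).
Proof.
move=> c0 mg /nbhs_ballP[r /= r0 rP]; exists (r / 2) => [|x]; first by rewrite divr_gt0.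
have near y : `|y - x0| < r -> c * `|y - x0| ^+ 2 <= inner (g y - g x0) (y - x0).
  by move=> yr; apply: rP; rewrite -ball_normE /= distrC.
have [xr|xr] := leP `|x - x0| (r / 2).
  by apply: near; apply: le_lt_trans xr _; rewrite ltr_pdivrMr// ltr_pMr// ltr1n.
set d := `|x - x0| in xr *.
have d0 : 0 < d by apply: lt_trans xr; rewrite divr_gt0.
pose s := r / 2 / d.
have s0 : 0 < s by rewrite !divr_gt0.
have s1 : s < 1 by rewrite ltr_pdivrMr// mul1r.
pose y := x0 + s *: (x - x0).
have yx0 : y - x0 = s *: (x - x0) by rewrite /y addrAC subrr add0r.
have xy : x - y = (1 - s) *: (x - x0).
  by rewrite /y opprD addrA scalerBl scale1r.
have ny : `|y - x0| = r / 2 by rewrite yx0 normrZ gtr0_norm// /s divfK// gt_eqF.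
have h1 : c * (r / 2) ^+ 2 <= inner (g y - g x0) (x - x0).
  have := near y; rewrite ny => /(_ _) h.
  apply: le_trans (h _) _; first by rewrite ltr_pdivrMr// ltr_pMr// ltr1n.
  have nn : 0 <= inner (g y - g x0) (x - x0).
    by have := mg y x0; rewrite yx0 innerZr pmulr_rge0.
  by rewrite yx0 innerZr ler_piMl// ltW.
have h2 : 0 <= inner (g x - g y) (x - x0).
  by have := mg x y; rewrite xy innerZr pmulr_rge0// subr_gt0.
apply: le_trans h1 _; rewrite -subr_ge0 -innerBl opprB addrA subrK.
exact: h2.
Qed.

Section cost.
Context (R : realType) (tf : R) (n m : nat) (alpha : R) (lx : euclid R n -> R).
Hypothesis alpha0 : 0 < alpha.
Hypothesis lx_ge0 : forall v, 0 <= lx v.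
Hypothesis lx_convex : convex_function [set: euclid R n] lx.
Hypothesis lx_int : forall x : L2 tf n,
  (lebesgue_on tf).-integrable setT (fun t => (lx (L2_rep x t))%:E).
Hypothesis gradient_x : forall x : L2 tf n, exists g, is_gradient (cost_x lx) x g.
Local Notation mu := (lebesgue_on tf).
Local Notation J := (cost alpha lx : primal tf n m -> R).
Local Notation Jx := (cost_x lx : L2 tf n -> R).
Implicit Types z : primal tf n m.

Lemma costE z : J z = Jx z.1 + alpha / 2 * `|z.2| ^+ 2.
Proof.
have i2 := L2_norm_rep_sqr_integrable z.2.
have i2' : mu.-integrable setT (EFin \o (fun t => alpha / 2 * `|L2_rep z.2 t| ^+ 2)).
  exact: (integrableZl _ (alpha / 2) i2).
rewrite L2_sqr_norm -RintegralZl// -RintegralD//; exact: lx_int.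
Qed.

Lemma cost_ge0 z : 0 <= J z.
Proof.
rewrite costE addr_ge0 ?mulr_ge0 ?divr_ge0 ?sqr_ge0 ?(ltW alpha0)//.
by apply: Rintegral_ge0 => t _.
Qed.

Lemma lx_segment_convex : segment_convex lx.
Proof.
move=> x y t t0 t1; pose p : {i01 R} := Itv01 t0 t1.
have : lx (t *: y + (1 - t) *: x) <= t * lx y + (1 - t) * lx x.
  exact: (lx_convex p (mem_setT y) (mem_setT x)).
have -> : t *: y + (1 - t) *: x = x + t *: (y - x).
  by rewrite scalerBl scale1r scalerBr addrCA.
by move/le_trans; apply; lra.
Qed.

Lemma cost_x_segment_convex : segment_convex Jx.
Proof.
move=> x y t t0 t1.
have iy : mu.-integrable setT (EFin \o (fun s => t * (lx (L2_rep y s) - lx (L2_rep x s)))).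
  apply: (integrableZl _ t (_ : mu.-integrable setT (EFin \o (fun s => lx (L2_rep y s) - lx (L2_rep x s))))) => //.
  exact: (integrableB _ (lx_int y) (lx_int x)).
have -> : Jx x + t * (Jx y - Jx x) =
    \int[mu]_s (lx (L2_rep x s) + t * (lx (L2_rep y s) - lx (L2_rep x s))).
  rewrite RintegralD//; last exact: lx_int.
  rewrite RintegralZl//; last exact: (integrableB _ (lx_int y) (lx_int x)).
  by rewrite RintegralB//; exact: lx_int.
have ir : mu.-integrable setT
    (EFin \o (fun s => lx (L2_rep x s) + t * (lx (L2_rep y s) - lx (L2_rep x s)))).
  exact: (integrableD _ (lx_int x) iy).
have il := lx_int (x + t *: (y - x)).
rewrite -lee_fin !fineK; [|exact: integrable_fin_num ir|exact: integrable_fin_num il].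
apply: ae_ge0_le_integral => //.
- by move=> s _; rewrite lee_fin.
- by have /integrableP[] := il.
- move=> s _; rewrite lee_fin.
  have := lx_ge0 (L2_rep x s); have := lx_ge0 (L2_rep y s).
  by move: (lx _) (lx _) => a b; nra.
- by have /integrableP[] := ir.
have h1 := L2_repD x (t *: (y - x)).
have h2 := ae_sub2 (fun s P Q => conj P Q) (L2_repZ t (y - x)) (L2_repB y x).
apply: ae_sub2 h1 h2 => s /(_ I) e1 [/(_ I) e2 /(_ I) e3] _.
by rewrite lee_fin e1 /= e2 e3 lx_segment_convex.
Qed.

Lemma cost_gradient z : is_gradient J z (gradient Jx z.1, alpha *: z.2).
Proof.
have [g0 /gradientP/is_gradientP gx] := gradient_x z.1.
apply/is_gradientP => e e0.
have e2 : 0 < e / 2 by rewrite divr_gt0.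
have /nbhs_ballP[r /= r0 rP] := gx _ e2.
(* Within this radius the quadratic remainder [alpha / 2 * |h.2|^2] is at most [e / 2 * |h|]; the
   other half of [e] is left for the state part. *)
have ea : 0 < e / alpha by rewrite divr_gt0.
apply/nbhs_ballP; exists (Num.min r (e / alpha)) => [|h]; first by rewrite /= lt_min r0.
rewrite -ball_normE /= sub0r normrN lt_min => /andP[hr he].
rewrite !costE hprod_innerE -[(h + z).1]/(h.1 + z.1) -[(h + z).2]/(h.2 + z.2) -[(_, _).1]/(gradient Jx z.1) -[(_, _).2]/(alpha *: z.2).
set d := Jx (h.1 + z.1) - (Jx z.1 + inner (gradient Jx z.1) h.1).
have -> : Jx (h.1 + z.1) + alpha / 2 * `|h.2 + z.2| ^+ 2 -
    (Jx z.1 + alpha / 2 * `|z.2| ^+ 2 + (inner (gradient Jx z.1) h.1 + inner (alpha *: z.2) h.2)) =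
    d + alpha / 2 * `|h.2| ^+ 2.
  by rewrite /d sqr_normD innerZl (innerC z.2); field.
have n1 := hprod_norm1 h; have n2 := hprod_norm2 h.
have dP : `|d| <= e / 2 * `|h|.
  apply: (@le_trans _ _ (e / 2 * `|h.1|)); last by rewrite ler_wpM2l// ltW.
  by apply: rP; rewrite -ball_normE /= sub0r normrN (le_lt_trans n1).
have qP : alpha / 2 * `|h.2| ^+ 2 <= e / 2 * `|h|.
  rewrite expr2 mulrA; apply: ler_pM => //.
    by rewrite mulr_ge0// divr_ge0// ltW.
  rewrite mulrAC ler_pM2r ?invr_gt0// mulrC -ler_pdivlMr//.
  exact: le_trans n2 (ltW he).
apply: le_trans (ler_normD _ _) _.
rewrite [X in _ + X]ger0_norm; last by rewrite mulr_ge0 ?sqr_ge0// divr_ge0// ltW.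
by move: dP qP; lra.
Qed.

Lemma gradient_cost z : gradient J z = (gradient Jx z.1, alpha *: z.2).
Proof. exact: gradientE (cost_gradient z). Qed.

Lemma cost_gradient_exists z : exists g, is_gradient J z g.
Proof. by eexists; exact: cost_gradient. Qed.

Lemma gradient_costB z z' : inner (gradient J z - gradient J z') (z - z') =
  inner (gradient Jx z.1 - gradient Jx z'.1) (z.1 - z'.1) + alpha * `|z.2 - z'.2| ^+ 2.
Proof.
rewrite !gradient_cost hprod_innerE /= -inner_norm -innerZl scalerBr.
by [].
Qed.

Lemma gradient_x_monotone x y : 0 <= inner (gradient Jx x - gradient Jx y) (x - y).
Proof. exact: gradientB_ge0 cost_x_segment_convex gradient_x x y. Qed.

Lemma cost_segment_convex : segment_convex J.
Proof.
move=> x y t t0 t1; rewrite !costE.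
have := cost_x_segment_convex x.1 y.1 t0 t1.
rewrite -[(x + _).1]/(x.1 + t *: (y.1 - x.1)) -[(x + _).2]/(x.2 + t *: (y.2 - x.2)).
have -> : `|x.2 + t *: (y.2 - x.2)| ^+ 2 =
    `|x.2| ^+ 2 + t * (`|y.2| ^+ 2 - `|x.2| ^+ 2) - t * (1 - t) * `|y.2 - x.2| ^+ 2.
  by rewrite sqr_normD sqr_normZ sqr_normB innerZr innerBr inner_norm (innerC y.2); ring.
have : 0 <= alpha / 2 * (t * (1 - t) * `|y.2 - x.2| ^+ 2).
  by rewrite !mulr_ge0 ?sqr_ge0 ?invr_ge0 ?subr_ge0// ltW.
set q := t * (1 - t) * _; rewrite !mulrDr !mulrN => q0.
by move: (Jx _) (Jx _) (Jx _) => a b c; move: (`|x.2| ^+ 2) (`|y.2| ^+ 2) => u v; lra.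
Qed.

(** The control part is quadratic and expands exactly, so its second-order term survives the
    convexity estimate for the state part; it later forces optimal controls to coincide. *)
Lemma cost_gradient_le z z' :
  inner (gradient J z) (z' - z) + alpha / 2 * `|z'.2 - z.2| ^+ 2 <= J z' - J z.
Proof.
have [g0 /gradientP gx] := gradient_x z.1.
have := gradient_convex_le z'.1 cost_x_segment_convex gx.
rewrite gradient_cost hprod_innerE /= !costE sqr_normB innerZl.
rewrite -[inner z.2 (z'.2 - z.2)]/(inner z.2 (z'.2 - z.2)) innerBr inner_norm (innerC z.2).
by lra.
Qed.

(** The control part is coercive globally and the state part up to truncation. If the state error is
    below [rho], the squares add up to the full norm; otherwise the state part alone supplies
    [rho ^+ 2]. *)
Lemma cost_coercive z c : 0 < c ->
  (\forall x \near z.1, inner (gradient Jx x - gradient Jx z.1) (x - z.1) >= c * `|x - z.1| ^+ 2) ->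
  exists2 rho : R, 0 < rho & forall z',
    Num.min c alpha * Num.min `|z' - z| rho ^+ 2 <= inner (gradient J z' - gradient J z) (z' - z).
Proof.
move=> c0 /(coercive_min c0 gradient_x_monotone)[rho rho0 rhoP]; exists rho => // z'.
rewrite gradient_costB; have := rhoP z'.1.
have k0 : 0 < Num.min c alpha by rewrite lt_min c0.
have kc : Num.min c alpha <= c by rewrite ge_min lexx.
have ka : Num.min c alpha <= alpha by rewrite ge_min lexx orbT.
set k := Num.min c alpha in k0 kc ka *; set b := inner _ _ => h.
have D2 := hprod_sqr_norm (z' - z).
rewrite -[(z' - z).1]/(z'.1 - z.1) -[(z' - z).2]/(z'.2 - z.2) in D2.
apply: (@le_trans _ _ (c * Num.min `|z'.1 - z.1| rho ^+ 2 + alpha * `|z'.2 - z.2| ^+ 2)); last first.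
  by rewrite lerD2r.
apply: (@le_trans _ _ (k * (Num.min `|z'.1 - z.1| rho ^+ 2 + `|z'.2 - z.2| ^+ 2))); last first.
  by rewrite mulrDr lerD// ler_wpM2r// sqr_ge0.
rewrite ler_wpM2l//; first exact: ltW.
have m0 : 0 <= Num.min `|z' - z| rho by rewrite le_min normr_ge0 ltW.
have [_|_] := leP `|z'.1 - z.1| rho.
  by rewrite -D2 ler_pXn2r ?nnegrE// ge_min lexx.
rewrite -[leLHS]addr0 lerD ?sqr_ge0// ler_pXn2r ?nnegrE ?(ltW rho0)//.
by rewrite ge_min lexx orbT.
Qed.

End cost.

(** * The optimizer dynamics *)

Section optimality.
Context (R : realType) (tf : R) (n m : nat) (A : 'M[R]_n) (B : 'M[R]_(n, m)).
Context (alpha : R) (lx : euclid R n -> R) (f : L2 tf n) (x0 : euclid R n).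
Hypothesis tf0 : 0 < tf.
Hypothesis alpha0 : 0 < alpha.
Hypothesis lx_ge0 : forall v, 0 <= lx v.
Hypothesis lx_convex : convex_function [set: euclid R n] lx.
Hypothesis lx_int : forall x : L2 tf n,
  (lebesgue_on tf).-integrable setT (fun t => (lx (L2_rep x t))%:E).
Hypothesis gradient_x : forall x : L2 tf n, exists g, is_gradient (cost_x lx) x g.
Local Notation C := (@constraint R tf n m A B).
Local Notation J := (cost alpha lx : primal tf n m -> R).
Local Notation M := (M_opt tf A B alpha lx).
Local Notation rhs := ((0, (f, x0)) : state tf n m).
Implicit Types z : primal tf n m.

Let linC : linear_op C. Proof. exact: constraint_linear. Qed.
Let cJ : segment_convex J. Proof. exact: cost_segment_convex. Qed.
Let gJ z : exists g, is_gradient J z g. Proof. exact: cost_gradient_exists. Qed.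

Lemma optimizer_maximally_monotone : maximally_monotone_ph (optimizer tf A B alpha lx).
Proof.
have mM : m_accretive (saddle_op C J).
  apply: saddle_m_accretive => //.
  - by apply: hprod_complete; exact: L2_complete.
  - by apply: hprod_complete; [exact: L2_complete|exact: euclid_complete].
  - exact: constraint_closed.
  - exact: constraint_dense.
  - exact: cost_ge0.
split; last exact: mM; split.
- exact: mM.1.
- move=> a u v.
  by rewrite -[RHS]/((a *: 0 + 0, a *: u + v) : state tf n m) scaler0 addr0.
- move=> v.
  apply: (@cvg_hprod _ (primal tf n m) (dual tf n) _ (nbhs v) _ (fun u => (0, u)) (0, v)).
    exact: cvg_cst.
  exact: cvg_id.
- move=> w u; rewrite -[RHS]/(inner w.1 (0 : primal tf n m) + inner w.2 u).
  by rewrite inner0r add0r.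
Qed.

Lemma feasibleE z : feasible A B f x0 z <-> dom C z /\ C z = (f, x0).
Proof.
split=> [[zH zd zi]|[zH [zd zi]]]; split=> //.
- rewrite -[LHS]/((H1_deriv z.1 - L2_mx A z.1 - L2_mx B z.2, H1_init z.1)) zi; congr pair.
  by apply/eqP; rewrite !subr_eq zd addrC [L2_mx A _ + _]addrC addrA.
- by rewrite -zd -[H1_deriv z.1 - _ - _]addrA -opprD addrCA subrr addr0.
Qed.

Lemma constraint_inj z z' : dom C z -> dom C z' -> C z = C z' -> z.2 = z'.2 -> z = z'.
Proof.
move=> dz dz' Czz' z2.
have := proj1 (constraint_solution A B tf0 z (C z)) (conj dz erefl).
have := proj1 (constraint_solution A B tf0 z' (C z')) (conj dz' erefl).
rewrite Czz' z2 => <- z1.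
by rewrite [z]surjective_pairing z1 z2 -surjective_pairing.
Qed.

Variable wh : state tf n m.
Hypotheses (dwh : dom M wh) (Mwh : M wh = rhs).

Let gradient_wh : gradient J wh.1 = adjoint C wh.2.
Proof. by apply/eqP; rewrite -subr_eq0; have /(congr1 fst)/eqP := Mwh. Qed.

Let C_wh : C wh.1 = (f, x0).
Proof. exact: (congr1 snd Mwh). Qed.

(** The first-order term vanishes: the gradient at [wh.1] is an adjoint value, and feasible
    differences lie in the kernel of the constraint operator. *)
Lemma kkt_cost_le z : feasible A B f x0 z ->
  alpha / 2 * `|z.2 - wh.1.2| ^+ 2 <= J z - J wh.1.
Proof.
move=> /feasibleE[dz Cz]; have [dwh1 dwh2] := dwh.
have [dd Cd] := linear_opB linC dz dwh1.
apply: le_trans (cost_gradient_le alpha0 lx_ge0 lx_convex lx_int gradient_x wh.1 z).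
by rewrite gradient_wh innerC -adjointP// Cd Cz C_wh subrr inner0l add0r.
Qed.

Lemma kkt_optimal : optimal A B alpha lx f x0 wh.1.
Proof.
split=> [|z /kkt_cost_le h]; first by apply/feasibleE; split; [have [] := dwh|].
rewrite -subr_ge0; apply: le_trans h.
by rewrite mulr_ge0 ?sqr_ge0// divr_ge0// ltW.
Qed.

Lemma kkt_optimal_unique z : optimal A B alpha lx f x0 z -> z = wh.1.
Proof.
move=> [fz optz]; have [fwh _] := kkt_optimal.
have := kkt_cost_le fz; have := optz _ fwh; rewrite -subr_le0 => /[swap] /le_trans /[apply].
rewrite pmulr_rle0 ?divr_gt0// => n0.
have /eqP z2 : `|z.2 - wh.1.2| ^+ 2 == 0 by rewrite eq_le n0 sqr_ge0.
move/eqP: z2; rewrite sqrf_eq0 normr_eq0 subr_eq0 => /eqP z2.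
move/feasibleE: fz => [dz Cz]; apply: constraint_inj => //; first by have [] := dwh.
by rewrite Cz C_wh.
Qed.

(** Two solutions make the monotonicity identity vanish, so strong convexity identifies the
    controls. The differential equation then identifies the states, and surjectivity of the
    constraint operator makes its adjoint injective on the multipliers. *)
Lemma kkt_unique w : dom M w -> M w = rhs -> w = wh.
Proof.
move=> dw Mw.
have := inner_saddle linC dw dwh.
rewrite -[saddle_op C J w]/(M w) -[saddle_op C J wh]/(M wh) Mw Mwh subrr inner0l.
rewrite gradient_costB// => /esym E.
have g0 := gradient_x_monotone lx_ge0 lx_convex lx_int gradient_x w.1.1 wh.1.1.
have a0 : 0 <= alpha * `|w.1.2 - wh.1.2| ^+ 2 by rewrite mulr_ge0 ?sqr_ge0// ltW.
have /eqP : alpha * `|w.1.2 - wh.1.2| ^+ 2 = 0 by lra.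
rewrite mulf_eq0 gt_eqF//= sqrf_eq0 normr_eq0 subr_eq0 => /eqP w2.
have [dw1 dw2] := dw; have [dwh1 dwh2] := dwh.
have w1 : w.1 = wh.1.
  by apply: constraint_inj => //; rewrite C_wh; exact: (congr1 snd Mw).
have adj : adjoint C w.2 = adjoint C wh.2.
  apply/esym/eqP; rewrite -gradient_wh -w1 -subr_eq0.
  by have /(congr1 fst)/eqP := Mw.
suff p2 : w.2 = wh.2 by rewrite [w]surjective_pairing w1 p2 -surjective_pairing.
apply: inner_inj => h.
have [dh Ch] := constraint_ode_solution A B tf0 h.
have adjE p : dom (adjoint C) p -> inner p h = inner ((ode_solution A h, 0) : primal tf n m) (adjoint C p).
  by move=> dp; rewrite innerC -{1}Ch adjointP.
by rewrite (adjE _ dw2) (adjE _ dwh2) adj.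
Qed.

Lemma optimizer_exponential (c : R) (w0 : state tf n m) (w : R -> state tf n m) :
  twice_differentiable J -> 0 < c ->
  (\forall x \near wh.1.1, inner (gradient (cost_x lx) x - gradient (cost_x lx) wh.1.1)
     (x - wh.1.1) >= c * `|x - wh.1.1| ^+ 2) ->
  dom M w0 -> strong_solution (optimizer tf A B alpha lx) (fun=> (f, x0)) w0 w ->
  exists K omega : R, 0 < omega /\ forall t, 0 <= t -> `|w t - wh| <= K * expR (- omega * t).
Proof.
move=> [_ /(_ wh.1) dG] c0 /(cost_coercive alpha0 lx_ge0 lx_convex lx_int gradient_x c0)[r r0 rP] dw0 sw.
have [L [rho [rho0 lip]]] := differentiable_lipschitz dG.
have [cS cS0 cSP] := ode_solution_bound A tf0.
have [cP cPP] := constraint_ode_bound A B tf0.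
(* The right inverse meets the constraint with zero control. *)
pose S q : primal tf n m := (ode_solution A q, 0).
have k0 : 0 < Num.min c alpha by rewrite lt_min c0.
have w00 : w 0 = w0 by have [] := sw 1 ltr01.
have nS q : `|S q| <= `|ode_solution A q|.
  by apply: le_trans (hprod_norm_le (S q)) _; rewrite normr0 addr0.
apply: (@saddle_exponential R (primal tf n m) (dual tf n) C J S cS cP linC cJ gJ _ _ _ _
   rhs wh (Num.min c alpha) (Num.min r rho) L dwh Mwh k0).
- move=> a q q'; rewrite -[RHS]/((a *: ode_solution A q + ode_solution A q', a *: 0 + 0) : primal tf n m).
  by rewrite scaler0 addr0 -ode_solution_linear.
- by move=> q; apply: le_trans (nS q) (cSP q).
- exact: constraint_ode_solution.
- by move=> z dz; apply: le_trans (nS _) (cPP z dz).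
- by rewrite lt_min r0.
- move=> z; apply: le_trans (rP z); rewrite ler_wpM2l//; first exact: ltW.
  have m0 : 0 <= Num.min `|z - wh.1| (Num.min r rho) by rewrite !le_min normr_ge0 !ltW.
  have m1 : 0 <= Num.min `|z - wh.1| r by rewrite le_min normr_ge0 ltW.
  rewrite ler_pXn2r ?nnegrE//.
  by rewrite !(le_min, ge_min) !lexx ?orbT.
- by move=> z; rewrite lt_min => /andP[_]; exact: lip.
- by move=> T T0; apply: strong_solution_trajectory T0 sw.
- by rewrite w00.
Qed.

End optimality.

Lemma expR_decay_cvg (R : realType) (X : normedModType R) (w : R -> X) (l : X) (K omega : R) :
  0 < omega -> (forall t, 0 <= t -> `|w t - l| <= K * expR (- omega * t)) ->
  w t @[t --> +oo] --> l.
Proof.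
move=> omega0 wl; apply/cvgrPdist_lt => e e0.
near=> t; rewrite distrC.
have t0 : 0 < t by near: t; exact: nbhs_pinfty_gt.
apply: le_lt_trans (wl t (ltW t0)) _.
have K1 : K < `|K| + 1 by rewrite (le_lt_trans (ler_norm K))// ltrDl.
(* Chosen so that [expR (omega * t)], which exceeds [omega * t], exceeds [(|K| + 1) / e]. *)
have te : (`|K| + 1) / e / omega < t by near: t; apply: nbhs_pinfty_gt; exact: num_real.
have E : 0 < expR (omega * t) := expR_gt0 _.
rewrite mulNr expRN ltr_pdivrMr//; apply: lt_trans K1 _.
rewrite mulrC -ltr_pdivrMr//; apply: lt_trans (_ : _ < omega * t) _.
  by rewrite [omega * t]mulrC -ltr_pdivrMr.
by apply: lt_le_trans (expR_ge1Dx _); rewrite ltrDr.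
Unshelve. all: by end_near. Qed.

Theorem corollary3p5 (R : realType) (n m : nat) (tf : R)
    (A : 'M[R]_n) (B : 'M[R]_(n, m)) (f : L2 tf n) (x0 : euclid R n)
    (alpha : R) (lx : euclid R n -> R)
    (Mopt := M_opt tf A B alpha lx)
    (opt := optimizer tf A B alpha lx)
    (uopt := (f, x0) : dual tf n)
    (rhs := (0, (f, x0)) : state tf n m) :
  0 < tf -> 0 < alpha ->
  (forall v, 0 <= lx v) -> continuous lx ->
  convex_function [set: euclid R n] lx ->
  (forall x : L2 tf n,
    (lebesgue_on tf).-integrable setT (fun t => (lx (L2_rep x t))%:E)) ->
  (forall x : L2 tf n, exists g, is_gradient (cost_x lx) x g) ->
  maximally_monotone_ph opt /\
  forall wh : state tf n m, dom Mopt wh -> Mopt wh = rhs ->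
    [/\ forall w, dom Mopt w -> Mopt w = rhs -> w = wh,
        optimal A B alpha lx f x0 wh.1,
        forall z, optimal A B alpha lx f x0 z -> z = wh.1 &
        twice_differentiable (cost alpha lx : primal tf n m -> R) ->
        (exists2 c : R, 0 < c &
          \forall x \near (wh.1.1 : L2 tf n),
            inner (gradient (cost_x lx) x - gradient (cost_x lx) wh.1.1)
                  (x - wh.1.1) >= c * `|x - wh.1.1| ^+ 2) ->
        (forall (w0 : state tf n m) (w : R -> state tf n m), dom Mopt w0 ->
          strong_solution opt (fun=> uopt) w0 w -> w t @[t --> +oo] --> wh) /\
        (exists2 delta : R, 0 < delta &
          forall (w0 : state tf n m) (w : R -> state tf n m), dom Mopt w0 ->
          strong_solution opt (fun=> uopt) w0 w -> `|w0.2 - wh.2| < delta ->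
          exists K omega : R, 0 < omega /\
            forall t, 0 <= t -> `|w t - wh| <= K * expR (- omega * t))].
Proof.
move=> tf0 alpha0 lx_ge0 _ lx_convex lx_int gradient_x.
split; first exact: optimizer_maximally_monotone.
move=> wh dwh Mwh; split.
- by move=> w; exact: kkt_unique.
- exact: kkt_optimal.
- by move=> z; exact: kkt_optimal_unique.
move=> J2 [c c0 cP].
have decay w0 w : dom Mopt w0 -> strong_solution opt (fun=> uopt) w0 w ->
    exists K omega : R, 0 < omega /\ forall t, 0 <= t -> `|w t - wh| <= K * expR (- omega * t).
  by move=> dw0 sw; exact: (optimizer_exponential tf0 alpha0 lx_ge0 lx_convex lx_int gradient_x dwh Mwh J2 c0 cP dw0 sw).
split=> [w0 w dw0 /(decay _ _ dw0)[K [omega [omega0 wwh]]]|]; first exact: expR_decay_cvg wwh.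
by exists 1 => // w0 w dw0 sw _; exact: decay sw.
Qed.
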